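(* Let $G$ be a full cubic group. Then every Dirichlet stereohedron for $G$ has at most $25$ facets; that is, for every $p\in\mathbb{R}^3$ the Voronoi cell $\mathrm{Vor}_{Gp}(p)$ has at most $25$ facets.
   Context: A crystallographic group is a discrete subgroup $G\subset\mathrm{Isom}(\mathbb{R}^3)$ containing a lattice of translations of rank $3$ as a subgroup of finite index. A cubic crystallographic group is one that contains rotations of order three in the four diagonal directions of the lattice $\mathbb{Z}^3$ (in suitable orthonormal coordinates). The odd subgroup of a cubic group is the subgroup generated by all its rotations of order three. Let $R_1$ be the group generated by the rotations of order three about all lines with directions $(\pm1,\pm1,\pm1)$ passing through points of $\mathbb{Z}^3$ (a crystallographic group of type $F23$). A full cubic group is a cubic crystallographic group whose odd subgroup equals $R_1$, up to a similarity of $\mathbb{R}^3$. (There are 27 types of such groups.) For $p\in\mathbb{R}^3$, $Gp$ is the orbit of $p$, and $\mathrm{Vor}_{Gp}(p)=\{x\in\mathbb{R}^3: |x-p|\le |x-q| \text{ for all } q\in Gp\}$ is the Voronoi cell of $p$. The polytopes $\mathrm{Vor}_{Gp}(p)$ are the Dirichlet stereohedra for $G$. Facets are 2-dimensional faces. *)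

(* Defs.v *)
From mathcomp Require Import all_boot all_order all_algebra.
From mathcomp Require Import all_classical all_reals all_analysis.

Set Implicit Arguments.
Unset Strict Implicit.
Unset Printing Implicit Defensive.

Import Order.TTheory GRing.Theory Num.Theory.
Import numFieldNormedType.Exports.

Local Open Scope classical_set_scope.
Local Open Scope ring_scope.

Section Euclidean_space.
Variable R : realType.
Local Notation E := 'rV[R]_3.
Implicit Types (p q u v x y : E) (f g : E -> E) (G H : set (E -> E)).

Definition dot u v : R := \sum_(i < 3) u 0 i * v 0 i.

(* The library norm on 'rV[R]_3 is the sup norm. *)
Definition edist x y : R := Num.sqrt (dot (x - y) (x - y)).

Definition is_isometry f := forall x y, edist (f x) (f y) = edist x y.

Definition isometry_group G :=
  [/\ forall f, G f -> is_isometry f,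
      G idfun,
      forall f g, G f -> G g -> G (f \o g)
    & forall f, G f -> exists2 g, G g & cancel f g /\ cancel g f].

Definition generated (S : set (E -> E)) : set (E -> E) :=
  smallest isometry_group S.

(* On isometries, pointwise convergence gives the usual topology of
   Isom(R^3). *)
Definition discrete G :=
  forall f, G f -> isolated (G : set {ptws E -> E}) f.

Definition finite_index H G :=
  finite_set [set [set f \o h | h in H] | f in G].

Definition translation v x : E := x + v.

Definition int_point (z : 'rV[int]_3) : E := map_mx intr z.

Definition translation_lattice (B : 'M[R]_3) : set (E -> E) :=
  range (fun z => translation (int_point z *m B)).

Definition crystallographic G :=
  [/\ isometry_group G,
      discrete G
    & exists B : 'M[R]_3,
        [/\ B \in unitmx, translation_lattice B `<=` G
          & finite_index (translation_lattice B) G]].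

Definition orthogonal_mx (A : 'M[R]_3) := A *m A^T = 1%:M.

Definition rotation_about p u f :=
  u != 0 /\
  exists A : 'M[R]_3,
    [/\ orthogonal_mx A, \det A = 1, u *m A = u
      & forall x, f x = p + (x - p) *m A].

Definition order_three f := f <> idfun /\ f \o f \o f = idfun.

Definition rotation3_about p u f := rotation_about p u f /\ order_three f.

Definition rotation3 f := exists p u, rotation3_about p u f.

Definition diagonal u := forall i, u 0 i = 1 \/ u 0 i = -1.

(* The rows of Q are the vectors of the orthonormal basis. *)
Definition cubic G :=
  crystallographic G /\
  exists2 Q : 'M[R]_3, orthogonal_mx Q &
    forall u, diagonal u ->
      exists p f, G f /\ rotation3_about p (u *m Q) f.

Definition odd_subgroup G : set (E -> E) :=
  generated (G `&` [set f | rotation3 f]).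

Definition R1 : set (E -> E) :=
  generated [set f | exists z u, diagonal u /\ rotation3_about (int_point z) u f].

Definition similarity f :=
  exists2 c : R, 0 < c & forall x y, edist (f x) (f y) = c * edist x y.

Definition full_cubic G :=
  cubic G /\
  exists s t : E -> E,
    [/\ similarity s, cancel s t, cancel t s
      & odd_subgroup G = [set s \o f \o t | f in R1]].

Definition point_orbit G p : set E := [set f p | f in G].

Definition Voronoi_cell (S : set E) p : set E :=
  [set x | forall q, S q -> edist x p <= edist x q].

Definition face (P F : set E) :=
  exists (c : E) (b : R),
    P `<=` [set x | dot c x <= b] /\ F = P `&` [set x | dot c x = b].

Definition affinely_independent k (x : 'I_k.+1 -> E) :=
  row_free (\matrix_(i < k) (x (lift ord0 i) - x ord0)).

Definition has_dim (F : set E) k :=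
  (exists2 x : 'I_k.+1 -> E, (forall i, F (x i)) & affinely_independent x) /\
  (forall x : 'I_k.+2 -> E, (forall i, F (x i)) -> ~ affinely_independent x).

Definition facet (P F : set E) := face P F /\ has_dim F 2.

End Euclidean_space.

(* Main.v *)
(** Proof idea.  After a similarity the odd subgroup of [G] is R1; being normalized
    by [G], it forces [G] into the normalizer N of R1, and N/R1 has order 16, so [G]
    is one of the groups given by the 35 subgroups of N/R1.  The centre [p] can be
    moved by N into a fundamental tetrahedron of N.

    For an isometry [g], [B_g(x, p) = |x - g p|^2 - |x - p|^2] is affine in [x] and
    affine in [p].  For [p] in the relative interior of one of a few pieces of the
    tetrahedron, some explicit inequalities [B_g(x, p) >= 0] put [x] into a fixed
    region with 8 vertices; there, identities [d(p) B_g >= sum_j q_j(p) B_j] with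
    forms [d], [q_j] having nonnegative coefficients, checked at the vertices, derive
    all the inequalities from a short list.  A point [p0] on a face is the limit of
    such [p]: the Voronoi cell of [p0] is defined by the images [s k p0], where [s]
    stabilizes [p0] and [k] runs over the short list of the piece.  There are at most
    25 of them other than [p0] (at the origin, after discarding sums of two shorter
    ones), and a polytope defined by 25 half-spaces has at most 25 facets. *)
Require Import Defs.
From Stdlib Require Import ZArith.
From mathcomp Require Import all_boot all_order all_algebra.
From mathcomp Require Import all_classical all_reals all_analysis.
From mathcomp Require Import ssrZ zify ring lra.
Set Implicit Arguments.
Unset Strict Implicit.
Unset Printing Implicit Defensive.
Import Order.TTheory GRing.Theory Num.Theory.

(** * Isometries normalizing R1 *)

(** In coordinates multiplied by 4 the translations of the normalizer form the body-centred lattice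
    of vectors [2 e (1, 1, 1) + 4 m], those of R1 the face-centred lattice of vectors [4 d] with
    [d1 + d2 + d3] even. The quotient is cyclic of order 4; the 48 signed permutations over the 12
    linear parts of R1 give another factor 4, whence the order 16. Membership of an isometry in the
    group depends only on its coset modulo R1. So a single table of facts about the normalizer
    serves all subgroups: a fact counts if its coset is in the subgroup, a reason if those of its
    premises are. At a vertex of the region [B_g] is a linear form, with integer coefficients, in
    the barycentric weights of the centre, so an inequality over the region and a piece becomes a
    check of integer signs. Multipliers that vary with the centre let the combination of half-spaces
    change across a piece. They may vanish on its boundary, where moreover distinct isometries can
    have the same image; hence the passage to the limit, in which the stabilizer of the limit centre
    supplies the additional images. *)

Inductive axis := X1 | X2 | X3.
Definition lin := ((axis * bool) * (axis * bool) * (axis * bool))%type.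

(** The negation is a parameter so that the same code acts on integer triples, on real triples, and
    on the rows of another signed permutation. *)
Definition sel T (opp : T -> T) (r : axis * bool) (x : T * T * T) : T :=
  let: (x1, x2, x3) := x in
  let v := match r.1 with X1 => x1 | X2 => x2 | X3 => x3 end in
  if r.2 then opp v else v.

Definition lapp T (opp : T -> T) (l : lin) (x : T * T * T) : T * T * T :=
  (sel opp l.1.1 x, sel opp l.1.2 x, sel opp l.2 x).

Definition axes (l : lin) := (l.1.1.1, l.1.2.1, l.2.1).

Definition odd_axes (l : lin) : bool :=
  match axes l with
  | (X1, X2, X3) | (X2, X3, X1) | (X3, X1, X2) => false
  | _ => true
  end.

Definition perm_axes (l : lin) : bool :=
  match axes l with
  | (X1, X2, X3) | (X2, X3, X1) | (X3, X1, X2)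
  | (X1, X3, X2) | (X2, X1, X3) | (X3, X2, X1) => true
  | _ => false
  end.

Definition flips (l : lin) : bool := l.1.1.2 (+) l.1.2.2 (+) l.2.2.

Section IntegerComputations.
Local Open Scope Z_scope.

(* The code [(l, b)] stands for the isometry [x |-> l x + b], in coordinates
   multiplied by 4, so that all the points and translations that occur are
   integral.  The codes with [wf] form the normalizer of R1. *)
Definition zvec := (Z * Z * Z)%type.
Definition code := (lin * zvec)%type.

Definition zadd (x y : zvec) : zvec :=
  let: (x1, x2, x3) := x in let: (y1, y2, y3) := y in (x1 + y1, x2 + y2, x3 + y3).

Definition zdist (x y : zvec) : Z :=
  let: (x1, x2, x3) := x in let: (y1, y2, y3) := y in
  (x1 - y1) * (x1 - y1) + (x2 - y2) * (x2 - y2) + (x3 - y3) * (x3 - y3).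

Definition zapp (g : code) (x : zvec) : zvec := zadd (lapp Z.opp g.1 x) g.2.

Definition zB (g : code) (v t : zvec) : Z := zdist v (zapp g t) - zdist v t.

Definition in_lattice (b : zvec) : bool :=
  let: (b1, b2, b3) := b in
  [&& b1 mod 2 =? 0, (b1 - b2) mod 4 =? 0 & (b1 - b3) mod 4 =? 0].

Definition wf (g : code) : bool := perm_axes g.1 && in_lattice g.2.

(** On [in_lattice] vectors this is a homomorphism onto Z/4 whose kernel is the translation lattice
    of R1. *)
Definition shift_class (b : zvec) : Z :=
  let: (b1, b2, b3) := b in ((b1 + b2 + b3) / 2) mod 4.

(* [cls g] determines the coset of [g] modulo R1, the codes of class
   [(false, false, 0)]; [mulc] is the product of the quotient group of order 16. *)
Definition coset := (bool * bool * Z)%type.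
Definition cls (g : code) : coset := (odd_axes g.1, flips g.1, shift_class g.2).
Definition mulc (a b : coset) : coset :=
  let: (e, d, k) := a in let: (e', d', k') := b in
  (e (+) e', d (+) d', (if d then k - k' else k + k') mod 4).

(** The position of [a] in [all_cosets]; a subgroup is a list of 16 booleans read at these
    positions. *)
Definition cindex (a : coset) : nat :=
  let: (e, d, k) := a in
  ((if e then 8 else 0) + ((if d then 4 else 0) + Z.to_nat k))%N.

Definition zeqv (x y : zvec) : bool :=
  let: (x1, x2, x3) := x in let: (y1, y2, y3) := y in
  [&& x1 =? y1, x2 =? y2 & x3 =? y3].
Definition eqaxis a b :=
  match a, b with X1, X1 | X2, X2 | X3, X3 => true | _, _ => false end.
Definition eqrow (r s : axis * bool) := eqaxis r.1 s.1 && (eqb r.2 s.2).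
Definition eqlin (l m : lin) :=
  [&& eqrow l.1.1 m.1.1, eqrow l.1.2 m.1.2 & eqrow l.2 m.2].
Definition eqcode (g h : code) := eqlin g.1 h.1 && zeqv g.2 h.2.

(* The vertices of the two pieces of the region [body] below. *)
Definition bodyv : seq zvec :=
  [:: (0, 0, 0); (4, 0, 0); (0, 4, 0); (4, 4, 0);
      (2, -2, 2); (2, 2, 2); (2, 0, -2); (2, 2, -2)].

(* Piece 0 is a fundamental tetrahedron of the normalizer; pieces 1 and 2 are
   the halves into which the plane through [v0], [v3] and [vm] cuts it, and piece
   3 is a facet of pieces 0 and 1.  Only the relative interiors matter. *)
Definition v0 : zvec := (0, 0, 0).
Definition v1 : zvec := (2, 0, 0).
Definition v2 : zvec := (2, 2, 0).
Definition v3 : zvec := (1, 1, 1).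
Definition vm : zvec := (2, 1, 0).

Definition piece (n : nat) : seq zvec :=
  match n with
  | 0 => [:: v0; v1; v3; v2]
  | 1 => [:: v0; v1; v3; vm]
  | 2 => [:: v0; vm; v3; v2]
  | _ => [:: v0; v1; v3]
  end%N.

Definition monomial := seq nat.
Definition monomials (n : nat) : seq monomial :=
  match n with
  | 1 => [:: [::]]
  | 3 => [:: [:: 0]; [:: 1]; [:: 2]]
  | 4 => [:: [:: 0]; [:: 1]; [:: 2]; [:: 3]]
  | 10 => [:: [:: 0; 0]; [:: 0; 1]; [:: 0; 2]; [:: 0; 3]; [:: 1; 1]; [:: 1; 2];
              [:: 1; 3]; [:: 2; 2]; [:: 2; 3]; [:: 3; 3]]
  | 20 => [:: [:: 0; 0; 0]; [:: 0; 0; 1]; [:: 0; 0; 2]; [:: 0; 0; 3]; [:: 0; 1; 1];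
              [:: 0; 1; 2]; [:: 0; 1; 3]; [:: 0; 2; 2]; [:: 0; 2; 3]; [:: 0; 3; 3];
              [:: 1; 1; 1]; [:: 1; 1; 2]; [:: 1; 1; 3]; [:: 1; 2; 2]; [:: 1; 2; 3];
              [:: 1; 3; 3]; [:: 2; 2; 2]; [:: 2; 2; 3]; [:: 2; 3; 3]; [:: 3; 3; 3]]
  | _ => [::]
  end%N.

(* A list of 1, 4, 10 or 20 coefficients stands for a form of degree 0, 1, 2
   or 3 in the barycentric coordinates of a tetrahedron, a list of 3 for a
   linear form in those of a triangle. *)
Definition bform := seq Z.
Definition terms (q : bform) : seq (monomial * Z) := zip (monomials (size q)) q.

(** Monomials are kept sorted so that equal products of weights are recognized and their
    coefficients merged. *)
Fixpoint insert (i : nat) (m : monomial) : monomial :=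
  if m is j :: m' then if (i <= j)%N then i :: m else j :: insert i m' else [:: i].

Fixpoint add_term (m : monomial) (c : Z) (l : seq (monomial * Z)) :=
  if l is (m', c') :: l' then
    if m == m' then (m', c' + c) :: l' else (m', c') :: add_term m c l'
  else [:: (m, c)].

Definition add_product (s : Z) (q : seq (monomial * Z)) (f : seq Z) l :=
  foldr (fun mc l => let: (m, c) := mc in
    if c =? 0 then l else
    foldr (fun ia l => let: (i, a) := ia in
      add_term (insert i m) (s * c * a) l) l (zip (iota 0 (size f)) f)) l q.

Definition values (g : code) (v : zvec) (t : seq zvec) : seq Z :=
  [seq zB g v x | x <- t].

Definition all_ge0 (l : seq (monomial * Z)) : bool := all (fun mc => 0 <=? mc.2) l.

(* Here [d] and the forms [q] of [l] have nonnegative coefficients, [d] is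
   positive at the points whose first three weights are positive, and
   [d B_g >= sum q_j B_j] holds coefficientwise at each vertex of [body], hence,
   both sides being affine in [x], on the whole of [body]. *)
Definition certified (g : code) (t : seq zvec) (d : bform) (l : seq (code * bform)) :=
  [&& all (Z.leb 0) d, all (fun jq => all (Z.leb 0) jq.2) l,
      has (fun mc => (0 <? mc.2) && all (fun i => i < 3)%N mc.1) (terms d) &
      all (fun v => all_ge0
        (foldr (fun jq s => add_product (-1) (terms jq.2) (values jq.1 v t) s)
           (add_product 1 (terms d) (values g v t) [::]) l)) bodyv].

Definition dominated (g h : code) (t : seq zvec) : bool :=
  let: gt := [seq zapp g x | x <- t] in let: ht := [seq zapp h x | x <- t] in
  all (fun v => all (fun xy => zdist v xy.2 <=? zdist v xy.1) (zip gt ht)) bodyv.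

Definition nonneg_on_body (g : code) (t : seq zvec) : bool :=
  all (fun x => let gx := zapp g x in
    all (fun v => zdist v x <=? zdist v gx) bodyv) t.

(* A fact [(n, rs)] lists reasons why the half-space of [decode n] contains the
   intersection of the half-spaces of earlier facts: [Dom i j] compares it with
   fact [j] for centres in piece [i], and [Pol i d l] is a certificate as above.
   Which reasons apply depends on the subgroup, which must contain the premises. *)
Inductive reason :=
  | Dom of nat & nat
  | Pol of nat & bform & seq (nat * bform).

Definition fact := (Z * seq reason)%type.

Definition axes_of (n : Z) : axis * axis * axis :=
  match n with
  | 0 => (X1, X2, X3) | 1 => (X1, X3, X2) | 2 => (X2, X1, X3)
  | 3 => (X2, X3, X1) | 4 => (X3, X1, X2) | _ => (X3, X2, X1)
  end.

Definition lin_of (n : Z) : lin :=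
  let: (a1, a2, a3) := axes_of (n / 8) in
  ((a1, Z.testbit n 2), (a2, Z.testbit n 1), (a3, Z.testbit n 0)).

(** Each of the last three hexadecimal digits is one translation coordinate, the digit 8 standing
    for 0; the leading part gives the axes and the three signs. *)
Definition decode (n : Z) : code :=
  (lin_of (n / 4096),
   (2 * ((n / 256) mod 16) - 16, 2 * ((n / 16) mod 16) - 16, 2 * (n mod 16) - 16)).

End IntegerComputations.

(** * The table of implications between half-spaces *)

Section Facts.
Local Open Scope Z_scope.
Let D (n : Z) (i j : nat) : fact := (n, [:: Dom i j]).

(* Found by computer search; an isometry precedes those it helps to exclude. *)
Definition facts : seq fact :=
  [:: (34952, [::]); (6280, [::]); (194969, [::]); (67720, [::]); (39048, [::]); (43144, [::]);
  (129433, [::]); (162201, [::]); (71816, [:: Pol 0 [:: 1] [:: (1%N, [:: 1]); (3%N, [:: 1])]]);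
  (133256, [::]); (100488, [::]); (190871, [:: Pol 0 [:: 0; 0; 1; 0] [:: (1%N, [:: 2; 0; 1; 0]);
  (2%N, [:: 0; 0; 1; 0])]]); (19080, [::]); (178585, [:: Pol 0 [:: 2; 0; 1; 0] [:: (2%N, [:: 2; 0;
  1; 0]); (12%N, [:: 0; 0; 1; 0])]]); (10376, [::]); (96665, [:: Pol 2 [:: 0; 1; 0; 2] [:: (2%N, [::
  0; 1; 0; 2]); (10%N, [:: 0; 1; 0; 0])]; Dom 0 7]); (47240, [::]); (145817, [:: Pol 0 [:: 2; 0; 1;
  0] [:: (7%N, [:: 2; 0; 1; 0]); (12%N, [:: 0; 0; 1; 0])]]); (125335, [:: Pol 0 [:: 0; 1; 0; 0] [::
  (3%N, [:: 0; 0; 0; 1]); (11%N, [:: 0; 1; 0; 0])]]); (51848, [:: Pol 0 [:: 1] [:: (0%N, [:: 1]);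
  (12%N, [:: 1])]]); (14472, [::]); (23176, [::]); (174487, [:: Pol 0 [:: 2; 0; 1; 0] [:: (11%N, [::
  2; 0; 1; 0]); (12%N, [:: 0; 0; 1; 0])]]); (63897, [:: Pol 1 [:: 0; 2; 0; 1] [:: (2%N, [:: 0; 2; 0;
  1]); (9%N, [:: 0; 0; 0; 1])]; Dom 0 6]); (31129, [:: Pol 0 [:: 1] [:: (6%N, [:: 1]); (10%N, [::
  1])]]); (158103, [:: Pol 0 [:: 0; 0; 1; 1] [:: (11%N, [:: 0; 0; 1; 1]); (16%N, [:: 0; 1; 0;
  0])]]); (10408, [::]); (121241, [:: Pol 0 [:: 2; 2; 1; 0] [:: (6%N, [:: 2; 2; 1; 0]); (26%N, [::
  0; 0; 1; 0])]]); (60040, [:: Pol 0 [:: 1] [:: (5%N, [:: 1]); (12%N, [:: 1])]]); (55944, [:: Pol 0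
  [:: 1] [:: (4%N, [:: 1]); (12%N, [:: 1]); (21%N, [:: 0])]]); (153977, [:: Pol 2 [:: 0; 1; 0; 2]
  [:: (0%N, [:: 4; 1; 2; 0]); (11%N, [:: 0; 1; 0; 2])]]); (92840, [::]); (113049, [:: Pol 0 [:: 2;
  0; 1; 0] [:: (6%N, [:: 2; 0; 1; 0]); (12%N, [:: 0; 0; 1; 2])]; Pol 0 [:: 2; 1; 1; 0] [:: (13%N,
  [:: 2; 1; 1; 0]); (31%N, [:: 0; 0; 0; 1])]]); (75944, [:: Pol 3 [:: 0; 1; 0] [:: (9%N, [:: 2; 1;
  1]); (19%N, [:: 0; 1; 0])]]); (117143, [:: Pol 0 [:: 0; 4; 0; 0; 0; 4; 0; 2; 2; 0; 0; 0; 0; 2; 0;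
  0; 1; 1; 0; 0] [:: (6%N, [:: 0; 0; 0; 0; 0; 0; 0; 2; 2; 0; 0; 0; 0; 0; 0; 0; 1; 1; 0; 0]); (8%N,
  [:: 0; 0; 4; 4; 0; 0; 0; 4; 4; 0; 0; 0; 0; 0; 0; 0; 1; 1; 0; 0]); (13%N, [:: 0; 0; 0; 0; 0; 0; 0;
  0; 0; 0; 0; 0; 0; 1; 0; 0; 0; 0; 0; 0]); (11%N, [:: 0; 4; 0; 0; 0; 4; 0; 0; 0; 0; 0; 0; 0; 1; 0;
  0; 0; 0; 0; 0]); (21%N, [:: 0; 0; 0; 0; 0; 2; 0; 0; 0; 0; 0; 0; 0; 1; 0; 0; 0; 0; 0; 0]); (33%N,
  [:: 0; 0; 0; 0; 0; 0; 0; 0; 0; 0; 0; 0; 0; 0; 0; 0; 1; 1; 0; 0])]; Pol 0 [:: 2; 2; 1; 0] [::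
  (18%N, [:: 2; 2; 1; 0]); (26%N, [:: 0; 0; 1; 0])]]); (141719, [:: Pol 0 [:: 2; 0; 1; 0] [:: (12%N,
  [:: 0; 0; 1; 0]); (25%N, [:: 2; 0; 1; 0])]]); (27272, [:: Pol 0 [:: 0; 0; 1; 1] [:: (5%N, [:: 0;
  0; 1; 0]); (19%N, [:: 0; 0; 1; 0]); (20%N, [:: 0; 0; 0; 1]); (21%N, [:: 0; 0; 0; 1])]; Pol 0 [::
  0; 0; 1; 1] [:: (16%N, [:: 0; 0; 0; 1]); (28%N, [:: 0; 0; 1; 1])]; Pol 0 [:: 1] [:: (14%N, [::
  1]); (12%N, [:: 1])]]); (80281, [:: Pol 0 [:: 2; 0; 1; 0] [:: (12%N, [:: 0; 0; 1; 2]); (15%N, [::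
  2; 0; 1; 0])]; Dom 0 17]); (88441, [:: Pol 2 [:: 0; 1; 2; 2] [:: (5%N, [:: 4; 0; 2; 0]); (7%N, [::
  0; 0; 2; 0]); (10%N, [:: 0; 1; 0; 0]); (11%N, [:: 0; 1; 0; 2])]; Pol 0 [:: 0; 0; 1; 2] [:: (14%N,
  [:: 2; 0; 1; 0]); (15%N, [:: 0; 0; 1; 2])]; Dom 0 30]); (64136, [:: Pol 0 [:: 0; 0; 2; 2] [::
  (4%N, [:: 0; 0; 1; 2]); (5%N, [:: 0; 0; 1; 0]); (21%N, [:: 0; 0; 1; 2]); (36%N, [:: 0; 0; 1;
  0])]]); (108951, [:: Pol 0 [:: 2; 1; 1; 0] [:: (22%N, [:: 2; 1; 1; 0]); (31%N, [:: 0; 0; 0; 1])];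
  Pol 0 [:: 2; 0; 1; 0] [:: (12%N, [:: 0; 0; 1; 2]); (18%N, [:: 2; 0; 1; 0])]]); (137593, [:: Pol 2
  [:: 0; 0; 0; 0; 1; 2; 2; 2; 2; 0] [:: (4%N, [:: 0; 2; 0; 0; 0; 0; 0; 0; 0; 0]); (5%N, [:: 0; 2; 4;
  0; 1; 2; 0; 2; 0; 0]); (13%N, [:: 0; 0; 0; 0; 1; 2; 2; 2; 0; 0]); (35%N, [:: 0; 0; 0; 0; 0; 0; 0;
  0; 2; 0])]; Pol 2 [:: 0; 1; 0; 2] [:: (0%N, [:: 4; 1; 2; 0]); (22%N, [:: 0; 1; 0; 2])]; Pol 0 [::
  2; 0; 1; 0] [:: (12%N, [:: 0; 0; 1; 0]); (30%N, [:: 2; 0; 1; 0])]]); (112776, [::]); (153736,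
  [::]); (59799, [:: Pol 1 [:: 0; 1; 1; 1] [:: (8%N, [:: 0; 0; 0; 1]); (9%N, [:: 0; 0; 1; 0]);
  (11%N, [:: 0; 1; 1; 1]); (42%N, [:: 0; 1; 0; 0])]; Pol 2 [:: 0; 0; 1; 0] [:: (1%N, [:: 2; 1; 1;
  0]); (23%N, [:: 0; 0; 1; 0])]; Dom 0 18]); (92567, [:: Pol 2 [:: 0; 3; 4; 6] [:: (11%N, [:: 0; 3;
  2; 4]); (42%N, [:: 0; 3; 0; 2]); (44%N, [:: 0; 0; 2; 2])]; Dom 0 25]); (31368, [:: Pol 0 [:: 1]
  [:: (12%N, [:: 1]); (20%N, [:: 1])]]); (55705, [:: Pol 2 [:: 2; 1; 1; 0] [:: (23%N, [:: 2; 1; 1;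
  0]); (26%N, [:: 0; 0; 1; 0])]; Pol 0 [:: 2; 1; 1; 0] [:: (6%N, [:: 2; 1; 1; 0]); (33%N, [:: 0; 0;
  1; 0])]; Dom 0 27]); (186745, [:: Pol 0 [:: 0; 0; 1; 1] [:: (4%N, [:: 0; 1; 0; 0]); (5%N, [:: 2;
  1; 1; 0]); (7%N, [:: 0; 0; 1; 0]); (11%N, [:: 0; 0; 0; 1])]; Pol 0 [:: 0; 0; 1; 1] [:: (16%N, [::
  0; 1; 0; 0]); (30%N, [:: 0; 0; 1; 1])]; Pol 0 [:: 0; 0; 1; 2] [:: (2%N, [:: 0; 0; 1; 2]); (14%N,
  [:: 2; 2; 1; 0])]]); (27304, [::]); (186777, [:: Pol 0 [:: 2; 1; 1; 0] [:: (6%N, [:: 2; 0; 1; 0]);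
  (13%N, [:: 0; 1; 0; 0]); (33%N, [:: 0; 0; 1; 0]); (49%N, [:: 0; 0; 0; 1])]; Pol 0 [:: 2; 1; 1; 0]
  [:: (27%N, [:: 2; 1; 1; 0]); (31%N, [:: 0; 0; 0; 1])]; Pol 0 [:: 2; 2; 1; 0] [:: (2%N, [:: 2; 2;
  1; 0]); (26%N, [:: 0; 0; 1; 2])]]); D 75912 1 5; (84616, [:: Pol 0 [:: 2; 0; 1; 0] [:: (3%N, [::
  2; 0; 1; 0]); (12%N, [:: 2; 2; 1; 0])]]); (149879, [:: Pol 0 [:: 0; 0; 2; 2] [:: (4%N, [:: 0; 2;
  0; 0]); (11%N, [:: 0; 0; 1; 2]); (20%N, [:: 2; 0; 1; 0]); (48%N, [:: 0; 0; 1; 0])]]); (104857, [::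
  Pol 0 [:: 2; 2; 1; 0] [:: (6%N, [:: 2; 0; 1; 0]); (12%N, [:: 0; 0; 0; 2]); (32%N, [:: 0; 2; 0;
  0]); (49%N, [:: 0; 0; 1; 0])]; Pol 0 [:: 2; 2; 1; 0] [:: (6%N, [:: 2; 0; 1; 0]); (13%N, [:: 0; 2;
  0; 0]); (52%N, [:: 0; 0; 0; 2]); (49%N, [:: 0; 0; 1; 0])]]); (27031, [:: Pol 0 [:: 0; 1; 1; 1] [::
  (18%N, [:: 0; 0; 1; 1]); (25%N, [:: 0; 1; 0; 0]); (42%N, [:: 0; 0; 0; 1]); (43%N, [:: 0; 1; 0;
  0])]]); (80040, [:: Pol 0 [:: 0; 1; 0; 0] [:: (3%N, [:: 2; 1; 1; 0]); (21%N, [:: 0; 1; 0; 0])]]);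
  (88712, [:: Pol 0 [:: 2; 1; 1; 0] [:: (21%N, [:: 2; 1; 1; 0]); (31%N, [:: 0; 1; 0; 0])]]);
  (182679, [:: Pol 0 [:: 2; 1; 1; 0] [:: (18%N, [:: 2; 0; 1; 0]); (22%N, [:: 0; 1; 0; 0]); (33%N,
  [:: 0; 0; 1; 0]); (49%N, [:: 0; 0; 0; 1])]; Pol 0 [:: 2; 1; 1; 0] [:: (34%N, [:: 2; 1; 1; 0]);
  (31%N, [:: 0; 0; 0; 1])]; Pol 0 [:: 2; 2; 1; 0] [:: (11%N, [:: 2; 2; 1; 0]); (26%N, [:: 0; 0; 1;
  2])]]); (170361, [:: Pol 0 [:: 0; 0; 1; 1] [:: (4%N, [:: 0; 1; 0; 0]); (5%N, [:: 2; 1; 1; 0]);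
  (17%N, [:: 0; 0; 1; 0]); (22%N, [:: 0; 0; 0; 1])]; Pol 0 [:: 0; 0; 1; 1] [:: (16%N, [:: 0; 1; 0;
  0]); (41%N, [:: 0; 0; 1; 1])]; Pol 0 [:: 2; 0; 1; 0] [:: (12%N, [:: 0; 0; 1; 0]); (48%N, [:: 2; 0;
  1; 0])]]); (170393, [:: Pol 0 [:: 2; 2; 1; 0] [:: (2%N, [:: 2; 0; 1; 0]); (32%N, [:: 0; 2; 0; 0]);
  (33%N, [:: 0; 0; 0; 2]); (49%N, [:: 0; 0; 1; 0])]; Pol 0 [:: 2; 2; 1; 0] [:: (2%N, [:: 2; 0; 1;
  0]); (13%N, [:: 0; 2; 0; 0]); (26%N, [:: 0; 0; 0; 2]); (49%N, [:: 0; 0; 1; 0])]]); (182647, [::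
  Pol 1 [:: 0; 0; 30; 12; 0; 10; 2; 12; 12; 0] [:: (15%N, [:: 0; 0; 0; 0; 0; 4; 0; 0; 0; 0]); (20%N,
  [:: 24; 28; 39; 12; 4; 16; 2; 12; 12; 0]); (21%N, [:: 0; 0; 6; 0; 0; 0; 0; 0; 0; 0]); (22%N, [::
  0; 0; 0; 12; 0; 0; 2; 0; 0; 0]); (59%N, [:: 0; 0; 6; 0; 0; 6; 0; 0; 0; 0])]; Pol 0 [:: 0; 0; 2; 2]
  [:: (5%N, [:: 0; 2; 0; 0]); (20%N, [:: 2; 0; 1; 0]); (25%N, [:: 0; 0; 1; 2]); (30%N, [:: 0; 0; 1;
  0])]; Pol 0 [:: 0; 0; 1; 0] [:: (1%N, [:: 2; 0; 1; 0]); (48%N, [:: 0; 0; 1; 0])]]); (141480, [::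
  Pol 0 [:: 2; 2; 1; 0] [:: (9%N, [:: 2; 2; 1; 0]); (26%N, [:: 2; 0; 1; 0])]]); (100759, [:: Pol 0
  [:: 2; 2; 1; 0] [:: (12%N, [:: 0; 0; 0; 2]); (18%N, [:: 2; 0; 1; 0]); (40%N, [:: 0; 2; 0; 0]);
  (49%N, [:: 0; 0; 1; 0])]; Pol 0 [:: 2; 2; 1; 0] [:: (18%N, [:: 2; 0; 1; 0]); (22%N, [:: 0; 2; 0;
  0]); (52%N, [:: 0; 0; 0; 2]); (49%N, [:: 0; 0; 1; 0])]]); (133495, [:: Pol 0 [:: 0; 0; 2; 2] [::
  (4%N, [:: 2; 2; 0; 0]); (5%N, [:: 2; 0; 0; 0]); (20%N, [:: 0; 0; 1; 0]); (22%N, [:: 0; 0; 1; 2]);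
  (59%N, [:: 0; 0; 1; 0])]; Pol 0 [:: 2; 0; 1; 0] [:: (12%N, [:: 0; 0; 1; 0]); (53%N, [:: 2; 0; 1;
  0])]]); (76185, [:: Dom 0 7; Dom 0 17; Dom 0 37]); (125576, [:: Pol 0 [:: 0; 0; 2; 2] [:: (5%N,
  [:: 0; 0; 1; 0]); (19%N, [:: 0; 0; 1; 2]); (36%N, [:: 0; 0; 1; 0])]; Dom 0 28; Dom 3 36]);
  (158376, [::]); (39321, [:: Pol 0 [:: 2; 2; 1; 0] [:: (17%N, [:: 0; 2; 0; 0]); (23%N, [:: 2; 0; 1;
  0]); (52%N, [:: 0; 2; 0; 2]); (49%N, [:: 0; 0; 1; 0])]; Pol 1 [:: 4; 2; 2; 1] [:: (2%N, [:: 4; 2;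
  2; 1]); (67%N, [:: 0; 0; 2; 1])]; Dom 0 54]); (72057, [:: Pol 2 [:: 190; 36; 52; 20; 8; 2; 39; 0;
  10; 10] [:: (2%N, [:: 0; 120; 0; 60; 8; 34; 21; 0; 10; 0]); (10%N, [:: 90; 16; 20; 0; 0; 0; 0; 0;
  0; 0]); (21%N, [:: 0; 0; 0; 0; 0; 0; 18; 0; 0; 0]); (59%N, [:: 190; 16; 52; 0; 0; 0; 0; 0; 0; 0]);
  (65%N, [:: 0; 0; 0; 0; 0; 0; 18; 0; 0; 0]); (66%N, [:: 0; 20; 0; 0; 8; 2; 5; 0; 10; 10]); (68%N,
  [:: 0; 0; 0; 0; 0; 0; 0; 0; 0; 10])]; Pol 0 [:: 2; 0; 1; 0] [:: (12%N, [:: 0; 0; 1; 2]); (38%N,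
  [:: 2; 0; 1; 0])]; Dom 0 41]); (121209, [:: Pol 0 [:: 0; 0; 1; 1] [:: (5%N, [:: 2; 0; 1; 0]);
  (15%N, [:: 0; 0; 1; 0]); (18%N, [:: 0; 0; 0; 1]); (20%N, [:: 0; 1; 0; 1])]; Dom 0 48]); (51607,
  [:: Pol 0 [:: 2; 1; 1; 0] [:: (18%N, [:: 2; 1; 1; 0]); (33%N, [:: 0; 0; 1; 0])]; Pol 0 [:: 2; 2;
  1; 0] [:: (44%N, [:: 2; 2; 1; 0]); (26%N, [:: 0; 0; 1; 0])]; Dom 0 34]); (84343, [:: Pol 0 [:: 0;
  0; 2; 2] [:: (4%N, [:: 2; 2; 0; 2]); (5%N, [:: 2; 0; 0; 0]); (18%N, [:: 0; 0; 1; 2]); (20%N, [::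
  0; 0; 1; 0]); (70%N, [:: 0; 0; 1; 0])]; Dom 0 53]); (42903, [:: Pol 1 [:: 8; 6; 4; 3] [:: (2%N,
  [:: 8; 2; 4; 3]); (43%N, [:: 8; 4; 4; 3]); (72%N, [:: 0; 4; 0; 0])]; Dom 0 6; Dom 0 18; Dom 0
  44]); (76183, [:: Pol 2 [:: 0; 2952; 4592; 2640; 0; 1722; 0; 984; 672; 0] [:: (10%N, [:: 0; 0; 0;
  0; 0; 0; 0; 492; 0; 0]); (21%N, [:: 0; 0; 0; 0; 1476; 820; 2472; 0; 804; 672]); (22%N, [:: 0;
  2952; 4592; 2136; 0; 1640; 0; 984; 870; 0]); (42%N, [:: 0; 2952; 0; 1008; 0; 0; 0; 0; 0; 0]);
  (43%N, [:: 0; 0; 0; 168; 0; 0; 0; 0; 0; 0]); (61%N, [:: 0; 0; 0; 0; 0; 369; 0; 0; 0; 0]); (58%N,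
  [:: 0; 0; 0; 504; 0; 246; 0; 0; 318; 0]); (72%N, [:: 0; 0; 0; 0; 0; 123; 0; 0; 60; 0]); (66%N, [::
  0; 0; 0; 0; 0; 0; 0; 0; 60; 0]); (68%N, [:: 0; 0; 0; 0; 0; 0; 0; 0; 294; 0]); (73%N, [:: 0; 0; 0;
  0; 0; 0; 0; 0; 234; 0])]; Pol 0 [:: 10; 0; 6; 2] [:: (4%N, [:: 2; 2; 0; 2]); (17%N, [:: 0; 0; 1;
  0]); (19%N, [:: 0; 0; 4; 0]); (21%N, [:: 0; 0; 1; 6]); (25%N, [:: 10; 0; 5; 0]); (63%N, [:: 0; 0;
  0; 2])]; Pol 0 [:: 2; 0; 1; 0] [:: (12%N, [:: 0; 0; 1; 2]); (45%N, [:: 2; 0; 1; 0])]; Dom 0 35]);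
  (166263, [:: Pol 0 [:: 0; 0; 2; 2] [:: (4%N, [:: 2; 0; 1; 0]); (5%N, [:: 2; 2; 1; 0]); (35%N, [::
  0; 0; 1; 2]); (41%N, [:: 0; 0; 1; 0])]; Pol 0 [:: 2; 0; 1; 0] [:: (12%N, [:: 0; 0; 1; 0]); (61%N,
  [:: 2; 0; 1; 0])]]); (166295, [:: Pol 0 [:: 2; 2; 1; 0] [:: (11%N, [:: 2; 0; 1; 0]); (22%N, [:: 0;
  2; 0; 0]); (26%N, [:: 0; 0; 0; 2]); (49%N, [:: 0; 0; 1; 0])]; Pol 0 [:: 2; 2; 1; 0] [:: (11%N, [::
  2; 0; 1; 0]); (40%N, [:: 0; 2; 0; 0]); (33%N, [:: 0; 0; 0; 2]); (49%N, [:: 0; 0; 1; 0])]]);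
  (145576, [:: Pol 0 [:: 2; 2; 1; 0] [:: (8%N, [:: 2; 1; 1; 0]); (21%N, [:: 0; 1; 0; 0]); (33%N, [::
  2; 1; 1; 0])]; Pol 3 [:: 0; 1; 0] [:: (9%N, [:: 2; 1; 1]); (21%N, [:: 0; 1; 0])]; Dom 0 56]);
  (121482, [::]); (47513, [:: Pol 1 [:: 8; 4; 4; 3] [:: (13%N, [:: 4; 2; 2; 3]); (37%N, [:: 4; 2; 2;
  0]); (78%N, [:: 0; 2; 0; 0]); (67%N, [:: 0; 2; 0; 3])]; Pol 0 [:: 2; 0; 1; 0] [:: (12%N, [:: 0; 2;
  1; 2]); (23%N, [:: 2; 0; 1; 0])]; Dom 0 32]); (14745, [:: Pol 0 [:: 2; 1; 1; 0] [:: (17%N, [:: 2;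
  1; 1; 0]); (67%N, [:: 0; 1; 0; 0])]]); (117111, [:: Pol 0 [:: 0; 0; 2; 2] [:: (4%N, [:: 0; 0; 1;
  0]); (5%N, [:: 0; 2; 1; 2]); (20%N, [:: 2; 0; 0; 0]); (38%N, [:: 0; 0; 1; 0]); (45%N, [:: 0; 0; 1;
  2])]; Pol 2 [:: 0; 1; 2; 1] [:: (10%N, [:: 0; 0; 2; 1]); (20%N, [:: 0; 1; 0; 0]); (43%N, [:: 0; 0;
  0; 1]); (53%N, [:: 0; 1; 2; 1])]; Dom 0 61]); (14504, [:: Pol 1 [:: 3; 2; 0; 3] [:: (9%N, [:: 3;
  1; 0; 0]); (11%N, [:: 0; 1; 0; 3]); (45%N, [:: 0; 1; 0; 0]); (50%N, [:: 0; 2; 0; 3]); (77%N, [::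
  3; 0; 0; 0])]; Pol 1 [:: 6; 4; 0; 3] [:: (2%N, [:: 0; 4; 0; 5]); (9%N, [:: 2; 0; 0; 0]); (58%N,
  [:: 0; 2; 0; 3]); (71%N, [:: 0; 2; 0; 0]); (77%N, [:: 6; 0; 0; 0])]; Pol 0 [:: 2; 1; 1; 0] [::
  (8%N, [:: 2; 0; 1; 0]); (21%N, [:: 0; 1; 0; 0]); (33%N, [:: 2; 0; 1; 0]); (49%N, [:: 0; 1; 0;
  0])]; Pol 0 [:: 2; 1; 1; 0] [:: (56%N, [:: 2; 1; 1; 0]); (31%N, [:: 0; 1; 0; 0])]; Pol 0 [:: 1]
  [:: (1%N, [:: 1]); (26%N, [:: 1])]]); (121480, [:: Pol 0 [:: 0; 6; 8; 8; 0; 7; 0; 4; 4; 0] [::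
  (10%N, [:: 0; 0; 0; 0; 0; 1; 0; 0; 0; 0]); (21%N, [:: 0; 6; 8; 8; 6; 8; 8; 4; 4; 0]); (36%N, [::
  0; 0; 0; 0; 0; 3; 0; 0; 0; 0]); (42%N, [:: 0; 6; 0; 8; 0; 0; 0; 0; 4; 0]); (82%N, [:: 0; 0; 0; 0;
  0; 2; 0; 0; 0; 0])]]); (154248, [:: Pol 0 [:: 0; 0; 2; 2; 0; 1; 0; 1; 1; 0] [:: (9%N, [:: 0; 0; 0;
  0; 0; 0; 0; 0; 1; 0]); (21%N, [:: 0; 0; 2; 2; 0; 1; 2; 1; 3; 2]); (43%N, [:: 0; 0; 0; 2; 0; 0; 0;
  0; 0; 0]); (67%N, [:: 0; 0; 0; 0; 0; 1; 0; 0; 0; 0])]]); (104825, [:: Pol 0 [:: 2; 0; 2; 2] [::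
  (4%N, [:: 0; 2; 0; 0]); (5%N, [:: 2; 2; 1; 2]); (7%N, [:: 0; 0; 1; 0]); (13%N, [:: 0; 0; 0; 2]);
  (19%N, [:: 0; 0; 1; 0]); (41%N, [:: 0; 0; 1; 0]); (48%N, [:: 2; 0; 0; 0])]; Pol 0 [:: 2; 0; 1; 0]
  [:: (12%N, [:: 0; 0; 1; 2]); (70%N, [:: 2; 0; 1; 0])]; Dom 0 59; Dom 2 41]); (125574, [:: Dom 0
  29; Dom 0 83]); (47272, [:: Pol 1 [:: 168; 72; 74; 21] [:: (7%N, [:: 0; 32; 0; 0]); (9%N, [:: 40;
  0; 42; 0]); (22%N, [:: 0; 0; 0; 42]); (54%N, [:: 0; 44; 0; 37]); (56%N, [:: 168; 10; 74; 0]);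
  (57%N, [:: 0; 10; 0; 0]); (58%N, [:: 0; 20; 0; 5]); (71%N, [:: 0; 0; 0; 16]); (74%N, [:: 0; 32; 0;
  0]); (49%N, [:: 0; 30; 0; 0])]; Pol 1 [:: 4; 2; 2; 1] [:: (9%N, [:: 4; 0; 2; 0]); (29%N, [:: 0; 2;
  0; 0]); (34%N, [:: 0; 0; 0; 1]); (35%N, [:: 0; 0; 0; 1]); (40%N, [:: 0; 0; 0; 1]); (56%N, [:: 4;
  0; 2; 0]); (60%N, [:: 0; 0; 0; 1]); (49%N, [:: 0; 2; 0; 0])]; Pol 2 [:: 4; 1; 1; 0] [:: (56%N, [::
  4; 1; 1; 0]); (49%N, [:: 0; 1; 0; 0])]; Dom 0 82]); (146088, [:: Pol 0 [:: 6; 3; 2; 1] [:: (29%N,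
  [:: 0; 3; 0; 0]); (57%N, [:: 0; 3; 1; 4]); (49%N, [:: 6; 0; 0; 0]); (67%N, [:: 0; 0; 1; 0]);
  (87%N, [:: 0; 0; 1; 0])]; Pol 0 [:: 2; 1; 0; 0] [:: (21%N, [:: 0; 1; 0; 0]); (84%N, [:: 0; 1; 0;
  0]); (49%N, [:: 2; 0; 0; 0])]]); (43415, [:: Pol 0 [:: 4772; 4772; 2948; 562; 108; 209; 1024; 562;
  1486; 0; 0; 54; 0; 74; 529; 0; 40; 502; 281; 0] [:: (2%N, [:: 0; 0; 0; 0; 0; 0; 0; 0; 0; 0; 0; 0;
  0; 0; 0; 0; 0; 241; 0; 0]); (10%N, [:: 0; 0; 0; 0; 0; 0; 0; 0; 0; 0; 0; 16; 0; 0; 0; 0; 0; 0; 0;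
  0]); (20%N, [:: 0; 0; 0; 0; 0; 0; 0; 0; 0; 0; 0; 0; 0; 20; 0; 0; 0; 0; 0; 0]); (21%N, [:: 0; 0; 0;
  0; 0; 0; 2948; 0; 562; 562; 108; 101; 216; 94; 317; 512; 0; 281; 281; 0]); (22%N, [:: 4772; 4772;
  2948; 0; 108; 378; 512; 562; 924; 0; 0; 0; 0; 0; 312; 0; 40; 221; 0; 0]); (42%N, [:: 0; 0; 0; 0;
  108; 0; 0; 0; 0; 0; 0; 0; 0; 0; 0; 0; 0; 0; 0; 0]); (58%N, [:: 0; 0; 0; 0; 0; 0; 512; 0; 562; 0;
  0; 54; 0; 10; 0; 0; 0; 0; 0; 0]); (71%N, [:: 0; 0; 0; 562; 0; 47; 0; 0; 0; 0; 0; 0; 0; 10; 0; 0;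
  0; 0; 0; 0]); (72%N, [:: 0; 0; 0; 0; 0; 0; 0; 0; 0; 0; 0; 0; 0; 0; 50; 0; 0; 0; 0; 0]); (82%N, [::
  0; 0; 0; 0; 0; 0; 0; 0; 0; 0; 0; 0; 0; 0; 33; 0; 0; 0; 0; 0]); (68%N, [:: 0; 0; 0; 0; 0; 0; 0; 0;
  0; 0; 0; 0; 0; 0; 67; 0; 0; 40; 281; 0]); (49%N, [:: 0; 0; 0; 2386; 0; 0; 0; 0; 0; 0; 0; 0; 0; 0;
  0; 0; 0; 0; 181; 0]); (78%N, [:: 0; 0; 0; 0; 0; 0; 0; 0; 0; 0; 0; 0; 0; 20; 0; 0; 0; 0; 0; 0])];
  Pol 1 [:: 8; 4; 6; 3] [:: (22%N, [:: 4; 2; 6; 3]); (74%N, [:: 4; 2; 0; 0]); (86%N, [:: 0; 2; 0;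
  0]); (88%N, [:: 0; 2; 0; 3])]]); (92808, [:: Dom 0 36; Dom 1 28]); (154009, [:: Pol 0 [:: 2; 1; 1;
  0] [:: (17%N, [:: 0; 1; 0; 0]); (23%N, [:: 2; 0; 1; 0]); (33%N, [:: 0; 0; 1; 0]); (49%N, [:: 0; 1;
  0; 1])]; Pol 0 [:: 2; 2; 1; 0] [:: (7%N, [:: 2; 2; 1; 0]); (26%N, [:: 0; 2; 1; 2])]; Dom 0 50]);
  (187016, [:: Pol 0 [:: 0; 1; 0; 1] [:: (29%N, [:: 0; 1; 0; 0]); (57%N, [:: 0; 0; 0; 1])]]);
  (10647, [:: Pol 0 [:: 2; 1; 2; 1] [:: (35%N, [:: 2; 1; 1; 0]); (40%N, [:: 0; 0; 1; 1]); (86%N, [::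
  0; 0; 0; 1]); (88%N, [:: 0; 1; 0; 0])]]); (96936, [:: Pol 0 [:: 4; 2; 1; 0] [:: (8%N, [:: 0; 0; 1;
  0]); (21%N, [:: 2; 2; 0; 0]); (33%N, [:: 0; 0; 1; 0]); (52%N, [:: 0; 2; 1; 0]); (82%N, [:: 2; 0;
  0; 0]); (49%N, [:: 2; 0; 0; 0])]]); (31400, [:: Pol 0 [:: 1] [:: (1%N, [:: 1]); (49%N, [:: 1])]]);
  (35223, [:: Pol 0 [:: 300; 254; 276; 0; 0; 141; 0; 116; 80; 0] [:: (11%N, [:: 140; 140; 124; 0; 0;
  32; 0; 0; 0; 0]); (21%N, [:: 0; 160; 80; 160; 136; 220; 184; 40; 76; 0]); (44%N, [:: 160; 114;
  152; 0; 0; 53; 0; 23; 0; 0]); (48%N, [:: 0; 0; 0; 0; 0; 8; 0; 0; 0; 0]); (50%N, [:: 0; 0; 0; 0; 0;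
  0; 0; 40; 0; 0]); (76%N, [:: 0; 0; 0; 0; 0; 0; 0; 13; 0; 0]); (66%N, [:: 0; 0; 0; 0; 0; 14; 0; 0;
  0; 0]); (79%N, [:: 0; 0; 0; 0; 0; 0; 0; 40; 80; 0]); (82%N, [:: 0; 0; 80; 0; 0; 0; 0; 40; 4; 0]);
  (49%N, [:: 0; 0; 70; 70; 0; 27; 0; 23; 23; 0]); (67%N, [:: 0; 0; 0; 0; 0; 10; 0; 0; 0; 0])]]);
  (72055, [:: Pol 2 [:: 16; 8; 8; 4] [:: (20%N, [:: 0; 0; 4; 0]); (29%N, [:: 0; 4; 0; 4]); (35%N,
  [:: 0; 8; 5; 0]); (40%N, [:: 0; 0; 0; 4]); (42%N, [:: 16; 0; 0; 0]); (56%N, [:: 0; 0; 1; 0]);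
  (57%N, [:: 0; 4; 0; 4]); (60%N, [:: 0; 0; 4; 0]); (61%N, [:: 16; 0; 0; 0]); (72%N, [:: 0; 0; 3;
  0])]; Pol 0 [:: 4; 0; 5; 2] [:: (20%N, [:: 2; 0; 1; 0]); (21%N, [:: 0; 0; 0; 4]); (74%N, [:: 0; 0;
  4; 2]); (72%N, [:: 4; 0; 1; 0])]; Dom 0 53]); (14743, [:: Pol 0 [:: 50; 50; 14; 18] [:: (18%N, [::
  41; 0; 22; 0]); (21%N, [:: 0; 0; 0; 32]); (25%N, [:: 0; 50; 0; 18]); (42%N, [:: 41; 0; 0; 0]);
  (55%N, [:: 9; 0; 0; 0]); (80%N, [:: 0; 0; 12; 0]); (84%N, [:: 0; 50; 0; 18]); (49%N, [:: 0; 0; 8;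
  0])]]); (145849, [:: Pol 0 [:: 32; 20; 5; 10] [:: (27%N, [:: 0; 8; 0; 0]); (30%N, [:: 0; 4; 2;
  0]); (63%N, [:: 0; 8; 0; 0]); (64%N, [:: 0; 0; 1; 0]); (77%N, [:: 8; 0; 0; 0]); (82%N, [:: 0; 8;
  1; 8]); (91%N, [:: 0; 0; 6; 10]); (49%N, [:: 16; 4; 6; 4])]]); D 108680 0 5; D 137352 0 8;
  (104584, [:: Pol 0 [:: 0; 0; 1; 0] [:: (1%N, [:: 0; 2; 1; 2]); (10%N, [:: 0; 0; 1; 0])]]); D
  149640 0 9; (170120, [:: Pol 0 [:: 0; 2; 1; 1] [:: (4%N, [:: 0; 2; 0; 0]); (8%N, [:: 0; 0; 1; 3]);
  (42%N, [:: 0; 1; 0; 0])]]); D 174216 0 5; (92569, [:: Pol 2 [:: 0; 3; 4; 6] [:: (10%N, [:: 0; 3;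
  4; 4]); (13%N, [:: 0; 3; 4; 2]); (47%N, [:: 0; 0; 0; 4])]; Dom 0 7]); D 84104 0 9; D 80008 0 20; D
  88200 0 9; (27033, [:: Dom 0 2; Dom 0 13; Dom 0 24]); D 141448 0 14; (117384, [:: Pol 0 [:: 2; 0;
  1; 0] [:: (10%N, [:: 2; 0; 1; 0]); (12%N, [:: 2; 2; 1; 0])]]); D 178312 0 20; D 190600 0 10; D
  158105 0 17; (84345, [:: Pol 2 [:: 2; 1; 0; 1] [:: (2%N, [:: 0; 1; 0; 1]); (10%N, [:: 2; 1; 1;
  0]); (9%N, [:: 0; 0; 0; 1]); (59%N, [:: 2; 0; 0; 0])]; Dom 0 30; Dom 0 41]); D 145544 0 20;
  (47001, [:: Pol 1 [:: 8; 6; 4; 3] [:: (9%N, [:: 8; 4; 4; 3]); (11%N, [:: 8; 2; 4; 3]); (38%N, [::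
  0; 4; 0; 0])]; Dom 0 6; Dom 0 18; Dom 0 23]); D 104586 0 10; (150152, [:: Pol 0 [:: 2; 1; 1; 0]
  [:: (12%N, [:: 2; 1; 1; 0]); (67%N, [:: 0; 1; 0; 0])]]); D 22905 0 30; D 22937 0 27; (14233, [::
  Pol 0 [:: 1] [:: (10%N, [:: 1]); (18%N, [:: 1])]]); D 141721 0 7; (182920, [:: Pol 0 [:: 2; 1; 1;
  1] [:: (19%N, [:: 2; 2; 1; 0]); (52%N, [:: 0; 0; 0; 1]); (67%N, [:: 0; 0; 0; 1])]]); D 157832 0
  20; (157864, [:: Pol 0 [:: 2; 2; 1; 0] [:: (9%N, [:: 2; 2; 1; 0]); (82%N, [:: 2; 0; 1; 0])]]);
  (96663, [:: Pol 2 [:: 0; 1; 2; 1] [:: (22%N, [:: 0; 1; 2; 1]); (42%N, [:: 0; 1; 0; 0]); (43%N, [::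
  0; 0; 0; 1])]; Dom 0 25; Dom 0 35; Dom 0 45]); D 55673 0 48; D 59801 0 13; (112778, [:: Pol 0 [::
  0; 0; 1; 2] [:: (10%N, [:: 0; 0; 1; 2]); (36%N, [:: 0; 0; 1; 0])]]); D 149881 0 41; (129672, [::
  Pol 0 [:: 2; 0; 1; 0] [:: (12%N, [:: 2; 2; 1; 0]); (42%N, [:: 2; 0; 1; 0])]]); D 161960 0 77;
  (31127, [:: Pol 0 [:: 1] [:: (34%N, [:: 1]); (42%N, [:: 1])]]); (67959, [:: Pol 2 [:: 6; 3; 6; 6]
  [:: (13%N, [:: 0; 0; 3; 2]); (11%N, [:: 0; 3; 0; 0]); (20%N, [:: 0; 0; 3; 0]); (21%N, [:: 0; 0; 0;
  2]); (42%N, [:: 6; 0; 0; 0]); (75%N, [:: 6; 0; 3; 0]); (83%N, [:: 0; 3; 0; 4]); (96%N, [:: 0; 0;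
  0; 4])]; Pol 0 [:: 0; 0; 2; 2] [:: (4%N, [:: 2; 2; 1; 2]); (5%N, [:: 2; 0; 1; 0]); (40%N, [:: 0;
  0; 1; 2]); (85%N, [:: 0; 0; 1; 0])]; Pol 0 [:: 2; 0; 1; 0] [:: (12%N, [:: 0; 0; 1; 2]); (72%N, [::
  2; 0; 1; 0])]; Dom 0 64]); (67961, [:: Pol 0 [:: 24; 4; 20; 8; 0; 4; 4; 4; 6; 16] [:: (20%N, [::
  4; 4; 0; 0; 0; 0; 0; 0; 0; 0]); (21%N, [:: 0; 0; 0; 8; 0; 0; 4; 0; 0; 4]); (36%N, [:: 0; 0; 0; 16;
  0; 2; 0; 1; 4; 0]); (37%N, [:: 0; 0; 6; 4; 0; 2; 4; 1; 14; 16]); (38%N, [:: 24; 4; 22; 4; 0; 2; 0;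
  3; 0; 0])]]); (38809, [:: Pol 0 [:: 2; 2; 2; 0] [:: (23%N, [:: 2; 2; 1; 0]); (71%N, [:: 0; 0; 1;
  0]); (82%N, [:: 0; 0; 1; 0])]; Pol 0 [:: 6; 2; 3; 0] [:: (6%N, [:: 6; 2; 3; 0]); (56%N, [:: 0; 0;
  3; 0])]]); D 92328 0 56; D 112537 0 18; D 18807 0 53; D 18809 0 41; D 18839 0 34; D 18841 0 6; D
  96424 0 33; (96904, [:: Pol 0 [:: 2] [:: (19%N, [:: 1]); (20%N, [:: 1]); (39%N, [:: 1])]]);
  (100727, [:: Pol 0 [:: 3; 0; 2; 1] [:: (14%N, [:: 0; 1; 0; 0]); (12%N, [:: 0; 0; 2; 3]); (20%N,
  [:: 1; 0; 2; 1]); (40%N, [:: 0; 0; 0; 1]); (81%N, [:: 3; 0; 0; 0])]; Pol 0 [:: 0; 0; 1; 1] [::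
  (4%N, [:: 2; 0; 1; 1]); (5%N, [:: 0; 0; 0; 1]); (20%N, [:: 0; 1; 0; 0]); (32%N, [:: 0; 0; 0; 1]);
  (69%N, [:: 0; 0; 1; 0])]; Dom 0 75]); D 133497 0 30; (10135, [:: Pol 0 [:: 2; 1; 1; 1] [:: (6%N,
  [:: 2; 1; 1; 0]); (53%N, [:: 0; 0; 0; 1])]]); (10137, [:: Dom 0 2; Dom 0 24]); (10649, [:: Pol 0
  [:: 2; 1; 1; 0] [:: (7%N, [:: 2; 1; 1; 0]); (67%N, [:: 0; 1; 0; 0])]]); D 178314 0 28; D 191112 0
  28; D 51575 0 61; D 51609 0 2; (80279, [:: Pol 0 [:: 0; 2; 0; 0; 0; 1; 0; 1; 2; 0] [:: (11%N, [::
  0; 0; 0; 0; 0; 0; 0; 1; 2; 0]); (20%N, [:: 0; 0; 0; 0; 0; 1; 0; 0; 0; 0]); (21%N, [:: 0; 0; 0; 0;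
  0; 0; 2; 0; 0; 0]); (45%N, [:: 0; 2; 0; 0; 0; 1; 0; 0; 0; 0])]]); (88439, [:: Pol 0 [:: 0; 0; 1;
  0; 0; 1; 1; 0; 0; 0] [:: (20%N, [:: 0; 1; 0; 0; 0; 0; 0; 0; 0; 0]); (45%N, [:: 0; 0; 0; 0; 0; 1;
  1; 0; 0; 0]); (75%N, [:: 0; 0; 1; 0; 0; 0; 0; 0; 0; 0])]]); D 79769 0 11; D 88473 0 50; D 108439 0
  6; (137625, [:: Pol 0 [:: 2; 2; 1; 0] [:: (6%N, [:: 2; 1; 1; 0]); (54%N, [:: 0; 1; 0; 0]); (49%N,
  [:: 0; 0; 1; 1])]]); (129401, [:: Dom 0 48; Dom 0 59; Dom 0 70; Dom 2 41]); D 162199 0 35; D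
  174248 0 33; D 39050 0 10; (43176, [:: Pol 0 [:: 2; 2; 1; 0] [:: (9%N, [:: 2; 0; 1; 0]); (33%N,
  [:: 2; 0; 1; 0]); (49%N, [:: 0; 2; 0; 1])]]); (34711, [:: Pol 0 [:: 4; 2; 1; 0] [:: (47%N, [:: 2;
  0; 0; 0]); (44%N, [:: 2; 2; 1; 0]); (82%N, [:: 0; 0; 1; 0])]]); (100486, [:: Pol 0 [:: 0; 1; 1; 1]
  [:: (21%N, [:: 0; 1; 1; 1]); (42%N, [:: 0; 1; 0; 1]); (43%N, [:: 0; 0; 1; 0])]]); (133768, [:: Pol
  0 [:: 2; 1; 1; 0] [:: (21%N, [:: 2; 1; 1; 0]); (67%N, [:: 0; 1; 0; 0])]]); D 178073 0 11; D 190873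
  0 13; D 158344 0 36; D 104345 0 34; (149911, [:: Pol 0 [:: 8; 16; 14; 10; 4; 9; 8; 5; 5; 0] [::
  (34%N, [:: 8; 16; 14; 10; 0; 9; 3; 5; 5; 0]); (35%N, [:: 0; 0; 0; 0; 1; 0; 2; 0; 0; 0]); (40%N,
  [:: 0; 0; 0; 0; 3; 0; 3; 0; 0; 0]); (43%N, [:: 0; 6; 0; 0; 3; 5; 0; 0; 0; 0]); (49%N, [:: 0; 0; 0;
  4; 1; 5; 9; 0; 5; 5]); (86%N, [:: 0; 0; 0; 0; 3; 0; 0; 0; 0; 0])]]); (125303, [:: Pol 0 [:: 0; 0;
  16; 8; 0; 7; 8; 2; 0; 0] [:: (17%N, [:: 0; 0; 0; 0; 0; 3; 0; 0; 0; 0]); (20%N, [:: 8; 8; 16; 0; 4;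
  6; 0; 0; 0; 0]); (21%N, [:: 0; 0; 4; 0; 0; 0; 0; 0; 0; 0]); (25%N, [:: 0; 0; 0; 8; 0; 0; 4; 0; 0;
  0]); (30%N, [:: 0; 0; 0; 0; 0; 1; 4; 0; 0; 0]); (36%N, [:: 0; 0; 0; 0; 0; 4; 0; 0; 0; 0]); (70%N,
  [:: 0; 0; 0; 0; 0; 3; 0; 2; 0; 0])]]); D 145815 0 25; D 6009 0 7; D 6041 0 34; D 6521 0 41; D 6553
  0 54; (166022, [:: Pol 0 [:: 2; 2; 1; 1] [:: (29%N, [:: 2; 2; 1; 0]); (43%N, [:: 0; 0; 0; 1]);
  (56%N, [:: 0; 0; 0; 1])]]); (166536, [:: Pol 0 [:: 2; 1; 1; 1] [:: (28%N, [:: 2; 1; 1; 0]); (57%N,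
  [:: 0; 0; 0; 1]); (78%N, [:: 0; 1; 0; 0]); (67%N, [:: 0; 0; 1; 1])]]); D 125337 0 17; D 145305 0
  18; D 47242 0 28; D 194698 0 10; D 195208 0 39; D 63865 0 59; D 63895 0 22; D 108678 0 42;
  (137864, [:: Dom 0 52; Dom 0 57; Dom 0 84]); D 173975 0 2; D 174489 0 2; D 108712 0 26; D 162440 0
  46; D 38777 0 61; D 39289 0 59; D 42905 0 22; D 43417 0 2; D 100247 0 27; (133527, [:: Pol 0 [::
  2; 2; 1; 0] [:: (18%N, [:: 2; 1; 1; 0]); (63%N, [:: 0; 1; 0; 0]); (49%N, [:: 0; 0; 1; 1])]]); D
  178344 0 56; D 190632 0 56; D 129674 0 66; (162472, [:: Pol 0 [:: 0; 0; 1; 0] [:: (1%N, [:: 0; 0;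
  1; 2]); (67%N, [:: 0; 0; 1; 0])]]); D 71545 0 2; D 72089 0 60; (113017, [:: Pol 0 [:: 1; 0; 1; 1]
  [:: (20%N, [:: 1; 1; 0; 0]); (32%N, [:: 0; 0; 0; 1]); (30%N, [:: 0; 0; 1; 0]); (36%N, [:: 0; 0; 0;
  1]); (70%N, [:: 1; 0; 0; 0])]]); D 153975 0 64; D 75671 0 2; D 75673 0 22; D 84375 0 58; D 84377 0
  60; D 55946 0 10; D 60072 0 49; D 22903 0 64; D 22935 0 18; D 14231 0 55; D 194937 0 59; D 51577 0
  59; (170632, [:: Dom 0 12; Dom 0 21; Dom 0 92]); D 117145 0 6; D 141207 0 6; (67688, [:: Pol 2 [::
  6] [:: (20%N, [:: 1]); (28%N, [:: 2]); (41%N, [:: 4])]; Pol 2 [:: 5] [:: (10%N, [:: 1]); (28%N,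
  [:: 1]); (59%N, [:: 4])]; Dom 0 14; Dom 0 36; Dom 0 51; Dom 1 28]); D 68232 0 57; (108919, [:: Pol
  0 [:: 1; 0; 1; 1] [:: (7%N, [:: 0; 0; 1; 0]); (20%N, [:: 1; 1; 0; 0]); (36%N, [:: 0; 0; 0; 1]);
  (40%N, [:: 0; 0; 0; 1]); (81%N, [:: 1; 0; 0; 0])]; Pol 0 [:: 1; 0; 1; 1] [:: (20%N, [:: 1; 1; 1;
  0]); (22%N, [:: 0; 0; 0; 1]); (29%N, [:: 0; 0; 0; 1]); (69%N, [:: 0; 0; 1; 0]); (81%N, [:: 1; 0;
  0; 0])]; Dom 0 61]); D 137591 0 53; D 174214 0 20; D 174728 0 19; D 108953 0 6; D 137081 0 6; D
  55703 0 11; D 59767 0 75; D 64138 0 5; (64168, [:: Pol 0 [:: 2] [:: (8%N, [:: 1]); (94%N, [:: 1]);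
  (49%N, [:: 1])]]); D 1911 0 25; D 1913 0 30; D 1943 0 27; D 1945 0 18; D 2423 0 64; D 2425 0 30; D
  2455 0 63; D 2457 0 32; D 71784 0 20; D 72328 0 52; D 112808 0 82; D 34679 0 11; D 34713 0 11; D
  35191 0 75; D 35225 0 13; D 178553 0 48; D 190839 0 75; D 194728 0 33; D 101000 0 21; D 133224 0
  36; D 104313 0 7; D 149913 0 6; D 67447 0 11; D 67449 0 38; D 67991 0 76; D 67993 0 50; D 141960 0
  46; D 195210 0 5; D 169849 0 2; D 169881 0 58; D 182649 0 59; D 182681 0 2; D 174455 0 61;
  (117382, [:: Dom 0 4; Dom 0 29; Dom 0 83]); D 141992 0 67; D 14474 0 36; D 109192 0 12; D 34950 0
  29; (34984, [:: Pol 0 [:: 2; 2; 0; 1] [:: (9%N, [:: 2; 0; 1; 0]); (56%N, [:: 2; 0; 0; 1]); (49%N,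
  [:: 0; 2; 0; 1])]]); D 178824 0 29; D 31097 0 41; (64409, [:: Pol 0 [:: 7; 2; 4; 4] [:: (9%N, [::
  1; 0; 0; 0]); (21%N, [:: 0; 2; 2; 4]); (58%N, [:: 2; 0; 0; 0]); (65%N, [:: 1; 0; 2; 0]); (66%N,
  [:: 0; 0; 2; 0]); (83%N, [:: 1; 0; 0; 0]); (68%N, [:: 0; 2; 2; 4]); (49%N, [:: 2; 0; 0; 0])]; Pol
  0 [:: 18; 9; 6; 6] [:: (7%N, [:: 0; 3; 0; 0]); (9%N, [:: 2; 0; 0; 0]); (28%N, [:: 0; 0; 6; 0]);
  (54%N, [:: 0; 3; 6; 6]); (57%N, [:: 4; 6; 0; 6]); (69%N, [:: 0; 3; 0; 0]); (89%N, [:: 2; 0; 0;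
  0]); (49%N, [:: 8; 0; 0; 0])]; Dom 0 40; Dom 3 22]); D 100215 0 25; D 100761 0 17; D 132983 0 18;
  D 133529 0 27; D 194457 0 22; D 194967 0 22; D 178346 0 9; D 191144 0 49; (31641, [:: Pol 0 [:: 1]
  [:: (40%N, [:: 1]); (78%N, [:: 1])]]); D 79767 0 11; D 88471 0 76; D 146056 0 21; D 46969 0 48; D
  46999 0 11; D 47481 0 48; D 47511 0 11; D 26792 0 77; D 165751 0 11; D 165783 0 47; D 166265 0 38;
  D 166297 0 13; D 125096 0 77; D 145546 0 36; D 105096 0 12; D 149608 0 20; D 129431 0 35; D 161689
  0 34; D 125608 0 49; (39080, [:: Dom 0 26; Dom 0 82; Dom 0 87]); D 43142 0 42; D 30888 0 62; D
  178583 0 11; D 190359 0 11; D 117113 0 41; D 141209 0 35; D 100520 0 82; D 133254 0 21; (182918,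
  [:: Dom 0 1; Dom 0 21; Dom 0 92]); D 55671 0 75; D 59769 0 38; D 6007 0 35; D 6039 0 6; D 6519 0
  53; D 6551 0 40; D 113288 0 21; D 31370 0 14; D 34681 0 38; D 35193 0 38; (56217, [:: Pol 0 [:: 1]
  [:: (21%N, [:: 1]); (79%N, [:: 1])]]); (60311, [:: Pol 0 [:: 36; 12; 14; 6] [:: (11%N, [:: 0; 0;
  2; 0]); (21%N, [:: 0; 6; 15; 12]); (37%N, [:: 6; 0; 0; 0]); (76%N, [:: 6; 0; 0; 0]); (84%N, [:: 6;
  0; 0; 0]); (49%N, [:: 12; 0; 0; 0]); (96%N, [:: 0; 12; 0; 6]); (78%N, [:: 0; 0; 4; 0])]]); D
  112810 0 49; D 76424 0 19; D 51846 0 4; D 51880 0 49; D 194730 0 9; D 195240 0 94; D 76456 0 67;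
  (84584, [:: Dom 0 14; Dom 0 36; Dom 0 90]); D 26999 0 64; D 27001 0 30; D 38807 0 2; D 39319 0 22;
  D 42871 0 22; D 43383 0 61; D 80520 0 29; D 129192 0 62; D 161930 0 10; D 71543 0 22; D 72087 0
  58; D 80010 0 28; D 80552 0 67; D 88680 0 20; D 121239 0 18; D 157591 0 18; D 129704 0 95; D 71577
  0 58; (27543, [:: Pol 0 [:: 2] [:: (32%N, [:: 1]); (83%N, [:: 1]); (98%N, [:: 1])]]); D 27545 0
  80; D 112505 0 30; D 113047 0 18; D 153465 0 30; D 154007 0 18; D 2152 0 36; D 2182 0 21; D 2216 0
  82; D 2696 0 21; D 55976 0 49; D 59560 0 56; D 60038 0 42; D 35464 0 29; D 104616 0 26; D 6248 0
  20; D 6312 0 26; D 6792 0 12; D 100729 0 30; D 178826 0 20; D 191110 0 20; (52119, [:: Pol 0 [::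
  679; 231; 108; 235] [:: (2%N, [:: 0; 18; 0; 0]); (29%N, [:: 0; 173; 0; 0]); (40%N, [:: 0; 151; 72;
  235]); (42%N, [:: 93; 0; 0; 0]); (57%N, [:: 133; 62; 0; 253]); (60%N, [:: 111; 0; 0; 0]); (90%N,
  [:: 9; 0; 0; 0]); (49%N, [:: 284; 0; 162; 0]); (67%N, [:: 0; 0; 18; 0]); (97%N, [:: 0; 62; 0;
  0])]; Pol 0 [:: 1] [:: (21%N, [:: 1]); (89%N, [:: 1])]; Dom 0 54; Dom 3 60]); D 67718 0 29; D
  108407 0 35; D 137623 0 34; D 63656 0 33; D 108441 0 35; D 137113 0 34; D 128921 0 34; D 162169 0
  41; D 14201 0 30; D 14713 0 30; D 174246 0 8; D 174760 0 49; D 150120 0 14; D 39560 0 19; D 43656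
  0 19; D 186233 0 38; D 186265 0 44; D 186743 0 75; D 186775 0 11; D 23417 0 17; D 23449 0 63; D
  129945 0 40; (162233, [:: Pol 0 [:: 2; 2; 1; 0] [:: (34%N, [:: 2; 1; 1; 0]); (40%N, [:: 0; 1; 0;
  0]); (49%N, [:: 0; 0; 1; 1])]]); D 104855 0 34; D 149367 0 34; D 96153 0 22; D 96633 0 59; D 10374
  0 20; D 10378 0 10; D 10888 0 12; D 124823 0 18; D 125305 0 30; D 145303 0 18; D 145785 0 30; D
  19048 0 14; D 19078 0 1; D 19112 0 49; D 47752 0 29; D 67479 0 47; D 67481 0 44; D 165992 0 28; D
  166056 0 56; D 56185 0 75; D 60313 0 11; D 96697 0 58; D 97177 0 22; D 170359 0 61; D 170391 0 22;
  D 182135 0 22; D 182167 0 23; D 63863 0 61; D 116904 0 62; D 141446 0 20; D 14984 0 21; D 125847 0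
  32; D 23144 0 20; D 23208 0 49; D 117416 0 49; D 141478 0 1; D 31095 0 53; D 195242 0 49; D 173977
  0 22; D 39287 0 61; D 42873 0 15; D 43385 0 59; D 108710 0 95; D 100249 0 18; D 133015 0 27; D
  120729 0 18; D 121207 0 64; D 157593 0 18; D 158071 0 64; D 178856 0 49; D 190630 0 43; D 129194 0
  9; D 162442 0 14; (31639, [:: Dom 0 2; Dom 0 22; Dom 0 93; Dom 3 6]); D 129706 0 49; D 162474 0
  67; D 121753 0 63; (158135, [:: Pol 0 [:: 208; 93; 87; 0] [:: (9%N, [:: 0; 0; 19; 0]); (18%N, [::
  38; 17; 0; 0]); (21%N, [:: 0; 19; 21; 0]); (25%N, [:: 0; 39; 0; 0]); (32%N, [:: 0; 17; 0; 0]);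
  (64%N, [:: 0; 20; 0; 0]); (77%N, [:: 38; 0; 0; 0]); (82%N, [:: 0; 59; 125; 38]); (91%N, [:: 0; 0;
  11; 0]); (49%N, [:: 76; 0; 52; 38]); (99%N, [:: 18; 0; 0; 0])]]); D 34920 0 28; D 10105 0 7; D
  10615 0 53; D 10617 0 41; D 104618 0 49; D 150150 0 1; D 19319 0 35; D 19321 0 7; D 19351 0 54; D
  19353 0 40; D 96906 0 5; D 116631 0 6; D 141687 0 53; D 96938 0 67; D 80249 0 38; D 170152 0 33; D
  182376 0 10; D 182440 0 33; D 52087 0 22; D 52121 0 22; D 27270 0 20; D 27274 0 10; D 108921 0 41;
  D 194971 0 22; D 195481 0 22; D 121000 0 77; D 92055 0 11; D 92057 0 11; D 92535 0 75; D 92537 0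
  38; D 117655 0 54; (141751, [:: Pol 0 [:: 2; 2; 1; 0] [:: (6%N, [:: 2; 1; 1; 0]); (54%N, [:: 0; 1;
  0; 0]); (49%N, [:: 0; 0; 1; 1])]]); D 80313 0 76; D 88953 0 13; D 121512 0 49; D 64170 0 49; D
  92599 0 50; D 92601 0 76; D 93079 0 13; D 93081 0 11; D 129435 0 40; D 162713 0 35; D 51368 0 33;
  D 190841 0 38; D 75910 0 20; D 75914 0 10; D 31402 0 49; D 100456 0 36; D 133736 0 20; D 75942 0
  4; D 84614 0 4; D 104823 0 53; D 178587 0 11; D 191383 0 13; D 71575 0 23; D 51816 0 5; D 55464 0
  56; D 112535 0 18; D 153497 0 18; D 174457 0 59; D 186536 0 56; D 64377 0 61; D 64407 0 2; D
  109224 0 49; D 137322 0 14; D 100217 0 10; D 133017 0 18; D 158073 0 30; D 76151 0 61; D 76153 0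
  59; D 178858 0 49; D 191142 0 57; D 47479 0 75; D 121243 0 18; D 121721 0 17; D 158137 0 18; D
  158615 0 17; D 67752 0 56; D 129399 0 53; D 161687 0 6; D 165785 0 11; D 195001 0 58; D 76215 0
  60; D 76217 0 58; D 84855 0 22; D 84857 0 2; D 14711 0 64; D 125094 0 9; D 146058 0 10; D 113051 0
  18; D 154489 0 17; D 125606 0 82; D 146090 0 67; D 23415 0 25; D 23447 0 63; D 71848 0 33; D 43174
  0 8; D 141689 0 41; D 178071 0 11; D 190361 0 11; D 52089 0 15; D 100518 0 49; D 133288 0 77; D
  170090 0 5; D 170154 0 9; D 182888 0 5; D 182952 0 49; D 96151 0 2; D 96631 0 61; D 117623 0 35; D
  141753 0 34; D 104343 0 6; D 149399 0 6; D 121002 0 9; D 158342 0 20; D 178617 0 76; D 190903 0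
  50; D 18600 0 62; D 56215 0 96; D 60279 0 11; D 121514 0 49; D 158374 0 21; D 96695 0 60; D 97175
  0 2; D 113320 0 49; D 153706 0 10; D 9896 0 9; D 10406 0 1; D 10920 0 49; D 71786 0 5; D 22696 0
  77; D 186747 0 38; D 186779 0 11; D 187257 0 13; D 187289 0 76; D 63385 0 22; D 13992 0 9; D 15016
  0 49; D 137384 0 62; D 30617 0 34; D 174519 0 60; D 104859 0 34; D 150391 0 35; D 113015 0 64; D
  92806 0 20; D 92810 0 10; D 31161 0 34; D 117352 0 14; D 92838 0 29; D 92842 0 67; D 170363 0 15;
  D 170395 0 22; D 183159 0 22; D 183191 0 60; D 55978 0 49; D 60070 0 56; D 149672 0 62; D 186474 0
  10; D 186538 0 9; D 187048 0 49; D 194935 0 61; D 31609 0 7; D 80247 0 75; D 79737 0 10; D 87961 0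
  11; D 121211 0 30; D 158617 0 18; D 108409 0 10; D 137111 0 6; D 162167 0 53; D 80311 0 76; D
  88951 0 11; D 43112 0 10; D 27302 0 21; D 27306 0 49; D 79801 0 47; D 88985 0 76; D 55193 0 11; D
  59287 0 11; D 174758 0 49; D 104554 0 14; D 153768 0 77; D 129913 0 7; D 162231 0 6; D 42664 0 9;
  D 43688 0 49; D 178551 0 75; D 129465 0 34; D 162203 0 10; D 84136 0 33; D 101032 0 49; D 179097 0
  11; D 190869 0 11; D 84648 0 49; D 149401 0 34; D 145783 0 64; D 26519 0 18; D 26521 0 18; D 88232
  0 56; D 56183 0 11; D 60281 0 38; D 124825 0 18; D 88744 0 49; D 166054 0 9; D 166504 0 10; D
  166568 0 49; D 125333 0 18; D 125815 0 25; D 145847 0 63; D 146329 0 25; D 113322 0 49; D 154218 0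
  36; D 46760 0 9; D 47784 0 49; D 27063 0 27; D 27065 0 18; D 169879 0 2; D 182169 0 22; D 116902 0
  9; D 125367 0 27; D 125849 0 18; D 145337 0 27; D 145819 0 10; D 108648 0 10; D 117414 0 49; D
  141990 0 88; D 174485 0 2; D 174999 0 2; D 27511 0 18; D 27513 0 30; D 104827 0 7; D 150393 0 6; D
  63929 0 58; D 194455 0 2; D 51095 0 2; D 80554 0 67; D 88682 0 28; D 75641 0 10; D 83863 0 2; D
  83865 0 22; D 60008 0 10; D 75703 0 58; D 75705 0 23; D 84887 0 60; D 84889 0 58; D 105128 0 49; D
  113081 0 63; D 153979 0 10; D 154521 0 63; D 22425 0 18; D 150184 0 49; D 186986 0 28; D 187050 0
  49; D 6250 0 14; D 116633 0 34; D 14265 0 27; D 14777 0 63; D 170664 0 49; D 182438 0 9; D 117141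
  0 6; D 142231 0 7; D 67690 0 10; D 117657 0 34; D 141239 0 34; D 108949 0 6; D 138105 0 7; D 59289
  0 11; D 108983 0 54; D 137595 0 10; D 129403 0 7; D 162711 0 6; D 39018 0 5; D 154280 0 49; D
  59831 0 47; D 51878 0 49; D 191385 0 11; D 30615 0 6; D 121450 0 36; D 158378 0 67; D 150423 0 54;
  D 153495 0 18; D 31159 0 6; D 170873 0 2; D 170905 0 58; D 182645 0 42; D 182677 0 2; D 64375 0
  22; D 23146 0 36; D 23210 0 49; D 18327 0 6; D 18329 0 34; D 34472 0 9; D 35496 0 49; D 109222 0
  49; D 137834 0 10; D 31607 0 34; D 96934 0 88; D 100757 0 18; D 134007 0 25; D 51097 0 22; D 87959
  0 11; D 10167 0 34; D 10169 0 6; D 10679 0 54; D 10681 0 40; D 125544 0 10; D 113019 0 30; D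
  113561 0 18; D 153945 0 30; D 154487 0 18; D 128919 0 6; D 79799 0 44; D 88983 0 76; D 166261 0
  42; D 166293 0 11; D 166775 0 11; D 166807 0 76; D 55914 0 28; D 60074 0 49; D 105130 0 49; D
  186263 0 11; D 38568 0 9; D 39592 0 49; D 47033 0 47; D 47545 0 76; D 129943 0 6; D 161721 0 6; D
  31398 0 49; D 194939 0 15; D 195449 0 2; D 142233 0 34; D 80793 0 11; D 88409 0 38; D 133800 0 49;
  D 170602 0 10; D 170666 0 49; D 182950 0 49; D 117625 0 7; D 141241 0 6; D 109463 0 6; D 137561 0
  7; D 178105 0 47; D 190905 0 11; D 112746 0 10; D 55675 0 10; D 59833 0 11; D 63383 0 2; D 178555
  0 38; D 191351 0 11; D 76454 0 67; D 76458 0 67; D 84586 0 10; D 137896 0 49; D 105369 0 34; D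
  149847 0 20; D 120727 0 18; D 174007 0 58; D 174521 0 22; D 104315 0 10; D 150425 0 34; D 42935 0
  58; D 43447 0 60; D 121273 0 18; D 121751 0 63; D 157623 0 18; D 158101 0 42; D 1704 0 9; D 2154 0
  10; D 2728 0 49; D 141994 0 67; D 183161 0 2; D 183193 0 22; D 22423 0 18; D 112569 0 27; D 5800 0
  9; D 6824 0 49; D 101271 0 63; D 133463 0 20; D 134009 0 30; D 72025 0 15; D 72569 0 2; D 14263 0
  18; D 14775 0 63; D 195479 0 2; D 76695 0 2; D 76697 0 22; D 84313 0 15; D 117175 0 6; D 141717 0
  42; D 68264 0 49; D 55191 0 11; D 138137 0 40; D 108471 0 34; D 72360 0 49; D 55737 0 44; D 101030
  0 49; D 104889 0 40; D 149877 0 42; D 146327 0 18; D 19050 0 10; D 19110 0 49; D 19114 0 49; D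
  96185 0 2; D 97145 0 2; D 47210 0 10; D 166566 0 49; D 125817 0 30; D 145335 0 18; D 51882 0 49; D
  125369 0 18; D 97209 0 60; D 47786 0 49; D 175001 0 22; D 105337 0 6; D 149849 0 7; D 63867 0 10;
  D 63927 0 2; D 15018 0 49; D 129642 0 10; D 162470 0 67; D 67929 0 38; D 68471 0 11; D 68473 0 38;
  D 100791 0 63; D 133493 0 42; D 134039 0 63; D 38779 0 10; D 39291 0 10; D 42937 0 2; D 43449 0
  22; D 121719 0 18; D 157625 0 18; D 51639 0 23; D 194489 0 23; D 194999 0 2; D 112507 0 10; D
  154519 0 63; D 31673 0 54; D 101239 0 18; D 133465 0 30; D 80791 0 11; D 138103 0 34; D 178615 0
  76; D 190391 0 44; D 64106 0 10; D 64166 0 49; D 92087 0 11; D 92089 0 11; D 93047 0 11; D 93049 0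
  38; D 27816 0 49; D 108985 0 34; D 162681 0 6; D 186713 0 10; D 186809 0 11; D 187255 0 11; D
  187287 0 76; D 179065 0 38; D 154282 0 49; D 93111 0 76; D 93113 0 76; D 162745 0 54; D 31912 0
  49; D 75976 0 49; D 80550 0 67; D 38841 0 23; D 39353 0 58; D 80072 0 49; D 88746 0 49; D 27575 0
  63; D 27577 0 63; D 170329 0 10; D 170425 0 22; D 182615 0 10; D 182711 0 2; D 174967 0 22; D
  141512 0 9; D 72567 0 22; D 134041 0 18; D 71513 0 10; D 72601 0 22; D 64441 0 60; D 158583 0 18;
  D 191146 0 49; D 113529 0 30; D 51641 0 22; D 146086 0 67; D 166231 0 10; D 166327 0 76; D 166777
  0 38; D 166809 0 11; D 158647 0 63; D 46971 0 10; D 47031 0 11; D 47483 0 10; D 47543 0 76; D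
  48025 0 11; D 129911 0 34; D 161719 0 34; D 60584 0 49; D 125610 0 49; D 145608 0 9; D 22873 0 10;
  D 22969 0 18; D 129463 0 6; D 15257 0 18; D 39594 0 49; D 43686 0 49; D 34743 0 44; D 35255 0 76;
  D 179095 0 11; D 109431 0 34; D 109465 0 34; D 96183 0 22; D 97143 0 22; D 104377 0 6; D 157896 0
  9; D 64680 0 49; D 10918 0 49; D 10922 0 49; D 97207 0 58; D 23206 0 49; D 60343 0 76; D 191353 0
  38; D 137898 0 49; D 67417 0 10; D 68503 0 76; D 68505 0 11; D 174009 0 2; D 39833 0 22; D 43927 0
  2; D 100279 0 18; D 161992 0 9; D 55974 0 49; D 31671 0 40; D 113079 0 63; D 92360 0 9; D 92872 0
  49; D 93352 0 49; D 18777 0 10; D 18871 0 6; D 18873 0 34; D 101273 0 18; D 11159 0 6; D 11161 0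
  34; D 150182 0 49; D 96456 0 9; D 158585 0 30; D 96968 0 49; D 97448 0 49; D 117177 0 34; D 138135
  0 6; D 121723 0 10; D 158649 0 49; D 195513 0 60; D 55735 0 11; D 174762 0 49; D 108473 0 6; D
  128953 0 6; D 162171 0 10; D 34745 0 11; D 35257 0 11; D 35735 0 76; D 129977 0 54; D 84646 0 49;
  D 84650 0 49; D 146297 0 30; D 191415 0 76; D 5977 0 10; D 6073 0 6; D 6489 0 10; D 6585 0 34; D
  7033 0 6; D 7065 0 34; D 158408 0 49; D 124855 0 18; D 145787 0 10; D 170871 0 22; D 170903 0 2; D
  56187 0 10; D 60345 0 49; D 146361 0 63; D 52392 0 49; D 117418 0 49; D 125879 0 63; D 35494 0 49;
  D 72599 0 2; D 39801 0 2; D 43929 0 22; D 100793 0 18; D 162504 0 49; D 113559 0 18; D 56488 0 49;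
  D 22967 0 18; D 101241 0 30; D 15255 0 18; D 6826 0 49; D 195447 0 22; D 142199 0 34; D 133798 0
  49; D 178103 0 11; D 190393 0 11; D 142263 0 40; D 162679 0 34; D 1881 0 10; D 1975 0 18; D 1977 0
  18; D 2393 0 10; D 2487 0 63; D 2489 0 18; D 2935 0 18; D 2937 0 30; D 2967 0 63; D 2969 0 18; D
  43690 0 49; D 129915 0 10; D 162743 0 49; D 72362 0 49; D 35703 0 11; D 35737 0 11; D 56249 0 76;
  D 195238 0 49; D 15014 0 49; D 105367 0 6; D 38839 0 22; D 39351 0 2; D 129702 0 49; D 121271 0
  18; D 158888 0 49; D 19624 0 49; D 30649 0 6; D 169913 0 2; D 182617 0 10; D 182713 0 22; D 174969
  0 2; D 112567 0 18; D 154041 0 18; D 23720 0 49; D 142024 0 49; D 109226 0 49; D 64379 0 10; D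
  64439 0 49; D 162984 0 49; D 47993 0 38; D 48023 0 11; D 52151 0 58; D 88505 0 11; D 165815 0 11;
  D 166233 0 10; D 166329 0 11; D 137657 0 34; D 146120 0 49; D 150186 0 49; D 27336 0 49; D 126120
  0 49; D 142201 0 6; D 80761 0 38; D 109433 0 6; D 31432 0 49; D 182954 0 49; D 142265 0 49; D
  104887 0 6; D 80825 0 49; D 88921 0 10; D 179129 0 76; D 6071 0 34; D 6583 0 6; D 7031 0 34; D
  7063 0 6; D 149943 0 6; D 88742 0 49; D 26551 0 18; D 26553 0 18; D 35705 0 38; D 105335 0 34; D
  76488 0 49; D 39831 0 2; D 43895 0 22; D 63417 0 2; D 178854 0 49; D 175031 0 58; D 100281 0 18; D
  133559 0 63; D 120761 0 18; D 72121 0 22; D 80584 0 49; D 194487 0 22; D 130216 0 49; D 2726 0 49;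
  D 2730 0 49; D 84407 0 2; D 84409 0 22; D 121785 0 63; D 35498 0 49; D 76663 0 22; D 76665 0 2; D
  116663 0 34; D 191656 0 49; D 52153 0 49; D 68262 0 49; D 68266 0 49; D 76727 0 49; D 76729 0 49;
  D 84825 0 10; D 121510 0 49; D 117687 0 40; D 15225 0 30; D 59319 0 11; D 186297 0 11; D 186807 0
  11; D 179063 0 11; D 23385 0 10; D 23481 0 49; D 101034 0 49; D 133802 0 49; D 146295 0 18; D
  149945 0 34; D 191417 0 49; D 47782 0 49; D 30647 0 34; D 68023 0 76; D 68025 0 11; D 166570 0 49;
  D 124857 0 18; D 146359 0 49; D 170423 0 2; D 182199 0 22; D 125881 0 49; D 195752 0 49; D 39799 0
  22; D 43897 0 2; D 117928 0 49; D 133561 0 18; D 113527 0 18; D 88503 0 11; D 191176 0 49; D 11127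
  0 34; D 11129 0 6; D 60104 0 49; D 19289 0 10; D 19383 0 49; D 19385 0 49; D 80759 0 11; D 80823 0
  49; D 104375 0 34; D 113318 0 49; D 154278 0 49; D 56247 0 49; D 59321 0 11; D 122024 0 49; D
  64200 0 49; D 195272 0 49; D 72119 0 2; D 71609 0 2; D 154039 0 18; D 142504 0 49; D 187046 0 49;
  D 6822 0 49; D 47991 0 11; D 137655 0 6; D 165817 0 11; D 195511 0 49; D 15223 0 18; D 146600 0
  49; D 39590 0 49; D 113593 0 49; D 153947 0 10; D 137145 0 6; D 128951 0 34; D 72358 0 49; D 55225
  0 11; D 23479 0 49; D 174792 0 49; D 125640 0 49; D 129975 0 49; D 109495 0 49; D 137563 0 10; D
  67511 0 11; D 67513 0 11; D 186715 0 10; D 187321 0 49; D 137894 0 49; D 63415 0 22; D 175033 0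
  49; D 133047 0 18; D 51127 0 22; D 178888 0 49; D 129736 0 49; D 105126 0 49; D 170331 0 10; D
  183223 0 49; D 170662 0 49; D 116665 0 6; D 117689 0 49; D 175272 0 49; D 183464 0 49; D 85160 0
  49; D 71607 0 22; D 169911 0 22; D 182201 0 2; D 89256 0 49; D 153529 0 18; D 76968 0 49; D 81064
  0 49; D 133049 0 18; D 179368 0 49; D 51129 0 2; D 22457 0 18; D 187560 0 49; D 15289 0 49; D
  179127 0 49; D 149431 0 34; D 10952 0 49; D 51912 0 49; D 105401 0 49; D 15048 0 49; D 120759 0
  18; D 121783 0 49; D 170937 0 49; D 56008 0 49; D 18359 0 34; D 18361 0 6; D 101303 0 49; D 109256
  0 49; D 11191 0 49; D 11193 0 49; D 87993 0 11; D 137143 0 34; D 166839 0 49; D 55223 0 11; D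
  89017 0 49; D 186295 0 11; D 48057 0 49; D 150696 0 49; D 149433 0 6; D 109497 0 49; D 113352 0
  49; D 154792 0 49; D 117448 0 49; D 43959 0 49; D 83895 0 22; D 83897 0 2; D 183225 0 49; D 22455
  0 18; D 84919 0 49; D 84921 0 49; D 109736 0 49; D 154553 0 49; D 15287 0 49; D 121544 0 49; D
  43720 0 49; D 19144 0 49; D 113832 0 49; D 150455 0 49; D 167080 0 49; D 153527 0 18; D 47816 0
  49; D 23240 0 49; D 43961 0 49; D 87991 0 11; D 113591 0 49; D 89015 0 49; D 171176 0 49; D 187319
  0 49; D 101544 0 49; D 150457 0 49; D 39865 0 49; D 101305 0 49; D 166841 0 49; D 105640 0 49; D
  48055 0 49; D 138169 0 49; D 35767 0 49; D 101064 0 49; D 134312 0 49; D 182984 0 49; D 11432 0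
  49; D 15528 0 49; D 138408 0 49; D 134071 0 49; D 154551 0 49; D 105160 0 49; D 187080 0 49; D
  44200 0 49; D 35769 0 49; D 105399 0 49; D 7097 0 49; D 166600 0 49; D 48296 0 49; D 170935 0 49;
  D 35528 0 49; D 134073 0 49; D 72633 0 49; D 39624 0 49; D 170696 0 49; D 68776 0 49; D 2999 0 49;
  D 3001 0 49; D 72872 0 49; D 39863 0 49; D 68535 0 49; D 68537 0 49; D 36008 0 49; D 138167 0 49;
  D 40104 0 49; D 84680 0 49; D 7095 0 49; D 88776 0 49; D 72631 0 49; D 2760 0 49; D 3240 0 49; D
  6856 0 49; D 7336 0 49; D 150216 0 49; D 154312 0 49; D 133832 0 49; D 137928 0 49; D 68296 0 49;
  D 72392 0 49].
End Facts.

(** * The checks to be run for each subgroup and each face *)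

Definition codes : seq code := [seq decode f.1 | f <- facts].
Definition code0 : code := decode 0.
Definition nth_code (j : nat) : code := nth code0 codes j.

Definition reason_ok (nc : nat -> code) (g : code) (i : nat) (r : reason) : bool :=
  match r with
  | Dom n j => (j < i) && dominated g (nc j) (piece n)
  | Pol n d l => all (fun jq => jq.1 < i) l &&
      certified g (piece n) d [seq (nc jq.1, jq.2) | jq <- l]
  end.

Fixpoint facts_ok (nc : nat -> code) (i : nat) (l : seq fact) : bool :=
  if l is f :: l' then
    all (reason_ok nc (decode f.1) i) f.2 && facts_ok nc i.+1 l'
  else true.

Section Enumeration.
Local Open Scope Z_scope.

Definition all_lins : seq lin := [seq lin_of (Z.of_nat n) | n <- iota 0 48].

(** These are the lattice translations left over by [B_far]: first the multiples of 4, then the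
    vectors with all coordinates congruent to 2 modulo 4. *)
Definition box : seq zvec :=
  [seq (b, b3) | b <- [seq (b1, b2) | b1 <- [:: -4; 0; 4; 8], b2 <- [:: -8; -4; 0; 4; 8]],
                 b3 <- [:: -8; -4; 0; 4; 8]] ++
  [seq (b, b3) | b <- [seq (b1, b2) | b1 <- [:: -6; -2; 2; 6; 10], b2 <- [:: -6; -2; 2; 6; 10]],
                 b3 <- [:: -6; -2; 2; 6]].
End Enumeration.

Definition box_cases (ls : seq lin) (bs : seq zvec) (cs : seq code) : bool :=
  all (fun l => let bucket := [seq g.2 | g <- cs & eqlin l g.1] in
    all (fun b => nonneg_on_body (l, b) (piece 0) || has (zeqv b) bucket) bs) ls.

(** A certificate for piece [n] may be used in piece [m] when admissible weights on [m] convert to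
    admissible weights on [n]; the last of four weights is allowed to vanish, so a facet opposite
    the last vertex counts. *)
Definition within (n m : nat) : bool :=
  match n, m with
  | 0, _ => true
  | 1, 3 => true
  | _, _ => n == m
  end.

Definition subgroup := seq bool.
Definition mem_cls (H : subgroup) (c : coset) : bool := nth false H (cindex c).

Definition piece_of (r : reason) : nat := match r with Dom n _ => n | Pol n _ _ => n end.
(** A premise may carry the zero form: it adds nothing to the inequality but restricts the reason to
    subgroups that contain its isometry. The fact [55944] treats fact 21 so, because [required]
    wants [55944] kept when the subgroup has the class [(true, false, 2)] but not
    [(false, false, 2)]. *)
Definition premises (r : reason) : seq nat :=
  match r with Dom _ j => [:: j] | Pol _ _ l => [seq jq.1 | jq <- l] end.

Definition applies (kc : seq coset) (H : subgroup) (n : nat) (r : reason) : bool :=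
  within (piece_of r) n &&
  all (fun j => mem_cls H (nth (false, false, Z0) kc j)) (premises r).

Definition kept (kc : seq coset) (H : subgroup) (n : nat) (f : code * seq reason) : bool :=
  mem_cls H (cls f.1) && ~~ has (applies kc H n) f.2.

Definition decoded := [seq (decode f.1, f.2) | f <- facts].
Definition known_cosets := [seq cls g | g <- codes].

(* The isometries that no reason excludes; they suffice to define the Voronoi
   cell when the centre is in the relative interior of piece [n]. *)
Definition Kset (df : seq (code * seq reason)) kc (H : subgroup) (n : nat) : seq code :=
  [seq f.1 | f <- df & kept kc H n f].

Section Required.
Local Open Scope Z_scope.
Definition lin1 s1 s2 s3 : lin := ((X1, s1), (X2, s2), (X3, s3)).
Definition lin2 s1 s2 s3 : lin := ((X2, s1), (X3, s2), (X1, s3)).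
Definition lin3 s1 s2 s3 : lin := ((X3, s1), (X1, s2), (X2, s3)).

(* Isometries whose half-spaces confine a point to [body]. *)
Definition required (H : subgroup) : seq code :=
  [:: (lin2 false false false, (0, 0, 0)); (lin3 false false false, (0, 0, 0));
      (lin2 false true true, (0, 0, 0)); (lin3 true false true, (0, 0, 0));
      (lin2 true false true, (4, 0, 4)); (lin3 true true false, (4, 4, 0));
      (lin1 false true true, (0, 0, 0)); (lin1 true true false, (4, 4, 0))] ++
  (if mem_cls H (false, false, 2) then [:: (lin1 true false true, (4, 0, 0))]
   else if mem_cls H (true, false, 2) then
     [:: (((X1, true), (X3, false), (X2, true)), (4, 0, 0));
         (((X2, true), (X1, false), (X3, true)), (4, 0, 0))]
   else [:: (lin2 true true false, (4, 0, -4)); (lin3 false true true, (4, 4, 0))]).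

(* [(n, phi)]: a centre in the relative interior of the face of the tetrahedron
   spanned by the vertices [phi] of piece [n] is treated as a limit of centres in
   the relative interior of that piece.  The choice of [n] keeps the count low. *)
Definition faces : seq (nat * seq nat) :=
  [:: (1, [:: 1]); (1, [:: 2]); (1, [:: 3]);
      (1, [:: 0; 3]); (1, [:: 1; 2]); (1, [:: 1; 3]); (1, [:: 2; 3]);
      (1, [:: 0; 1; 2]); (1, [:: 0; 1; 3]); (1, [:: 0; 2; 3]); (1, [:: 1; 2; 3]); (1, [:: 0; 1; 2; 3]);
      (2, [:: 1]); (2, [:: 2]); (2, [:: 3]);
      (2, [:: 0; 1]); (2, [:: 0; 2]); (2, [:: 0; 3]); (2, [:: 1; 2]); (2, [:: 1; 3]); (2, [:: 2; 3]);
      (2, [:: 0; 1; 2]); (2, [:: 0; 1; 3]); (2, [:: 0; 2; 3]); (2, [:: 1; 2; 3]); (2, [:: 0; 1; 2; 3]);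
      (3, [:: 0]); (3, [:: 0; 1])]%N.

Definition vertices (n : nat) (phi : seq nat) : seq zvec :=
  [seq nth v0 (piece n) i | i <- phi].

Definition zopp (x : zvec) : zvec := let: (x1, x2, x3) := x in (- x1, - x2, - x3).
(** An isometry fixing [v] is determined by its linear part, so a stabilizer is found among 48
    candidates. *)
Definition fixing (l : lin) (v : zvec) : code := (l, zadd v (zopp (lapp Z.opp l v))).

Definition stabilizer (H : subgroup) (vs : seq zvec) : seq code :=
  [seq s <- [seq fixing l (head v0 vs) | l <- all_lins] |
    [&& in_lattice s.2, mem_cls H (cls s) & all (fun v => zeqv (zapp s v) v) vs]].

Fixpoint eqzs (s t : seq zvec) : bool :=
  match s, t with
  | [::], [::] => true
  | x :: s', y :: t' => zeqv x y && eqzs s' t'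
  | _, _ => false
  end.

Definition add_new (s : seq zvec) (l : seq (seq zvec)) :=
  if has (eqzs s) l then l else s :: l.

(** The centre is a combination of [vs] with unknown positive weights, so an image of it is recorded
    as the tuple of images of [vs]; the tuple [vs] is the centre itself and is dropped. *)
Definition images (st K : seq code) (vs : seq zvec) : seq (seq zvec) :=
  foldr (fun k l => let kvs := [seq zapp k v | v <- vs] in
    foldr (fun s l => let q := [seq zapp s v | v <- kvs] in
      if eqzs q vs then l else add_new q l) l st) [::] K.

Definition znorm (x : zvec) : Z := zdist x v0.
Definition zdot (x y : zvec) : Z :=
  let: (x1, x2, x3) := x in let: (y1, y2, y3) := y in x1 * y1 + x2 * y2 + x3 * y3.

(* At the origin, the half-space of [x + y] contains the intersection of those
   of [x] and [y] when the angle between [x] and [y] is not obtuse. *)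
Definition reduced (vs : seq zvec) (Q : seq (seq zvec)) : seq (seq zvec) :=
  if eqzs vs [:: v0] then
    let: short := [seq q <- Q | znorm (head v0 q) <=? 16] in
    [seq q <- Q | (znorm (head v0 q) <=? 16) ||
      ~~ has (fun x => has (fun y => (0 <=? zdot (head v0 x) (head v0 y)) &&
           zeqv (head v0 q) (zadd (head v0 x) (head v0 y))) short) short]
  else Q.

Definition zcoord (i : axis) (x : zvec) : Z := sel Z.opp (i, false) x.

(* Some coordinate separates the two convex combinations with the same positive
   weights. *)
Definition moves (vs q : seq zvec) : bool :=
  has (fun i => has (fun s =>
    let d := [seq s * (zcoord i xy.1 - zcoord i xy.2) | xy <- zip q vs] in
    all (Z.leb 0) d && has (Z.ltb 0) d) [:: 1; -1]) [:: X1; X2; X3].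

Definition face_ok (H : subgroup) (n : nat) (K : seq code) (phi : seq nat) : bool :=
  let vs := vertices n phi in
  let Q := images (stabilizer H vs) K vs in
  all (moves vs) Q && (size (reduced vs Q) <= 25)%N.

Definition leaf_ok df kc (H : subgroup) (n : nat) : bool :=
  let K := Kset df kc H n in
  all (fun g => has (eqcode g) K) (required H) &&
  all (fun f => (f.1 != n) || face_ok H n K f.2) faces.

Definition subgroup_ok df kc (H : subgroup) : bool :=
  all (leaf_ok df kc H) [:: 1%N; 2%N; 3%N].

Definition all_cosets : seq coset :=
  [seq (ed, k) | ed <- [seq (e, d) | e <- [:: false; true], d <- [:: false; true]],
                  k <- [:: 0; 1; 2; 3]].

(** Each round adds all products of two elements, so three rounds reach words of length eight. That
    the results are subgroups is established separately by [closed_okT]; the completeness of the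
    enumeration only uses that [adjoin] stays inside every subgroup containing [H] and [c]. *)
Definition adjoin (H : subgroup) (c : coset) : subgroup :=
  let step (H : subgroup) : subgroup :=
    let el := [seq a <- all_cosets | mem_cls H a] in
    let pr := [seq mulc a b | a <- c :: el, b <- c :: el] in
    [seq mem_cls H a || has (fun b => cindex a == cindex b) pr | a <- all_cosets] in
  step (step (step H)).

Fixpoint subgroups_from (cs : seq coset) (H : subgroup) : seq subgroup :=
  if cs is c :: cs' then
    if mem_cls H c then subgroups_from cs' H
    else subgroups_from cs' H ++ subgroups_from cs' (adjoin H c)
  else [:: H].

Definition trivial_subgroup : subgroup := true :: nseq 15 false.
Definition subgroups : seq subgroup :=
  undup (subgroups_from all_cosets trivial_subgroup).
End Required.

(** * Verification of the tables *)

Lemma facts_okT : facts_ok nth_code 0 facts.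
Proof. by vm_compute. Qed.
Lemma box_okT : box_cases all_lins box codes.
Proof. by vm_compute. Qed.
(** The two local definitions let the evaluation decode the table once for all subgroups. *)
Lemma subgroups_okT : let df := decoded in let kc := known_cosets in
  all (subgroup_ok df kc) subgroups.
Proof. by vm_compute. Qed.

(** * Distance comparisons as affine functions *)

Section Real.
Variable R : realFieldType.
Local Open Scope ring_scope.
Local Notation V := (R * R * R)%type.

Definition zr (z : Z) : R := (int_of_Z z)%:~R.

Lemma zrD a b : zr (Z.add a b) = zr a + zr b.
Proof. by rewrite /zr -rmorphD -(rmorphD int_of_Z). Qed.
Lemma zrM a b : zr (Z.mul a b) = zr a * zr b.
Proof. by rewrite /zr -rmorphM -(rmorphM int_of_Z). Qed.
Lemma zrN a : zr (Z.opp a) = - zr a.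
Proof. by rewrite /zr -rmorphN -(rmorphN int_of_Z). Qed.
Lemma zrB a b : zr (Z.sub a b) = zr a - zr b.
Proof. by rewrite -Z.add_opp_r zrD zrN. Qed.
Lemma zr0 : zr Z0 = 0. Proof. by []. Qed.
Lemma zr_ge0 z : Z.leb 0 z -> 0 <= zr z.
Proof. by move=> h; rewrite /zr ler0z; lia. Qed.
Lemma zr_gt0 z : Z.ltb 0 z -> 0 < zr z.
Proof. by move=> h; rewrite /zr ltr0z; lia. Qed.
Lemma zr_inj : injective zr.
Proof. by move=> a b /intr_inj; lia. Qed.

Definition vadd (x y : V) : V :=
  let: (x1, x2, x3) := x in let: (y1, y2, y3) := y in (x1 + y1, x2 + y2, x3 + y3).
Definition vscale (a : R) (x : V) : V := let: (x1, x2, x3) := x in (a * x1, a * x2, a * x3).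
Definition dist2 (x y : V) : R :=
  let: (x1, x2, x3) := x in let: (y1, y2, y3) := y in
  (x1 - y1) ^+ 2 + (x2 - y2) ^+ 2 + (x3 - y3) ^+ 2.
Definition zr3 (x : zvec) : V := let: (x1, x2, x3) := x in (zr x1, zr x2, zr x3).
Definition app (g : code) (x : V) : V := vadd (lapp -%R g.1 x) (zr3 g.2).
Definition B (g : code) (x p : V) : R := dist2 x (app g p) - dist2 x p.

Lemma zr_sel r x : zr (sel Z.opp r x) = sel -%R r (zr3 x).
Proof. by case: r x => -[] [] [[x1 x2] x3]; rewrite /= /sel ?zrN. Qed.

Lemma zr3_add x y : zr3 (zadd x y) = vadd (zr3 x) (zr3 y).
Proof. by case: x y => [[? ?] ?] [[? ?] ?] /=; rewrite !zrD. Qed.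

Lemma zr3_app g x : zr3 (zapp g x) = app g (zr3 x).
Proof. by rewrite /zapp zr3_add /lapp /= !zr_sel. Qed.

Lemma zr_dist x y : zr (zdist x y) = dist2 (zr3 x) (zr3 y).
Proof. by case: x y => [[? ?] ?] [[? ?] ?] /=; rewrite !(zrD, zrM, zrB) -!expr2. Qed.

Lemma zr_B g v t : zr (zB g v t) = B g (zr3 v) (zr3 t).
Proof. by rewrite /zB zrB !zr_dist zr3_app. Qed.

(** Given as an explicit formula in four values of [f], so that interpolation identities reduce to
    [ring] after rewriting. *)
Definition affine (f : V -> R) := forall x1 x2 x3,
  f (x1, x2, x3) = f (0, 0, 0) + x1 * (f (1, 0, 0) - f (0, 0, 0)) +
    x2 * (f (0, 1, 0) - f (0, 0, 0)) + x3 * (f (0, 0, 1) - f (0, 0, 0)).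

Lemma affineD f g : affine f -> affine g -> affine (fun x => f x + g x).
Proof. by move=> hf hg x1 x2 x3; rewrite hf hg; ring. Qed.
Lemma affineZ a f : affine f -> affine (fun x => a * f x).
Proof. by move=> hf x1 x2 x3; rewrite hf; ring. Qed.

Lemma affine_Bl g p : affine (fun x => B g x p).
Proof.
move=> x1 x2 x3; rewrite /B; case: (app g p) => [[q1 q2] q3].
case: p => [[p1 p2] p3] /=; ring.
Qed.

(* Since [g] is an isometry, the quadratic terms in [p] cancel. *)
Lemma affine_Br g x : perm_axes g.1 -> affine (B g x).
Proof.
case: g x => [[[[a1 s1] [a2 s2]] [a3 s3]] [[b1 b2] b3]] [[x1 x2] x3] ha p1 p2 p3.
rewrite /B /app /lapp /sel /=.
move: (zr b1) (zr b2) (zr b3) => c1 c2 c3.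
by case: a1 a2 a3 ha => [] [] [] // _; case: s1 s2 s3 => [] [] [] /=; ring.
Qed.

Definition bary (w : seq R) (t : seq V) : V :=
  foldr (fun wt y => vadd (vscale wt.1 wt.2) y) (0, 0, 0) (zip w t).

(** Subtracting [f (0, 0, 0)] makes [f] linear, which allows an induction on the weights without
    knowing their sum. *)
Lemma affine_bary_gen f w t : affine f -> size w = size t ->
  f (bary w t) - f (0, 0, 0) = \sum_(wt <- zip w t) wt.1 * (f wt.2 - f (0, 0, 0)).
Proof.
move=> hf; rewrite /bary; elim: w t => [|a w IH] [|[[t1 t2] t3] t] //=.
  by rewrite big_nil subrr.
case=> hs; rewrite big_cons -IH //=; case: (foldr _ _ _) => [[y1 y2] y3] /=.
rewrite [f (_ + _, _, _)]hf [f (y1, _, _)]hf [f (t1, _, _)]hf; ring.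
Qed.

Lemma affine_bary f w t : affine f -> size w = size t -> \sum_(a <- w) a = 1 ->
  f (bary w t) = \sum_(wt <- zip w t) wt.1 * f wt.2.
Proof.
move=> hf hs h1; have := affine_bary_gen hf hs.
have -> : \sum_(wt <- zip w t) wt.1 * (f wt.2 - f (0, 0, 0)) =
  \sum_(wt <- zip w t) wt.1 * f wt.2 - (\sum_(a <- w) a) * f (0, 0, 0).
  have -> : \sum_(a <- w) a = \sum_(wt <- zip w t) wt.1.
    by rewrite -(big_map fst xpredT id) -/(unzip1 _) unzip1_zip ?hs.
  by rewrite mulr_suml -sumrB; apply: eq_bigr => wt _; rewrite mulrBr.
by rewrite h1 mul1r => /(canRL (subrK _)) ->; rewrite subrK.
Qed.

Definition body (x : V) : Prop :=
  let: (x1, x2, x3) := x in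
  [/\ - x1 <= x3, x3 <= x1, x1 + x3 <= 4, x1 - x3 <= 4 &
    [/\ x2 + x3 <= 4, x2 - x3 <= 4 & 0 <= x2 \/ 0 <= x3 /\ 0 <= x2 + x3]].

(** The set [body] is a union of two convex parts glued along [x3 = 0]. In each part [x] is
    interpolated in the [x2] direction between two triangles of vertices, for instance those in the
    planes [x2 = - x3] and [x2 = 4 - x3] in the upper part; the factors 16 and [4 * (4 + x3)] clear
    the denominators. *)
Lemma body_ge0 f x : affine f -> body x ->
  (forall n, (n < 8)%N -> 0 <= f (zr3 (nth v0 bodyv n))) -> 0 <= f x.
Proof.
case: x => [[x1 x2] x3] hf [h1 h2 h3 h4 [h5 h6 h7]] hv.
have [e1 e2 e3 e4] : [/\ 0 <= f (0, 0, 0), 0 <= f (4, 0, 0), 0 <= f (0, 4, 0) & 0 <= f (4, 4, 0)].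
  by split; [exact: (hv 0%N) | exact: (hv 1%N) | exact: (hv 2) | exact: (hv 3)].
have [e5 e6 e7 e8] : [/\ 0 <= f (2, -2, 2), 0 <= f (2, 2, 2), 0 <= f (2, 0, -2) & 0 <= f (2, 2, -2)].
  by split; [exact: (hv 4) | exact: (hv 5) | exact: (hv 6) | exact: (hv 7)].
have [z0|z0] := leP 0 x3.
  have y0 : 0 <= x2 + x3 by case: h7 => [?|[]//]; apply: addr_ge0.
  suff : 0 <= 16 * f (x1, x2, x3) by rewrite pmulr_rge0.
  have -> : 16 * f (x1, x2, x3) =
     (4 - x3 - x2) * ((4 - x3 - x1) * f (0, 0, 0) + (x1 - x3) * f (4, 0, 0) + 2 * x3 * f (2, -2, 2)) +
     (x2 + x3) * ((4 - x3 - x1) * f (0, 4, 0) + (x1 - x3) * f (4, 4, 0) + 2 * x3 * f (2, 2, 2)).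
    rewrite [f (x1, _, _)]hf [f (4, 0, _)]hf [f (2, -2, _)]hf [f (0, 4, _)]hf
      [f (4, 4, _)]hf [f (2, 2, _)]hf; ring.
  apply: addr_ge0; (apply: mulr_ge0; first by lra);
  (apply: addr_ge0; [apply: addr_ge0|]); apply: mulr_ge0 => //; lra.
have y0 : 0 <= x2 by case: h7 => [//|[]]; lra.
suff : 0 <= (4 * (4 + x3)) * f (x1, x2, x3) by rewrite pmulr_rge0 //; lra.
have -> : (4 * (4 + x3)) * f (x1, x2, x3) =
   (4 + x3 - x2) * ((4 + x3 - x1) * f (0, 0, 0) + (x1 + x3) * f (4, 0, 0) - 2 * x3 * f (2, 0, -2)) +
   x2 * ((4 + x3 - x1) * f (0, 4, 0) + (x1 + x3) * f (4, 4, 0) - 2 * x3 * f (2, 2, -2)).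
  rewrite [f (x1, _, _)]hf [f (4, 0, _)]hf [f (2, 0, _)]hf [f (0, 4, _)]hf
    [f (4, 4, _)]hf [f (2, 2, _)]hf; ring.
rewrite -!mulNr.
apply: addr_ge0; (apply: mulr_ge0; first by lra);
  (apply: addr_ge0; [apply: addr_ge0|]); apply: mulr_ge0 => //; lra.
Qed.
End Real.

(** * Soundness of the certificates *)

Section Certificates.
Variable R : realFieldType.
Local Open Scope ring_scope.
Local Notation V := (R * R * R)%type.
Local Notation zr := (zr R).
Local Notation zr3 := (zr3 R).
Implicit Types (w : seq R) (x p : V) (g h : code).

Definition mval w (m : monomial) : R := \prod_(i <- m) w`_i.
Definition peval w (l : seq (monomial * Z)) : R := \sum_(mc <- l) zr mc.2 * mval w mc.1.

Lemma mval_insert w i m : mval w (insert i m) = w`_i * mval w m.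
Proof.
rewrite /mval; elim: m => [|j m IH] /=; first by rewrite big_seq1 big_nil mulr1.
by case: ifP => _; rewrite !big_cons // IH mulrCA.
Qed.

Lemma peval_add_term w m c l :
  peval w (add_term m c l) = zr c * mval w m + peval w l.
Proof.
rewrite /peval; elim: l => [|[m' c'] l IH] /=; first by rewrite big_seq1 big_nil addr0.
case: eqP => [->|_]; rewrite !big_cons /=; first by rewrite zrD; ring.
by rewrite IH; ring.
Qed.

Lemma peval_add_row w m b zf l :
  peval w (foldr (fun ia l => let: (i, a) := ia in add_term (insert i m) (Z.mul b a) l) l zf) =
  zr b * mval w m * (\sum_(ia <- zf) w`_ia.1 * zr ia.2) + peval w l.
Proof.
elim: zf => [|[i a] zf IH] /=; first by rewrite big_nil mulr0 add0r.
by rewrite big_cons peval_add_term IH mval_insert !zrM /=; ring.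
Qed.

Lemma peval_add_product w s q f l : peval w (add_product s q f l) =
  zr s * peval w q * (\sum_(ia <- zip (iota 0 (size f)) f) w`_ia.1 * zr ia.2) + peval w l.
Proof.
rewrite /add_product; elim: q => [|[m c] q IH] /=.
  by rewrite [in peval w [::]]/peval big_nil mulr0 mul0r add0r.
rewrite [in peval w (_ :: q)]/peval big_cons -/(peval w q) /=.
case: ifP => [/Z.eqb_eq ->|_]; first by rewrite IH zr0 mul0r add0r.
by rewrite peval_add_row IH zrM; ring.
Qed.

Lemma mval_ge0 w m : (forall i, 0 <= w`_i) -> 0 <= mval w m.
Proof. by move=> hw; rewrite /mval; apply: prodr_ge0. Qed.

Lemma peval_ge0 w l : (forall i, 0 <= w`_i) -> all_ge0 l -> 0 <= peval w l.
Proof.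
move=> hw; rewrite /peval; elim: l => [|[m c] l IH] /=; first by rewrite big_nil.
by case/andP=> hc hl; rewrite big_cons addr_ge0 ?IH // mulr_ge0 ?zr_ge0 ?mval_ge0.
Qed.

Lemma all_ge0_terms d : all (Z.leb 0) d -> all_ge0 (terms d).
Proof.
rewrite /terms /all_ge0; elim: d (monomials _) => [|c d IH] [|m s] //= /andP[hc hd].
by rewrite hc /= IH.
Qed.

Lemma peval_gt0 w l : (forall i, 0 <= w`_i) -> (forall i, (i < 3)%N -> 0 < w`_i) ->
  all_ge0 l -> has (fun mc => Z.ltb 0 mc.2 && all (fun i => i < 3)%N mc.1) l ->
  0 < peval w l.
Proof.
move=> hw hw3; rewrite /peval; elim: l => [|[m c] l IH] //= /andP[hc hl].
rewrite big_cons; case/orP=> [/andP[hc' hm]|hh].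
  apply: ltr_pwDl; last exact: peval_ge0.
  apply: mulr_gt0; first exact: zr_gt0.
  rewrite /mval /=; elim: m hm => [|i m IHm] /=; first by rewrite big_nil.
  by case/andP=> hi hm; rewrite big_cons mulr_gt0 ?hw3 ?IHm.
by apply: ltr_wpDl; [rewrite mulr_ge0 ?zr_ge0 ?mval_ge0 | exact: IH].
Qed.

(* Barycentric coordinates of a point of the relative interior of a piece, or of
   the part of its boundary that contains the relative interior of [v0 v1 v3]. *)
Definition weights w (t : seq zvec) : Prop :=
  [/\ size w = size t, \sum_(a <- w) a = 1, forall i, 0 <= w`_i &
      forall i, (i < 3)%N -> 0 < w`_i].

Definition point w (t : seq zvec) : V := bary w [seq zr3 v | v <- t].

Lemma affine_point (f : V -> R) w t : affine f -> size w = size t -> \sum_(a <- w) a = 1 ->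
  f (point w t) = \sum_(wt <- zip w t) wt.1 * f (zr3 wt.2).
Proof.
move=> hf hs h1; rewrite /point affine_bary ?size_map //.
have -> : zip w [seq zr3 v | v <- t] = [seq (wt.1, zr3 wt.2) | wt <- zip w t].
  by elim: w t {hs h1} => [|a w IH] [|v t] //=; rewrite IH.
by rewrite big_map.
Qed.

(** As [B g] is affine in the centre, at a fixed vertex [v] it is the linear form in the weights
    whose coefficients are [values g v t]. *)
Lemma point_values g v w t : perm_axes g.1 -> size w = size t -> \sum_(a <- w) a = 1 ->
  \sum_(ia <- zip (iota 0 (size (values g v t))) (values g v t)) w`_ia.1 * zr ia.2 =
  B g (zr3 v) (point w t).
Proof.
move=> hg hs h1; rewrite (affine_point (affine_Br _ hg) hs h1) /values size_map -hs.
rewrite (big_nth (0%N, Z0)) size2_zip; last by rewrite size_iota size_map hs.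
rewrite size_map [RHS](big_nth (0, v0)) size2_zip ?hs //.
rewrite !big_mkord; apply: eq_bigr => i _; rewrite !nth_zip ?size_iota ?size_map //=.
have hi : (i < size t)%N by case: i => i /=; rewrite ?hs.
by rewrite nth_iota ?hs // add0n (nth_map v0) // zr_B.
Qed.

(** The difference [F] of the two sides is affine in [x], and at a vertex of [body] it is a
    polynomial in the weights with nonnegative coefficients. So [F] is nonnegative at [x]; as each
    [q_j B_j] is nonnegative there too and [d] is positive, [B_g] is nonnegative. *)
Lemma certified_ge0 g t d l w x : weights w t ->
  certified g t d l -> perm_axes g.1 -> all (fun jq => perm_axes jq.1.1) l -> body x ->
  (forall jq, List.In jq l -> 0 <= B jq.1 x (point w t)) -> 0 <= B g x (point w t).
Proof.
move=> [hs h1 hw hw3] /and4P[hd hl hpos hv] hg hperm hx hB.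
set p := point w t in hB *.
pose F (l : seq (code * bform)) y := peval w (terms d) * B g y p +
  \sum_(jq <- l) - peval w (terms jq.2) * B jq.1 y p.
have aF k : affine (F k).
  apply: affineD; first exact/affineZ/affine_Bl.
  elim: k => [|jq k IH]; first by move=> *; rewrite !big_nil; ring.
  have := affineD (affineZ (- peval w (terms jq.2)) (affine_Bl jq.1 p)) IH.
  by move=> h x1 x2 x3; rewrite !big_cons; exact: h.
have FE v : forall k, all (fun jq => perm_axes jq.1.1) k -> F k (zr3 v) =
    peval w (foldr (fun jq s => add_product (-1) (terms jq.2) (values jq.1 v t) s)
      (add_product 1 (terms d) (values g v t) [::]) k).
  elim=> [|jq k IH] /=.
    rewrite /F big_nil addr0 peval_add_product point_values // => _.
    by rewrite [peval w [::]]/peval big_nil addr0 mul1r.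
  case/andP=> hj hk; rewrite peval_add_product point_values // -IH //.
  by rewrite /F big_cons /= addrCA mulN1r.
have F0 : 0 <= F l x.
  apply: body_ge0 (aF l) hx _ => n hn; rewrite FE //; apply: peval_ge0 => //.
  by move/(all_nthP v0): hv; apply.
have D0 : 0 < peval w (terms d) by apply: peval_gt0 => //; exact: all_ge0_terms.
rewrite -(pmulr_rge0 _ D0); apply: le_trans F0 _; rewrite /F gerDl.
elim: l hl hB {hv hperm} => [|jq k IH] /=; first by rewrite big_nil.
case/andP=> hq hk hB; rewrite big_cons -[leRHS]addr0; apply: lerD.
  rewrite mulNr oppr_le0 mulr_ge0 ?hB //; last by left.
  by apply: peval_ge0 => //; exact: all_ge0_terms.
by apply: IH => // j hj; apply: hB; right.
Qed.

Lemma zip_sum_ge0 (T : Type) (x0 : T) w (t : seq T) (F : T -> R) : (forall i, 0 <= w`_i) ->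
  (forall i, (i < size t)%N -> 0 <= F (nth x0 t i)) -> 0 <= \sum_(wt <- zip w t) wt.1 * F wt.2.
Proof.
elim: w t => [|a w IH] [|v t] hw hF; rewrite /= ?big_nil // big_cons addr_ge0 //=.
  by rewrite mulr_ge0 ?(hw 0%N) ?(hF 0%N).
by apply: IH => i; [exact: (hw i.+1) | exact: (hF i.+1)].
Qed.

Lemma dominated_le g h t w x : weights w t -> dominated g h t ->
  perm_axes g.1 -> perm_axes h.1 -> body x -> B h x (point w t) <= B g x (point w t).
Proof.
move=> [hs h1 hw _] hd hg hh hx; rewrite -subr_ge0.
pose f y := B g y (point w t) + (-1) * B h y (point w t).
have af : affine f by exact: affineD (affine_Bl _ _) (affineZ _ (affine_Bl _ _)).
suff : 0 <= f x by rewrite /f mulN1r.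
apply: body_ge0 af hx _ => n hn; rewrite /f mulN1r.
rewrite !affine_point //; try exact: affine_Br.
rewrite -sumrB; under eq_bigr do rewrite -mulrBr.
set v := nth v0 bodyv n.
apply: (@zip_sum_ge0 _ v0 w t (fun u => B g (zr3 v) (zr3 u) - B h (zr3 v) (zr3 u))) => // i hi.
rewrite -!zr_B -zrB zr_ge0 //.
move/(all_nthP v0)/(_ n hn)/(all_nthP (v0, v0))/(_ i): hd.
rewrite -/v size2_zip ?size_map // nth_zip ?size_map //= !(nth_map v0) // => /(_ hi).
by rewrite /zB; lia.
Qed.

Lemma nonneg_on_body_ge0 g t w x : weights w t -> nonneg_on_body g t ->
  perm_axes g.1 -> body x -> 0 <= B g x (point w t).
Proof.
move=> [hs h1 hw _] hd hg hx.
apply: body_ge0 (affine_Bl _ _) hx _ => n hn.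
rewrite affine_point //; last exact: affine_Br.
set v := nth v0 bodyv n.
apply: (@zip_sum_ge0 _ v0 w t (fun u => B g (zr3 v) (zr3 u))) => // i hi.
rewrite -zr_B zr_ge0 //.
move/(all_nthP v0)/(_ i hi)/(all_nthP v0)/(_ n hn): hd; rewrite -/v.
rewrite /zB; move: (zdist v _) (zdist v (zapp g _)) => a b; lia.
Qed.
End Certificates.

(** * Confinement of the Voronoi cell to the body *)

Section Body.
Variable R : realFieldType.
Local Open Scope ring_scope.
Local Notation V := (R * R * R)%type.
Local Notation zr := (zr R).
Local Notation zr3 := (zr3 R).
Implicit Types (w : seq R) (x p : V) (g h : code) (a b c d : R) (t : seq zvec).

(** Up to positive factors [2 - a - c], [a - b], [c] and [b - c] are the weights of [v0], [v1], [v3]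
    and [v2]; only the last may vanish. *)
Definition chamber p : Prop :=
  let: (a, b, c) := p in [/\ 0 < c, c <= b, b < a & a + c < 2].

Lemma seq4 w : size w = 4 -> exists a b c d, w = [:: a; b; c; d].
Proof. by case: w => [|a [|b [|c [|d []]]]] // _; exists a, b, c, d. Qed.

Lemma seq3 w : size w = 3 -> exists a b c, w = [:: a; b; c].
Proof. by case: w => [|a [|b [|c []]]] // _; exists a, b, c. Qed.

Lemma weights4 a b c d t : size t = 4 -> a + b + c + d = 1 ->
  0 < a -> 0 < b -> 0 < c -> 0 <= d -> weights [:: a; b; c; d] t.
Proof.
move=> hs h1 ha hb hc hd; split; rewrite ?hs //.
- by rewrite !big_cons big_nil addr0 -h1 !addrA.
- case=> [|[|[|[|i]]]] /=; rewrite ?(ltW ha) ?(ltW hb) ?(ltW hc) //.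
  by rewrite nth_nil.
- by case=> [|[|[|i]]].
Qed.

Lemma weights4E a b c d t : weights [:: a; b; c; d] t ->
  [/\ a + b + c + d = 1, 0 < a, 0 < b, 0 < c & 0 <= d].
Proof.
case=> _ h1 hw h3; split; [|exact: (h3 0%N)|exact: (h3 1%N)|exact: (h3 2%N)|exact: (hw 3%N)].
by move: h1; rewrite !big_cons big_nil addr0 !addrA.
Qed.

Lemma weights3E a b c t : weights [:: a; b; c] t ->
  [/\ a + b + c = 1, 0 < a, 0 < b & 0 < c].
Proof.
case=> _ h1 hw h3; split; [|exact: (h3 0%N)|exact: (h3 1%N)|exact: (h3 2%N)].
by move: h1; rewrite !big_cons big_nil addr0 !addrA.
Qed.

Lemma zr1 : zr 1 = 1. Proof. by []. Qed.
Lemma zr2 : zr 2 = 2. Proof. by []. Qed.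
Lemma zr4 : zr 4 = 4. Proof. by []. Qed.
Lemma zrm4 : zr (-4) = -4. Proof. by []. Qed.

Definition simpz := (zr0 R, zr1, zr2, zr4, zrm4).

(** Since [vm] is the midpoint of [v1] and [v2], its weight is shared equally between them; a
    triangle is completed by a fourth weight 0. *)
Lemma within_point m n w : within m n -> (n < 4)%N -> weights w (piece n) ->
  exists2 w', weights w' (piece m) & point w' (piece m) = point w (piece n).
Proof.
have [-> _ _|hmn] := eqVneq m n; first by exists w.
case: n m hmn => [|[|[|[|n]]]] [|[|m]] //= hmn hin _ hw;
  try by rewrite hin in hmn.
- have [a [b [c [d e]]]] := seq4 (let: And4 h _ _ _ := hw in h); subst w.
  have [h1 ha hb hc hd] := weights4E hw.
  exists [:: a; b + d / 2; c; d / 2]; first by apply: weights4 => //; lra.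
  by rewrite /point /bary /= !simpz; congr (_, _, _); lra.
- have [a [b [c [d e]]]] := seq4 (let: And4 h _ _ _ := hw in h); subst w.
  have [h1 ha hb hc hd] := weights4E hw.
  exists [:: a; b / 2; c; d + b / 2]; first by apply: weights4 => //; lra.
  by rewrite /point /bary /= !simpz; congr (_, _, _); lra.
- have [a [b [c e]]] := seq3 (let: And4 h _ _ _ := hw in h); subst w.
  have [h1 ha hb hc] := weights3E hw.
  exists [:: a; b; c; 0]; first by apply: weights4 => //; lra.
  by rewrite /point /bary /= !simpz; congr (_, _, _); lra.
- have [a [b [c e]]] := seq3 (let: And4 h _ _ _ := hw in h); subst w.
  have [h1 ha hb hc] := weights3E hw.
  exists [:: a; b; c; 0]; first by apply: weights4 => //; lra.
  by rewrite /point /bary /= !simpz; congr (_, _, _); lra.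
Qed.

Lemma chamber_point n w : (n < 4)%N -> weights w (piece n) -> chamber (point w (piece n)).
Proof.
move=> hn /(within_point (m := 0) isT hn) [{}w hw <-].
have [a [b [c [d e]]]] := seq4 (let: And4 h _ _ _ := hw in h); subst w.
have [h1 ha hb hc hd] := weights4E hw.
by rewrite /point /bary /= !simpz; split; lra.
Qed.

(* The sector argument: if [x] is at least as close to [p] as to its two images
   under a rotation of order three about the line [y1 = y2 = y3], and [p] is
   outside this line with [a > b >= c], then [x] is in a half-space. *)
Lemma sector (a b c x1 x2 x3 : R) : b < a -> c <= b ->
  0 <= x1 * (a - b) + x2 * (b - c) + x3 * (c - a) ->
  0 <= x1 * (a - c) + x2 * (b - a) + x3 * (c - b) -> x3 <= x1.
Proof.
move=> ba cb f1 f2.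
have D : 0 < (a - b) ^+ 2 + (a - c) * (b - c).
  by rewrite ltr_pwDl ?exprn_gt0 ?mulr_ge0 ?subr_gt0 ?subr_ge0 // (le_trans cb) ?ltW.
rewrite -subr_ge0 -(pmulr_rge0 _ D).
have -> : ((a - b) ^+ 2 + (a - c) * (b - c)) * (x1 - x3) =
  (a - b) * (x1 * (a - b) + x2 * (b - c) + x3 * (c - a)) +
  (b - c) * (x1 * (a - c) + x2 * (b - a) + x3 * (c - b)) by ring.
by rewrite addr_ge0 ?mulr_ge0 ?subr_ge0 // ltW.
Qed.

Lemma body_required H x p : chamber p ->
  (forall g, List.In g (required H) -> 0 <= B g x p) -> body x.
Proof.
case: p x => [[a b] c] [[x1 x2] x3] [c0 cb ba ac] hB.
have [e1 e2] := (hB _ (or_introl erefl), hB _ (or_intror (or_introl erefl))).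
have e3 := hB _ (or_intror (or_intror (or_introl erefl))).
have e4 := hB _ (or_intror (or_intror (or_intror (or_introl erefl)))).
have e5 := hB _ (or_intror (or_intror (or_intror (or_intror (or_introl erefl))))).
have e6 := hB _ (or_intror (or_intror (or_intror (or_intror (or_intror (or_introl erefl)))))).
have e7 := hB _ (or_intror (or_intror (or_intror (or_intror (or_intror (or_intror (or_introl erefl))))))).
have e8 := hB _ (or_intror (or_intror (or_intror (or_intror (or_intror (or_intror (or_intror (or_introl erefl)))))))).
have {}hB g : List.In g (drop 8 (required H)) -> 0 <= B g (x1, x2, x3) (a, b, c).
  by rewrite /= drop0 => hg; apply: hB; do 8!right.
move: e1 e2 e3 e4 e5 e6 e7 e8; rewrite /B /app /lapp /sel /= !simpz => e1 e2 e3 e4 e5 e6 e7 e8.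
have h1 : x3 <= x1.
  by apply: (@sector a b c x1 x2 x3) => //; [move: e1 | move: e2]; clear; lra.
(* Here centre and point are first reflected in the plane [x3 = 0], and for [h3] in the plane
   [x1 = 2], which brings the rotation axis to the line of [sector]. *)
have h2 : - x3 <= x1.
  by apply: (@sector a b (- c) x1 x2 (- x3)) => //; [lra | move: e3 | move: e4]; clear; lra.
have h3 : x3 <= 4 - x1.
  by apply: (@sector (4 - a) b c (4 - x1) x2 x3) => //; [lra | move: e5 | move: e6]; clear; lra.
have f7 : 0 <= x2 * b + x3 * c by move: e7; clear; lra.
have f8 : 0 <= (2 - a) * (2 - x1) + (2 - b) * (2 - x2) by move: e8; clear; lra.
clear e1 e2 e3 e4 e5 e6 e7 e8.
have h4 : - x3 <= 4 - x1.
  (* Only kept isometries may be used. The two rotations of order three of the last case lie in R1,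
     but reasons may exclude them in larger subgroups; a half-turn, or two isometries of class
     [(true, false, 2)], then take their place. *)
  move: hB; rewrite /required /= drop0; case: ifP => [_|_]; last case: ifP => [_|_].
  - move=> /(_ _ (or_introl erefl)); rewrite /B /app /lapp /sel /= !simpz => e9.
    have f9 : 0 <= (2 - a) * (2 - x1) + c * x3 by move: e9; clear; lra.
    have [z0|z0] := leP 0 x3; last first.
      suff : x1 <= 2 by lra.
      have q1 : 0 <= c * - x3 by rewrite mulr_ge0; lra.
      have : 0 <= (2 - a) * (2 - x1) by lra.
      by rewrite pmulr_rge0; lra.
    have q1 : 0 <= (2 - a - c) * x3 by rewrite mulr_ge0; lra.
    have : 0 <= (2 - a) * (2 - x1 + x3) by lra.
    by rewrite pmulr_rge0; lra.
  - move=> hB; have := (hB _ (or_introl erefl), hB _ (or_intror (or_introl erefl))).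
    rewrite /B /app /lapp /sel /= !simpz => -[e9 e10].
    have f9 : 0 <= 2 * (2 - a) * (2 - x1) + x2 * (b - c) + x3 * (b + c).
      by move: e9; clear; lra.
    have f10 : 0 <= 8 - 4 * b - x1 * (4 - a - b) - x2 * (a - b) + 2 * c * x3.
      by move: e10; clear; lra.
    (* The weights [a - b] and [b - c] eliminate [x2] from [f9] and [f10]. *)
    have f11 : 0 <= (a - b) * (2 * (2 - a) * (2 - x1) + x3 * (b + c)) +
                    (b - c) * (8 - 4 * b - x1 * (4 - a - b) + 2 * c * x3).
      by rewrite (_ : _ + _ = (a - b) * (2 * (2 - a) * (2 - x1) + x2 * (b - c) + x3 * (b + c))
        + (b - c) * (8 - 4 * b - x1 * (4 - a - b) - x2 * (a - b) + 2 * c * x3));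
        [rewrite addr_ge0 ?mulr_ge0 //; lra | ring].
    clear e9 e10 f7 f8 f9 f10 hB.
    rewrite -subr_ge0 opprK leNgt; apply/negP => ht.
    have q0 : x3 < 0 by lra.
    have q1 : 0 < (a - b) * ((2 - a) * (x1 - 2)) by rewrite !mulr_gt0 //; lra.
    have q3 : 0 <= (a - b) * (c * - x3) by rewrite !mulr_ge0 //; lra.
    have q5 : 0 <= (b - c) * (c * - x3) by rewrite !mulr_ge0 //; lra.
    have [m2|m2] := leP 2 (- x3).
      have q2 : 0 <= (a - b) * ((b - c) * (- x3 - 2)) by rewrite !mulr_ge0 //; lra.
      have q4 : 0 <= (b - c) * ((x1 - 2) * (4 - a - b)) by rewrite !mulr_ge0 //; lra.
      lra.
    have q4 : 0 <= (b - c) * ((x1 - 4 - x3) * (4 - a - b)) by rewrite !mulr_ge0 //; lra.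
    have q6 : 0 <= (b - c) * ((2 + x3) * (4 - 2 * a)) by rewrite !mulr_ge0 //; lra.
    lra.
  - move=> hB; have := (hB _ (or_introl erefl), hB _ (or_intror (or_introl erefl))).
    rewrite /B /app /lapp /sel /= !simpz => -[e9 e10].
    by apply: (@sector (4 - a) b (- c) (4 - x1) x2 (- x3)); [lra | lra | move: e9 | move: e10];
      clear; lra.
(* By [f8], from the half-turn about the line [x1 = x2 = 2], the product [(2 - b) * (4 - x2 - s)] is
   at least [(2 - a) * (x1 - s) + (a - b) * (2 - s)]. Both [x3] and [- x3] are admissible values of
   [s]. *)
have h5 s : s <= x1 -> s <= 2 -> x2 + s <= 4.
  move=> sx s2; suff : 0 <= (2 - b) * (4 - x2 - s) by rewrite pmulr_rge0; lra.
  have q1 : 0 <= (2 - a) * (x1 - s) by rewrite mulr_ge0 //; lra.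
  have q2 : 0 <= (a - b) * (2 - s) by rewrite mulr_ge0 //; lra.
  lra.
split; try lra; split; [apply: h5; lra | apply: (h5 (- x3)); lra |].
have [z0|z0] := leP 0 x3; [right; split=> // | left].
  suff : 0 <= b * (x2 + x3) by rewrite pmulr_rge0; lra.
  have q1 : 0 <= (b - c) * x3 by rewrite mulr_ge0 //; lra.
  lra.
suff : 0 <= b * x2 by rewrite pmulr_rge0; lra.
have q1 : 0 <= c * - x3 by rewrite mulr_ge0 //; lra.
lra.
Qed.
End Body.

Section Lists.
Lemma all_in (T : Type) (P : pred T) s (x : T) : all P s -> List.In x s -> P x.
Proof. by elim: s => //= y s IH /andP[py ps] [<-|/IH]; auto. Qed.

Lemma has_in (T : Type) (P : pred T) s : has P s -> exists2 x, List.In x s & P x.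
Proof.
elim: s => //= y s IH /orP[py|/IH[x hx px]]; first by exists y; [left|].
by exists x; [right|].
Qed.

Lemma in_filter (T : Type) (P : pred T) s (x : T) : List.In x [seq y <- s | P y] <-> List.In x s /\ P x.
Proof.
elim: s => /= [|y s [IH1 IH2]]; first tauto.
case: ifP => py /=; split.
- by case=> [<-|/IH1 []]; auto.
- by case=> [[->|h1] h2]; auto.
- by case/IH1; auto.
- by case=> [[yx|h1] h2]; [rewrite yx h2 in py | apply: IH2].
Qed.

Lemma in_map (T U : Type) (f : T -> U) s y : List.In y [seq f x | x <- s] <-> exists2 x, List.In x s & y = f x.
Proof.
elim: s => /= [|x s [IH1 IH2]]; first by split=> // -[].
split; first by case=> [<-|/IH1[z hz ->]]; [exists x; auto | exists z; auto].
by case=> z [xz|hz] yz; [left; rewrite xz yz | right; apply: IH2; exists z].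
Qed.

Lemma in_nth (T : Type) (x0 : T) s i : (i < size s)%N -> List.In (nth x0 s i) s.
Proof. by elim: s i => [|y s IH] [|i] //= hi; auto. Qed.

Lemma in_ex_nth (T : Type) (x0 : T) s (x : T) : List.In x s -> exists2 i, (i < size s)%N & nth x0 s i = x.
Proof.
elim: s => //= y s IH [<-|/IH[i hi <-]]; first by exists 0%N.
by exists i.+1.
Qed.

End Lists.

Section FactsSound.
Variable R : realFieldType.
Local Open Scope ring_scope.
Local Notation V := (R * R * R)%type.
Local Notation zr := (zr R).
Local Notation zr3 := (zr3 R).
Implicit Types (w : seq R) (x p : V) (g h : code).

Lemma decode_perm z : perm_axes (decode z).1.
Proof.
rewrite /decode /= /lin_of; move: (Z.div _ 8) => q.
by rewrite /axes_of; case: q => [|[[[]|[]|]|[[]|[]|]|]|].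
Qed.

Lemma perm_nth_code j : perm_axes (nth_code j).1.
Proof.
rewrite /nth_code; have [hj|hj] := ltnP j (size facts).
  by rewrite /codes (nth_map (Z0, [::])) // decode_perm.
by rewrite nth_default ?size_map // decode_perm.
Qed.

Lemma zeqvP u v : reflect (u = v) (zeqv u v).
Proof.
case: u v => [[u1 u2] u3] [[v1 v2] v3] /=.
apply: (iffP and3P) => [[/Z.eqb_eq -> /Z.eqb_eq -> /Z.eqb_eq ->] //|[-> -> ->]].
by split; apply/Z.eqb_eq.
Qed.

Lemma eqrowP r s : reflect (r = s) (eqrow r s).
Proof. by apply: (iffP idP); case: r s => [[] []] [[] []]. Qed.

Lemma eqlinP l m : reflect (l = m) (eqlin l m).
Proof.
case: l m => [[r1 r2] r3] [[s1 s2] s3]; apply: (iffP and3P) => /=.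
  by case=> /eqrowP-> /eqrowP-> /eqrowP->.
by case=> -> -> ->; split; apply/eqrowP.
Qed.

Lemma eqcodeP g h : reflect (g = h) (eqcode g h).
Proof.
case: g h => [l b] [m c]; rewrite /eqcode /=.
by apply: (iffP andP) => [[/eqlinP-> /zeqvP->]|[-> ->]]; last by split; [apply/eqlinP|apply/zeqvP].
Qed.

Lemma all_linsP l : perm_axes l -> List.In l all_lins.
Proof.
move=> hl; suff /has_in[m hm /eqlinP->] : has (eqlin l) all_lins by [].
by case: l hl => [[[[] []] [[] []]] [[] []]].
Qed.

End FactsSound.

Ltac Zify.zify_post_hook ::= Z.to_euclidean_division_equations.

Section Box.
Local Open Scope Z_scope.
Lemma boxP (b1 b2 b3 : Z) : in_lattice (b1, b2, b3) ->
  Z.leb (-6) b1 && Z.leb b1 10 -> Z.leb (-8) b2 && Z.leb b2 10 ->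
  Z.leb (-8) b3 && Z.leb b3 8 -> List.In (b1, b2, b3) box.
Proof.
move=> /and3P[/Z.eqb_eq p1 /Z.eqb_eq p2 /Z.eqb_eq p3].
move=> /andP[/Z.leb_le q1 /Z.leb_le r1] /andP[/Z.leb_le q2 /Z.leb_le r2].
move=> /andP[/Z.leb_le q3 /Z.leb_le r3]; suff /has_in[b hb /zeqvP->] : has (zeqv (b1, b2, b3)) box by [].
have [e|e] : (Z.modulo b1 4 = 0 \/ Z.modulo b1 4 = 2) by lia.
  have h1 : (b1 = -4 \/ b1 = 0 \/ b1 = 4 \/ b1 = 8) by lia.
  have h2 : (b2 = -8 \/ b2 = -4 \/ b2 = 0 \/ b2 = 4 \/ b2 = 8) by lia.
  have h3 : (b3 = -8 \/ b3 = -4 \/ b3 = 0 \/ b3 = 4 \/ b3 = 8) by lia.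
  clear p1 p2 p3 q1 q2 q3 r1 r2 r3 e.
  by case: h1 h2 h3 => [->|[->|[->|->]]] [->|[->|[->|[->|->]]]] [->|[->|[->|[->|->]]]].
have h1 : (b1 = -6 \/ b1 = -2 \/ b1 = 2 \/ b1 = 6 \/ b1 = 10) by lia.
have h2 : (b2 = -6 \/ b2 = -2 \/ b2 = 2 \/ b2 = 6 \/ b2 = 10) by lia.
have h3 : (b3 = -6 \/ b3 = -2 \/ b3 = 2 \/ b3 = 6) by lia.
clear p1 p2 p3 q1 q2 q3 r1 r2 r3 e.
by case: h1 h2 h3 => [->|[->|[->|[->|->]]]] [->|[->|[->|[->|->]]]] [->|[->|[->|->]]].
Qed.

End Box.

Lemma facts_ok_nth nc k l i : facts_ok nc k l -> (i < size l)%N ->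
  all (reason_ok nc (decode (nth (Z0, [::]) l i).1) (k + i)) (nth (Z0, [::]) l i).2.
Proof.
elim: l k i => //= f l IH k [|i] /andP[hf hl] hi; first by rewrite addn0.
by rewrite addnS -addSn; exact: IH.
Qed.

Lemma box_casesP ls bs cs : box_cases ls bs cs -> forall l b, List.In l ls -> List.In b bs ->
  nonneg_on_body (l, b) (piece 0) || has (zeqv b) [seq g.2 | g <- cs & eqlin l g.1].
Proof. by move=> h l b hl hb; exact: (all_in (all_in h hl) hb). Qed.

(** * The cell of a centre in the relative interior of a piece *)

Section Leaf.
Variable R : realFieldType.
Local Open Scope ring_scope.
Local Notation V := (R * R * R)%type.
Local Notation zr := (zr R).
Local Notation zr3 := (zr3 R).
Implicit Types (w : seq R) (x p : V) (g h : code).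

Lemma zr_le a b : Z.leb a b -> zr a <= zr b.
Proof. by move=> h; rewrite -subr_ge0 -zrB zr_ge0 //; lia. Qed.

Lemma sel_chamber r p : chamber p -> -2 <= sel -%R r p <= 2.
Proof. by case: p r => [[a b] c] [[] []] [] /= *; apply/andP; split; lra. Qed.

(** With [s = |x3|] the coordinate differences are at most [4 - s], 4 and [s + 1], and the sum of
    squares [33 - 6 s + 2 s^2] is at most 33 for [s] between 0 and 2. *)
Lemma dist2_body x p : body x -> chamber p -> dist2 x p <= 33.
Proof.
case: x p => [[x1 x2] x3] [[a b] c] [h1 h2 h3 h4 [h5 h6 h7]] [c0 cb ba ac] /=.
have [s [s0 s2 e1 e2 e3]] : exists s, [/\ 0 <= s, s <= 2, `|x1 - a| <= 4 - s,
    `|x2 - b| <= 4 & `|x3 - c| <= s + 1].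
  have [z0|z0] := leP 0 x3; [exists x3 | exists (- x3)]; split; rewrite ?ler_norml;
    try apply/andP; try split; case: h7 => [|[]]; lra.
have sq (y z : R) : `|y| <= z -> y ^+ 2 <= z ^+ 2.
  rewrite ler_norml => /andP[l1 l2]; have : 0 <= (z - y) * (z + y) by rewrite mulr_ge0 //; lra.
  lra.
apply: le_trans (lerD (lerD (sq _ _ e1) (sq _ _ e2)) (sq _ _ e3)) _.
have : 0 <= s * (2 - s) by rewrite mulr_ge0 ?subr_ge0.
lra.
Qed.

(** A translation outside these bounds moves some coordinate of the image of [p], which is at most 2
    in absolute value before translation, to a distance at least 6 from that of [x]; and 36 exceeds
    the bound 33. *)
Lemma B_far (x p : V) g : body x -> chamber p ->
  ~~ (let: (b1, b2, b3) := g.2 in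
    [&& Z.leb (-7) b1 && Z.leb b1 11, Z.leb (-9) b2 && Z.leb b2 11 & Z.leb (-9) b3 && Z.leb b3 9]) ->
  0 <= B g x p.
Proof.
case: g => [l [[b1 b2] b3]] hx hp /= hb; rewrite subr_ge0.
apply: le_trans (dist2_body hx hp) _; apply: (@le_trans _ _ 36); first lra.
case: x hx => [[x1 x2] x3] [h1 h2 h3 h4 [h5 h6 h7]].
have [/andP[s1 t1] /andP[s2 t2] /andP[s3 t3]] := And3 (sel_chamber l.1.1 hp)
  (sel_chamber l.1.2 hp) (sel_chamber l.2 hp).
rewrite /dist2 /app /lapp /=.
have sq (y : R) : 6 <= y \/ y <= -6 -> 36 <= y ^+ 2.
  case=> hy.
    have : 0 <= (y - 6) * (y + 6) by rewrite mulr_ge0 //; lra.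
    lra.
  have : 0 <= (- 6 - y) * (6 - y) by rewrite mulr_ge0 //; lra.
  lra.
have z12 : zr 12 = 12 by []. have z10 : zr 10 = 10 by [].
have zm8 : zr (-8) = -8 by []. have zm10 : zr (-10) = -10 by [].
have [c1|c1] : (Z.leb 12 b1 \/ Z.leb b1 (-8)) \/
  ((Z.leb 12 b2 \/ Z.leb b2 (-10)) \/ (Z.leb 10 b3 \/ Z.leb b3 (-10))) by lia.
  rewrite -addrA ler_wpDr ?addr_ge0 ?sqr_ge0 // sq //.
  by case: c1 => /zr_le; rewrite ?z12 ?zm8 => c1; [right | left]; case: h7 => [|[]]; lra.
case: c1 => [c1|c1].
  rewrite [_ ^+ 2 + _]addrC -addrA ler_wpDr ?addr_ge0 ?sqr_ge0 // sq //.
  by case: c1 => /zr_le; rewrite ?z12 ?zm10 => c1; [right | left]; case: h7 => [|[]]; lra.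
rewrite addrC ler_wpDr ?addr_ge0 ?sqr_ge0 // sq //.
by case: c1 => /zr_le; rewrite ?z10 ?zm10 => c1; [right | left]; case: h7 => [|[]]; lra.
Qed.

Variables (H : subgroup) (n : nat) (w : seq R) (x : V).
Hypotheses (hn : (n < 4)%N) (hw : weights w (piece n)).
Hypothesis hreq : all (fun g => has (eqcode g) (Kset decoded known_cosets H n)) (required H).
Local Notation p := (point w (piece n)).
Hypothesis hK : forall g, List.In g (Kset decoded known_cosets H n) -> 0 <= B g x p.

Let hp : chamber p := chamber_point hn hw.

Lemma leaf_body : body x.
Proof.
apply: body_required (hp) _ => g hg.
by have /has_in[h hh /eqcodeP->] := all_in hreq hg; exact: hK.
Qed.

Lemma nth_known j : (j < size facts)%N ->
  nth (false, false, Z0) known_cosets j = cls (nth_code j).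
Proof. by move=> hj; rewrite /known_cosets (nth_map code0) ?size_map. Qed.

(** Strong induction along the table: a kept isometry is covered by [hK], any other has an
    applicable reason whose premises come earlier and lie in the subgroup. *)
Lemma fact_ge0 i : (i < size facts)%N -> mem_cls H (cls (nth_code i)) -> 0 <= B (nth_code i) x p.
Proof.
elim/ltn_ind: i => i IH hi hc.
have hf := facts_ok_nth facts_okT hi; rewrite add0n in hf.
have eg : nth_code i = decode (nth (Z0, [::]) facts i).1 by rewrite /nth_code (nth_map (Z0, [::])).
set f := nth _ facts i in hf eg.
have IHj j : (j < i)%N -> mem_cls H (nth (false, false, Z0) known_cosets j) ->
    0 <= B (nth_code j) x p.
  by move=> hj; rewrite nth_known ?(ltn_trans hj) //; exact: IH (ltn_trans hj hi).
case hk : (kept known_cosets H n (decode f.1, f.2)).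
  rewrite eg; apply: hK; rewrite /Kset in_map; exists (decode f.1, f.2) => //.
  rewrite in_filter; split=> //; rewrite /decoded in_map; exists f => //.
  exact: in_nth.
move: hk; rewrite /kept /= -eg hc /= => /negbFE/has_in[r hr /andP[hm hpr]].
have := all_in hf hr; case: r hr hm hpr => [m j|m d l] _ /= hm.
  rewrite andbT => hj /andP[ji hd].
  have [w' hw' e] := within_point hm hn hw.
  apply: le_trans (IHj _ ji hj) _; rewrite -e; apply: dominated_le => //.
  - by rewrite -eg in hd.
  - exact: perm_nth_code.
  - exact: perm_nth_code.
  - exact: leaf_body.
move=> hj /andP[ji hd]; have [w' hw' e] := within_point hm hn hw.
rewrite -eg in hd; rewrite -e.
apply: certified_ge0 hw' hd (perm_nth_code _) _ leaf_body _.
  by rewrite all_map; apply/allP => jq _ /=; exact: perm_nth_code.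
move=> jq /in_map[[j q] hjq ->] /=; rewrite e; apply: IHj; first exact: (all_in ji hjq).
by apply: (all_in hj); rewrite in_map; exists (j, q).
Qed.

(** The infinitely many isometries split into those with a far translation, those whose inequality
    holds on all of [body] for every centre in piece 0, and those listed in the table. *)
Theorem leaf_ge0 g : wf g -> mem_cls H (cls g) -> 0 <= B g x p.
Proof.
case: g => [l [[b1 b2] b3]] /andP[hl hb] hc.
have [far|] := boolP (~~ [&& Z.leb (-7) b1 && Z.leb b1 11, Z.leb (-9) b2 && Z.leb b2 11
  & Z.leb (-9) b3 && Z.leb b3 9]); first exact: B_far leaf_body hp _.
rewrite negbK => near.
have hbox : List.In (b1, b2, b3) box.
  move: (hb) near; case/and3P => /Z.eqb_eq e1 /Z.eqb_eq e2 /Z.eqb_eq e3.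
  case/and3P=> /andP[/Z.leb_le q1 /Z.leb_le r1] /andP[/Z.leb_le q2 /Z.leb_le r2].
  move=> /andP[/Z.leb_le q3 /Z.leb_le r3].
  by apply: boxP hb _ _ _; apply/andP; split; apply/Z.leb_le; lia.
case/orP: (box_casesP box_okT (all_linsP hl) hbox) => [hpos|].
  have [w' hw' <-] := within_point (m := 0) isT hn hw.
  exact: nonneg_on_body_ge0 hw' hpos hl leaf_body.
case/has_in=> b' /in_map[[l' b''] /in_filter[hcode ll] e'] hz.
have {}ll : l = l' by apply/eqlinP.
have bb : (b1, b2, b3) = b'' by apply/zeqvP; rewrite e' in hz.
have [i hi ei] := in_ex_nth code0 hcode; rewrite size_map in hi.
have e : nth_code i = (l, (b1, b2, b3)) by rewrite /nth_code ei -ll bb.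
by rewrite -e; apply: fact_ge0 => //; rewrite e.
Qed.
End Leaf.

(** * The group of codes *)

Definition flip (r : axis * bool) : axis * bool := (r.1, ~~ r.2).
(** The rows of a product are rows of [m], selected and negated by [l] exactly as the coordinates of
    a vector are. *)
Definition lcomp (l m : lin) : lin := lapp flip l m.
Definition lin_id : lin := ((X1, false), (X2, false), (X3, false)).
Definition linv (l : lin) : lin := head l [seq m <- all_lins | eqlin (lcomp m l) lin_id].
Definition ccomp (g h : code) : code := (lcomp g.1 h.1, zapp g h.2).
Definition cinv (g : code) : code := (linv g.1, zopp (lapp Z.opp (linv g.1) g.2)).

Lemma lin_tables : all (fun l => all (fun m => [&& perm_axes (lcomp l m),
  odd_axes (lcomp l m) == odd_axes l (+) odd_axes m & flips (lcomp l m) == flips l (+) flips m])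
  all_lins) all_lins.
Proof. by vm_compute. Qed.

Lemma linv_table : all (fun l => [&& perm_axes (linv l), eqlin (lcomp (linv l) l) lin_id &
  eqlin (lcomp l (linv l)) lin_id]) all_lins.
Proof. by vm_compute. Qed.

Lemma lcompP l m : perm_axes l -> perm_axes m -> [/\ perm_axes (lcomp l m),
  odd_axes (lcomp l m) = odd_axes l (+) odd_axes m & flips (lcomp l m) = flips l (+) flips m].
Proof.
move=> /all_linsP hl /all_linsP hm.
by have /and3P[-> /eqP-> /eqP->] := all_in (all_in lin_tables hl) hm.
Qed.

Lemma linvP l : perm_axes l ->
  [/\ perm_axes (linv l), lcomp (linv l) l = lin_id & lcomp l (linv l) = lin_id].
Proof. by move=> /all_linsP /(all_in linv_table)/and3P[-> /eqlinP-> /eqlinP->]. Qed.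

Lemma sel_lapp (T : Type) (opp : T -> T) r l x : involutive opp ->
  sel opp (sel flip r l) x = sel opp r (lapp opp l x).
Proof.
move=> oppK; case: r l x => [a s] [[[a1 s1] [a2 s2]] [a3 s3]] x.
by rewrite /sel /lapp; case: x => [[x1 x2] x3]; case: a s => [] [] /=;
  [case: s1|case: s1|case: s2|case: s2|case: s3|case: s3]; rewrite ?oppK.
Qed.

Lemma lapp_comp (T : Type) (opp : T -> T) l m x : involutive opp ->
  lapp opp (lcomp l m) x = lapp opp l (lapp opp m x).
Proof. by move=> oppK; rewrite /lapp /lcomp /= !sel_lapp. Qed.

Section IntegerCodes.
Local Open Scope Z_scope.

Lemma in_lattice_app l b c : in_lattice b -> in_lattice c -> perm_axes l ->
  in_lattice (zadd (lapp Z.opp l b) c).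
Proof.
case: b c => [[b1 b2] b3] [[c1 c2] c3] /and3P[/Z.eqb_eq p1 /Z.eqb_eq p2 /Z.eqb_eq p3].
move=> /and3P[/Z.eqb_eq q1 /Z.eqb_eq q2 /Z.eqb_eq q3] hl.
(* Writing lattice vectors as [2 e (1, 1, 1) + 4 m] turns the congruences into linear equations
   within reach of [lia]. *)
have {p1 p2 p3}[e [m1 [m2 [m3 [-> -> ->]]]]] : exists e m1 m2 m3,
  [/\ b1 = (e + e) + (m1 + m1 + (m1 + m1)),
   b2 = (e + e) + (m2 + m2 + (m2 + m2)) & b3 = (e + e) + (m3 + m3 + (m3 + m3))].
  by exists (b1 / 2), 0, ((b2 - b1) / 4), ((b3 - b1) / 4); split; lia.
have {q1 q2 q3}[f [n1 [n2 [n3 [-> -> ->]]]]] : exists e m1 m2 m3,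
  [/\ c1 = (e + e) + (m1 + m1 + (m1 + m1)),
   c2 = (e + e) + (m2 + m2 + (m2 + m2)) & c3 = (e + e) + (m3 + m3 + (m3 + m3))].
  by exists (c1 / 2), 0, ((c2 - c1) / 4), ((c3 - c1) / 4); split; lia.
case: l hl => [[[a1 s1] [a2 s2]] [a3 s3]] hl.
apply/and3P; rewrite /sel; split; apply/Z.eqb_eq.
- by clear hl; case: a1; case: s1 => /=; lia.
- by clear hl; case: a1; case: a2; case: s1; case: s2 => /=; lia.
- by clear hl; case: a1; case: a3; case: s1; case: s3 => /=; lia.
Qed.

(** Permuting coordinates preserves the class. Changing the sign of [b_i] subtracts [b_i], which is
    0 modulo 4 for an even class and 2 for an odd one, so each sign change acts on Z/4 as
    negation. *)
Lemma shift_class_app l b c : in_lattice b -> in_lattice c -> perm_axes l ->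
  shift_class (zadd (lapp Z.opp l b) c) =
  (if flips l then shift_class c - shift_class b else shift_class c + shift_class b) mod 4.
Proof.
case: b c => [[b1 b2] b3] [[c1 c2] c3] /and3P[/Z.eqb_eq p1 /Z.eqb_eq p2 /Z.eqb_eq p3].
move=> /and3P[/Z.eqb_eq q1 /Z.eqb_eq q2 /Z.eqb_eq q3].
have {p1 p2 p3}[e [m1 [m2 [m3 [-> -> ->]]]]] : exists e m1 m2 m3,
  [/\ b1 = (e + e) + (m1 + m1 + (m1 + m1)),
   b2 = (e + e) + (m2 + m2 + (m2 + m2)) & b3 = (e + e) + (m3 + m3 + (m3 + m3))].
  by exists (b1 / 2), 0, ((b2 - b1) / 4), ((b3 - b1) / 4); split; lia.
have {q1 q2 q3}[f [n1 [n2 [n3 [-> -> ->]]]]] : exists e m1 m2 m3,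
  [/\ c1 = (e + e) + (m1 + m1 + (m1 + m1)),
   c2 = (e + e) + (m2 + m2 + (m2 + m2)) & c3 = (e + e) + (m3 + m3 + (m3 + m3))].
  by exists (c1 / 2), 0, ((c2 - c1) / 4), ((c3 - c1) / 4); split; lia.
case: l => [[[a1 s1] [a2 s2]] [a3 s3]]; rewrite /sel /shift_class /=.
by case: a1; case: a2; case: a3 => // _; case: s1; case: s2; case: s3 => /=; lia.
Qed.

Lemma wf_comp g h : wf g -> wf h -> wf (ccomp g h).
Proof.
move=> /andP[g1 g2] /andP[h1 h2]; have [p _ _] := lcompP g1 h1.
by apply/andP; split=> //; exact: in_lattice_app.
Qed.

Lemma cls_comp g h : wf g -> wf h -> cls (ccomp g h) = mulc (cls g) (cls h).
Proof.
move=> /andP[g1 g2] /andP[h1 h2]; have [_ p q] := lcompP g1 h1.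
by rewrite /cls /= p q shift_class_app.
Qed.

Lemma zapp_comp g h x : zapp (ccomp g h) x = zapp g (zapp h x).
Proof.
rewrite /zapp [(ccomp g h).1]/= lapp_comp; last exact: Z.opp_involutive.
case: g h => [l [[b1 b2] b3]] [m [[c1 c2] c3]]; case: (lapp _ m x) => [[y1 y2] y3] /=.
congr (_, _, _); rewrite /zapp /lapp /= /sel; [case: l.1.1|case: l.1.2|case: l.2] => -[] [] /=; lia.
Qed.

Lemma in_lattice_opp b : in_lattice (zadd b (0, 0, 0)) -> in_lattice (zopp b).
Proof.
case: b => [[b1 b2] b3] /and3P[/Z.eqb_eq h1 /Z.eqb_eq h2 /Z.eqb_eq h3].
by apply/and3P; split; apply/Z.eqb_eq; lia.
Qed.

Lemma wf_cinv g : wf g -> wf (cinv g).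
Proof.
move=> /andP[g1 g2]; have [p _ _] := linvP g1.
by apply/andP; split=> //; exact/in_lattice_opp/in_lattice_app.
Qed.

Definition code_id : code := (lin_id, (0, 0, 0)).

Lemma lapp_zopp l x : lapp Z.opp l (zopp x) = zopp (lapp Z.opp l x).
Proof.
case: l x => [[[a1 s1] [a2 s2]] [a3 s3]] [[x1 x2] x3]; rewrite /lapp /sel /=.
by case: a1 s1 a2 s2 a3 s3 => [] [] [] [] [] [].
Qed.

Lemma cinvK g : perm_axes g.1 -> ccomp g (cinv g) = code_id /\ ccomp (cinv g) g = code_id.
Proof.
move=> g1; have [_ p q] := linvP g1; rewrite /ccomp [(cinv g).1]/= p q /code_id.
have e x : lapp Z.opp g.1 (lapp Z.opp (linv g.1) x) = x.
  by rewrite -lapp_comp ?q //; [case: x => [[]] | exact: Z.opp_involutive].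
have z x : zadd (zopp x) x = (0, 0, 0).
  by case: x => [[x1 x2] x3] /=; congr (_, _, _); lia.
split; congr (_, _).
  have -> : zapp g (cinv g).2 = zadd (lapp Z.opp g.1 (zopp (lapp Z.opp (linv g.1) g.2))) g.2 by [].
  by rewrite lapp_zopp e z.
have -> : zapp (cinv g) g.2 = zadd (lapp Z.opp (linv g.1) g.2) (zopp (lapp Z.opp (linv g.1) g.2)).
  by [].
by case: (lapp Z.opp _ _) => [[x1 x2] x3] /=; congr (_, _, _); lia.
Qed.
End IntegerCodes.

Section RealCodes.
Variable R : realFieldType.
Local Open Scope ring_scope.
Local Notation V := (R * R * R)%type.
Implicit Types (x y p : V) (g h : code).

Lemma lapp_vadd l x y : lapp -%R l (vadd x y) = vadd (lapp -%R l x) (lapp -%R l y).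
Proof.
case: l x y => [[[a1 s1] [a2 s2]] [a3 s3]] [[x1 x2] x3] [[y1 y2] y3]; rewrite /lapp /sel /=.
by case: a1 s1 a2 s2 a3 s3 => [] [] [] [] [] []; rewrite ?opprD.
Qed.

Lemma lapp_zr3 l b : zr3 R (lapp Z.opp l b) = lapp -%R l (zr3 R b).
Proof. by rewrite /lapp /= !zr_sel. Qed.

Lemma vaddA : associative (@vadd R).
Proof. by move=> [[? ?] ?] [[? ?] ?] [[? ?] ?]; rewrite /= !addrA. Qed.

Lemma app_comp g h x : app (ccomp g h) x = app g (app h x).
Proof.
rewrite /app [(ccomp g h).1]/= lapp_comp; last exact: opprK.
by rewrite lapp_vadd -vaddA -lapp_zr3 -zr3_add.
Qed.

Lemma app_id x : app code_id x = x.
Proof. by case: x => [[x1 x2] x3]; rewrite /app /= !zr0 !addr0. Qed.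

Lemma app_cinv g x : perm_axes g.1 -> app g (app (cinv g) x) = x.
Proof. by move=> /cinvK[e _]; rewrite -app_comp e app_id. Qed.

Lemma app_cinv' g x : perm_axes g.1 -> app (cinv g) (app g x) = x.
Proof. by move=> /cinvK[_ e]; rewrite -app_comp e app_id. Qed.

Lemma dist2_app g x y : perm_axes g.1 -> dist2 (app g x) (app g y) = dist2 x y.
Proof.
case: g x y => [[[[a1 s1] [a2 s2]] [a3 s3]] [[b1 b2] b3]] [[x1 x2] x3] [[y1 y2] y3].
rewrite /app /lapp /sel /=; move: (zr R b1) (zr R b2) (zr R b3) => c1 c2 c3.
by case: a1; case: a2; case: a3 => // _; case: s1; case: s2; case: s3 => /=; ring.
Qed.

Lemma dist2_cinv g x y : perm_axes g.1 -> dist2 (app (cinv g) x) y = dist2 x (app g y).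
Proof. by move=> hg; rewrite -(dist2_app _ _ hg) app_cinv. Qed.

Lemma dist2_ge0 x y : 0 <= dist2 x y.
Proof. by case: x y => [[? ?] ?] [[? ?] ?]; rewrite !addr_ge0 ?sqr_ge0. Qed.

Lemma dist2_gt0 x y : x <> y -> 0 < dist2 x y.
Proof.
move=> xy; rewrite lt_def dist2_ge0 andbT; apply/eqP => e; apply: xy.
case: x y e => [[x1 x2] x3] [[y1 y2] y3] /= /eqP.
rewrite !paddr_eq0 ?addr_ge0 ?sqr_ge0 // !sqrf_eq0 !subr_eq0.
by case/andP=> /andP[/eqP-> /eqP->] /eqP->.
Qed.

Lemma dist2xx x : dist2 x x = 0.
Proof. by case: x => [[? ?] ?]; rewrite /= !subrr expr0n !addr0. Qed.

End RealCodes.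

(** * Passing to the limit in the centre *)

Section Eventually.
Variable R : realFieldType.
Local Open Scope ring_scope.
Local Notation V := (R * R * R)%type.
Implicit Types (x y p c : V) (g h s k : code).

Definition for_small (P : R -> Prop) := exists2 e, 0 < e & forall t, 0 < t -> t <= e -> P t.

Lemma for_small_and P Q : for_small P -> for_small Q -> for_small (fun t => P t /\ Q t).
Proof.
case=> e he hP [f hf hQ]; exists (Num.min e f); first by rewrite lt_min he hf.
by move=> t t0; rewrite le_min => /andP[te tf]; split; [exact: hP | exact: hQ].
Qed.

Lemma for_small_all (T : Type) (l : seq T) (P : T -> R -> Prop) :
  (forall a, List.In a l -> for_small (P a)) -> for_small (fun t => forall a, List.In a l -> P a t).
Proof.
elim: l => [|b l IH] hl; first by exists 1.
have [e he h] := for_small_and (hl b (or_introl erefl)) (IH (fun a ha => hl a (or_intror ha))).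
by exists e => // t t0 te a [<-|]; have [h1 h2] := h t t0 te; [exact: h1 | exact: h2].
Qed.

Lemma for_small_le1 : for_small (fun t => t <= 1).
Proof. by exists 1. Qed.

Definition towards c p t : V := vadd (vscale (1 - t) p) (vscale t c).

Lemma affine_towards f c p t : affine f -> f (towards c p t) = (1 - t) * f p + t * f c.
Proof.
case: c p => [[c1 c2] c3] [[p1 p2] p3] hf.
by rewrite /towards /= hf [f (p1, _, _)]hf [f (c1, _, _)]hf; ring.
Qed.

(** With [a = f p] and [b = f c], the bound on [t] gives [t (a + |b|) <= a / 2], so the value is at
    least [a / 2]. *)
Lemma for_small_gt0 f c p : affine f -> 0 < f p -> for_small (fun t => 0 < f (towards c p t)).
Proof.
move=> hf fp; set a := f p in fp; set b := f c.
have ab : 0 < 2 * (a + `|b|) by rewrite mulr_gt0 // ltr_wpDr.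
exists (a / (2 * (a + `|b|))); first by rewrite divr_gt0.
move=> t t0; rewrite ler_pdivlMr // => h; rewrite affine_towards // -/a -/b.
have h1 : - (t * `|b|) <= t * b by rewrite -mulrN ler_pM2l // lerNl -normrN ler_norm.
have : 0 <= t * `|b| by rewrite mulr_ge0 // ltW.
move: h; rewrite mulrCA mulrDr => h h2.
lra.
Qed.

Lemma affine_dist2B q r : affine (fun x => dist2 x q - dist2 x r).
Proof. by case: q r => [[q1 q2] q3] [[r1 r2] r3] x1 x2 x3 /=; ring. Qed.

Lemma affine_dist2_app x g h : perm_axes g.1 -> perm_axes h.1 ->
  affine (fun p => dist2 x (app g p) - dist2 x (app h p)).
Proof.
move=> hg hh; have := affineD (affine_Br x hg) (affineZ (-1) (affine_Br x hh)).
have e p : B g x p + -1 * B h x p = dist2 x (app g p) - dist2 x (app h p) by rewrite /B; ring.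
by move=> h0 a b c; have := h0 a b c; rewrite !e.
Qed.

Lemma minimizer (T : Type) (f : T -> R) a l :
  exists2 m, List.In m (a :: l) & forall b, List.In b (a :: l) -> f m <= f b.
Proof.
elim: l a => [|b l IH] a; first by exists a; [left | move=> b [->|[]]].
have [m hm h] := IH b; have [am|ma] := leP (f a) (f m).
  by exists a => [|c [->|hc]] //; [left | exact: le_trans am (h _ hc)].
by exists m => [|c [<-|/h]] //; [right | exact: ltW].
Qed.
End Eventually.

Definition member H g := wf g && mem_cls H (cls g).

(** The class of index 0 is the identity, so the last condition puts every left inverse of an
    element of [H] into [H]. *)
Definition closed_ok (H : subgroup) : bool :=
  mem_cls H (cls code_id) &&
  all (fun a => all (fun b => mem_cls H a ==> (mem_cls H b ==> mem_cls H (mulc a b)) &&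
    (mem_cls H a ==> (cindex (mulc b a) == 0) ==> mem_cls H b)) all_cosets) all_cosets.

Lemma closed_okT : all closed_ok subgroups.
Proof. by vm_compute. Qed.

Section Cosets.
Local Open Scope Z_scope.
Lemma cls_all_cosets g : List.In (cls g) all_cosets.
Proof.
case: g => [l [[b1 b2] b3]]; rewrite /cls /=.
move: (odd_axes l) (flips l) => e d.
have : (0 <= ((b1 + b2 + b3) / 2) mod 4 < 4) by lia.
set k := Z.modulo _ 4 => hk.
have [->|[->|[->|->]]] : k = 0 \/ k = 1 \/ k = 2 \/ k = 3 by lia.
all: by case: e; case: d; rewrite /all_cosets /=; tauto.
Qed.
End Cosets.

Section Limit.
Variable R : realFieldType.
Local Open Scope ring_scope.
Local Notation V := (R * R * R)%type.
Implicit Types (x y p c : V) (g h s k : code) (H : subgroup).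

Section Subgroup.
Variable H : subgroup.
Hypothesis hH : closed_ok H.

Lemma member_id : member H code_id.
Proof. by rewrite /member; case/andP: hH. Qed.

Lemma member_comp g h : member H g -> member H h -> member H (ccomp g h).
Proof.
move=> /andP[g1 g2] /andP[h1 h2]; rewrite /member wf_comp //= cls_comp //.
have /andP[_ hh] := hH.
by have := all_in (all_in hh (cls_all_cosets g)) (cls_all_cosets h); rewrite g2 h2 => /andP[].
Qed.

Lemma member_cinv g : member H g -> member H (cinv g).
Proof.
move=> /andP[g1 g2]; rewrite /member wf_cinv //=.
have /andP[_ hh] := hH.
have := all_in (all_in hh (cls_all_cosets g)) (cls_all_cosets (cinv g)).
rewrite g2 -(cls_comp (wf_cinv g1) g1); have [_ ->] := cinvK (proj1 (andP g1)).
by rewrite !implyTb => /andP[_].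
Qed.
End Subgroup.

Lemma member_perm H g : member H g -> perm_axes g.1.
Proof. by case/andP => /andP[]. Qed.

Variables (H : subgroup) (n : nat) (w : seq R) (S : seq code) (p0 : V).
Variable K : seq code.
Local Notation c := (point w (piece n)).
Hypothesis hH : closed_ok H.
Hypothesis hleaf : forall w' y, weights w' (piece n) ->
  (forall k, List.In k K -> 0 <= B k y (point w' (piece n))) ->
  forall g, member H g -> 0 <= B g y (point w' (piece n)).
Hypothesis hw : forall t, 0 < t -> t <= 1 ->
  exists2 w', weights w' (piece n) & point w' (piece n) = towards c p0 t.
Hypothesis hS : forall s, List.In s S -> member H s /\ app s p0 = p0.
Hypothesis S_id : List.In code_id S.
Hypothesis hK : forall k, List.In k K -> member H k.

(* For small [t], let [s] be an element of the stabilizer [S] of [p0] whose image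
   of the centre [towards c p0 t] is nearest to [x].  The hypotheses show that
   [s^-1 x] satisfies the inequalities of [K], so no image of the centre is nearer
   to [x]; then let [t] tend to 0. *)
Lemma limit_strict x :
  (forall s k, List.In s S -> List.In k K ->
    List.In (ccomp s k) S \/ dist2 x p0 < dist2 x (app (ccomp s k) p0)) ->
  forall g, member H g -> dist2 x p0 <= dist2 x (app g p0).
Proof.
move=> hyp g hg; rewrite leNgt; apply/negP => lt_g.
have Sperm s : List.In s S -> perm_axes s.1 by move=> /hS[/member_perm].
have ev1 : for_small (fun t => forall s, List.In s S ->
    dist2 x (app g (towards c p0 t)) < dist2 x (app s (towards c p0 t))).
  apply: for_small_all => s hs.
  have [||e e0 he] := @for_small_gt0 _ (fun p => dist2 x (app s p) - dist2 x (app g p)) c p0.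
  - exact: affine_dist2_app (Sperm _ hs) (member_perm hg).
  - by cbv beta; rewrite subr_gt0 (proj2 (hS hs)).
  - by exists e => // t t0 te; rewrite -subr_gt0; exact: he.
have ev2 : for_small (fun t => forall s, List.In s S -> forall k, List.In k K ->
    List.In (ccomp s k) S \/
    dist2 x (app s (towards c p0 t)) < dist2 x (app (ccomp s k) (towards c p0 t))).
  apply: for_small_all => s hs; apply: for_small_all => k hk.
  have [h|h] := hyp s k hs hk; first by exists 1 => //; left.
  have hsk : perm_axes (ccomp s k).1.
    by apply: member_perm (member_comp hH (hS hs).1 (hK hk)).
  have [||e e0 he] := @for_small_gt0 _ (fun p => dist2 x (app (ccomp s k) p) - dist2 x (app s p)) c p0.
  - exact: affine_dist2_app hsk (Sperm _ hs).
  - by cbv beta; rewrite subr_gt0 (proj2 (hS hs)).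
  - by exists e => // t t0 te; right; rewrite -subr_gt0; exact: he.
have [t t0 /(_ t t0 (lexx t))] := for_small_and (for_small_le1 R) (for_small_and ev1 ev2).
move=> [t1 [{ev1} far {ev2} near]]; have [w' hw' e] := hw t0 t1; rewrite -e in far near.
set p := point w' (piece n) in far near.
have [s hs smin] : exists2 s, List.In s S & forall s', List.In s' S ->
    dist2 x (app s p) <= dist2 x (app s' p).
  case ES : S S_id => [//|s0 l] _.
  by have [m hm hmin] := minimizer (fun s => dist2 x (app s p)) s0 l; exists m.
have hsm := (hS hs).1; have hsp := Sperm _ hs.
have Bs k : B k (app (cinv s) x) p = dist2 x (app s (app k p)) - dist2 x (app s p).
  by rewrite /B !dist2_cinv.
have hg' := member_comp hH (member_cinv hH hsm) hg.
have : 0 <= B (ccomp (cinv s) g) (app (cinv s) x) p.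
  refine (hleaf hw' _ hg') => k hk; rewrite Bs subr_ge0 -app_comp.
  by case: (near s hs k hk) => [/smin|/ltW].
by rewrite Bs app_comp app_cinv // subr_ge0 leNgt far.
Qed.

(* Moving [x] towards [p0] makes all the inequalities strict. *)
Lemma limit_le x :
  (forall s k, List.In s S -> List.In k K -> List.In (ccomp s k) S \/
    p0 <> app (ccomp s k) p0 /\ dist2 x p0 <= dist2 x (app (ccomp s k) p0)) ->
  forall g, member H g -> dist2 x p0 <= dist2 x (app g p0).
Proof.
move=> hyp g hg; rewrite leNgt; apply/negP => lt_g.
pose f q y := dist2 y q - dist2 y p0; have af q : affine (f q) by exact: affine_dist2B.
have f0 q : f q p0 = dist2 p0 q by rewrite /f dist2xx subr0.
have [||t t0 /(_ t t0 (lexx t)) [t1]] := for_small_and (for_small_le1 R)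
    (@for_small_gt0 _ (fun y => (-1) * f (app g p0) y) p0 x _ _).
- exact: affineZ.
- by rewrite mulN1r oppr_gt0 subr_lt0.
rewrite mulN1r oppr_gt0 ltNge subr_ge0 => /negP; apply.
apply: limit_strict hg => s k hs hk; have [h|[ne le]] := hyp s k hs hk; first by left.
right; rewrite -subr_gt0 -/(f _ _) affine_towards // f0.
by rewrite ltr_wpDl ?mulr_gt0 ?dist2_gt0 // mulr_ge0 ?subr_ge0.
Qed.
End Limit.

(** * Centres on the faces of the pieces *)

Section Tuples.
Lemma eqzsP s t : reflect (s = t) (eqzs s t).
Proof.
apply: (iffP idP) => [|<-]; last by elim: s => //= x s ->; rewrite andbT; apply/zeqvP.
by elim: s t => [|x s IH] [|y t] //= /andP[/zeqvP-> /IH->].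
Qed.

Lemma in_add_new a s l : List.In a (add_new s l) <-> a = s \/ List.In a l.
Proof.
rewrite /add_new; case: ifP => [/has_in[b hb /eqzsP sb]|_] /=; last by split=> -[]; auto.
by split; [right | case=> // ->; rewrite sb].
Qed.

Lemma in_images st K vs q : List.In q (images st K vs) <->
  exists s k, [/\ List.In s st, List.In k K, q = [seq zapp s v | v <- [seq zapp k v | v <- vs]] & q <> vs].
Proof.
rewrite /images; elim: K => [|k K IH]; first by split=> // -[? [? []]].
rewrite /=; move: (foldr _ [::] K) IH => l IHK; set kvs := [seq _ | v <- vs].
have E : List.In q (foldr (fun s l => if eqzs [seq zapp s v | v <- kvs] vs then l
      else add_new [seq zapp s v | v <- kvs] l) l st) <->
    List.In q l \/ exists s, [/\ List.In s st, q = [seq zapp s v | v <- kvs] & q <> vs].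
  elim: st {IHK} => [|s st IH] /=; first by split; [left | case=> // -[? []]].
  have step : List.In q (if eqzs [seq zapp s v | v <- kvs] vs then
        foldr (fun s l => if eqzs [seq zapp s v | v <- kvs] vs then l
          else add_new [seq zapp s v | v <- kvs] l) l st
      else add_new [seq zapp s v | v <- kvs]
        (foldr (fun s l => if eqzs [seq zapp s v | v <- kvs] vs then l
          else add_new [seq zapp s v | v <- kvs] l) l st)) <->
      (q = [seq zapp s v | v <- kvs] /\ q <> vs) \/ (List.In q l \/
        exists s, [/\ List.In s st, q = [seq zapp s v | v <- kvs] & q <> vs]).
    case: eqzsP => [e|ne]; rewrite ?in_add_new IH; first by split; [right | case=> // -[->]].
    by split=> [[->|]|[[-> _]|]]; auto.
  rewrite step; split=> [[[-> ne]|[|[s' [h1 h2 h3]]]]|[|[s' [[<-|h1] h2 h3]]]]; auto.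
  - by right; exists s; split; auto.
  - by right; exists s'; split; auto.
  - by right; right; exists s'.
rewrite E IHK; split=> [[[s [k' [h1 h2 h3 h4]]]|[s [h1 h2 h3]]]|[s [k' [h1 [<-|h2] h3 h4]]]].
- by exists s, k'; split; auto.
- by exists s, k; split; auto.
- by right; exists s.
- by left; exists s, k'.
Qed.

Lemma map_eq_id (T : Type) (f : T -> T) s : [seq f x | x <- s] = s ->
  forall x, List.In x s -> f x = x.
Proof. by elim: s => //= y s IH [e1 e2] x [<-|/(IH e2)]. Qed.

Lemma map_id_of_in (T : Type) (f : T -> T) s : (forall x, List.In x s -> f x = x) ->
  [seq f x | x <- s] = s.
Proof. by elim: s => //= y s IH h; rewrite h ?IH //; auto. Qed.

Lemma all_lins_perm : all perm_axes all_lins.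
Proof. by vm_compute. Qed.

Lemma all_of_in (T : Type) (P : pred T) s : (forall x, List.In x s -> P x) -> all P s.
Proof. by elim: s => //= x s IH h; rewrite h ?IH //; auto. Qed.

Lemma fixing_eq s v : zapp s v = v -> fixing s.1 v = s.
Proof.
rewrite /fixing /zapp; case: s => l b; rewrite [(l, b).1]/= [(l, b).2]/=.
move: (lapp Z.opp l v) => y e; congr (_, _); rewrite -e.
by case: y b {e} => [[y1 y2] y3] [[b1 b2] b3] /=; congr (_, _, _); lia.
Qed.

Lemma stabilizerP H vs s : vs <> [::] -> List.In s (stabilizer H vs) <->
  member H s /\ [seq zapp s v | v <- vs] = vs.
Proof.
case: vs => // v vs _; rewrite /stabilizer in_filter in_map.
split=> [[[l hl e] /and3P[h1 h2 h3]]|[/andP[/andP[hl hb] hc] e]].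
  split; first by rewrite /member /wf h1 h2 e (all_in all_lins_perm hl).
  by apply: map_id_of_in => u hu; apply/zeqvP; exact: (all_in h3).
have fix_s := map_eq_id e; split; last first.
  by rewrite hb hc; apply: all_of_in => u hu; apply/zeqvP; exact: fix_s.
by exists s.1; [exact: all_linsP | rewrite fixing_eq //; apply: fix_s; left].
Qed.
End Tuples.

Section Faces.
Variable R : realFieldType.
Local Open Scope ring_scope.
Local Notation V := (R * R * R)%type.
Local Notation zr3 := (zr3 R).
Local Notation zr := (zr R).
Implicit Types (x y p c : V) (g h s k : code) (u w : seq R) (H : subgroup).

Definition rcoord (i : axis) x : R := sel -%R (i, false) x.

Lemma affine_rcoord i : affine (rcoord i).
Proof. by case: i => x1 x2 x3; rewrite /rcoord /sel /=; ring. Qed.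

Lemma rcoord_inj x y : (forall i, rcoord i x = rcoord i y) -> x = y.
Proof.
case: x y => [[x1 x2] x3] [[y1 y2] y3] e.
by have := (e X1, e X2, e X3); rewrite /rcoord /= => -[[-> ->] ->].
Qed.

Lemma affine_rcoord_app i g : affine (fun x => rcoord i (app g x)).
Proof.
case: g => [[[[a1 s1] [a2 s2]] [a3 s3]] [[b1 b2] b3]] x1 x2 x3.
rewrite /app /lapp /rcoord /sel /=; move: (zr b1) (zr b2) (zr b3) => c1 c2 c3.
by case: i; [case: a1; case: s1|case: a2; case: s2|case: a3; case: s3] => /=; ring.
Qed.

Lemma zip_map_r (A B C : Type) (f : B -> C) (s : seq A) t :
  zip s [seq f b | b <- t] = [seq (ab.1, f ab.2) | ab <- zip s t].
Proof. by elim: s t => [|a s IH] [|b t] //=; rewrite IH. Qed.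

Lemma app_bary g u t : size u = size t -> \sum_(a <- u) a = 1 ->
  app g (bary u t) = bary u [seq app g x | x <- t].
Proof.
move=> hs h1; apply: rcoord_inj => i.
rewrite (affine_bary (affine_rcoord_app i g)) // (affine_bary (affine_rcoord i)) ?size_map //.
by rewrite zip_map_r big_map.
Qed.

Lemma app_point g u t : size u = size t -> \sum_(a <- u) a = 1 ->
  app g (point u t) = point u [seq zapp g v | v <- t].
Proof.
move=> hs h1; rewrite /point app_bary ?size_map // -!map_comp; congr (bary _ _).
by apply: eq_map => v /=; rewrite zr3_app.
Qed.

Lemma sum_zip_ge0 u (d : seq Z) : (forall a, a \in u -> 0 < a) -> all (Z.leb 0) d ->
  0 <= \sum_(t <- zip u d) t.1 * zr t.2.
Proof.
elim: u d => [|a u IH] [|z d] u0 /=; rewrite ?big_nil // => /andP[hz hd].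
rewrite big_cons; apply: addr_ge0 => /=.
  by rewrite mulr_ge0 ?zr_ge0 // ltW // u0 // inE eqxx.
by apply: IH => // b hb; rewrite u0 // inE hb orbT.
Qed.

Lemma sum_zip_gt0 u (d : seq Z) : size u = size d -> (forall a, a \in u -> 0 < a) ->
  all (Z.leb 0) d -> has (Z.ltb 0) d -> 0 < \sum_(t <- zip u d) t.1 * zr t.2.
Proof.
elim: u d => [|a u IH] [|z d] //= [hs] u0 /andP[hz hd].
have a0 : 0 < a by rewrite u0 // inE eqxx.
have u0' b : b \in u -> 0 < b by move=> hb; rewrite u0 // inE hb orbT.
rewrite big_cons /=; case/orP=> h.
  by rewrite ltr_pwDl ?sum_zip_ge0 // mulr_gt0 ?zr_gt0.
by rewrite ltr_wpDl ?IH // mulr_ge0 ?zr_ge0 // ltW.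
Qed.

(** Different tuples could still represent the same point for particular weights; a coordinate in
    which all vertices move weakly to one side, and one of them strictly, rules this out for all
    positive weights. *)
Lemma moves_neq u (vs q : seq zvec) : size u = size vs -> size q = size vs ->
  \sum_(a <- u) a = 1 -> (forall a, a \in u -> 0 < a) -> moves vs q ->
  point u q <> point u vs.
Proof.
move=> hu hq h1 u0 /has_in[i _ /has_in[z _ /andP[hz1 hz2]]] e.
have : zr z * (rcoord i (point u q) - rcoord i (point u vs)) = 0 by rewrite e subrr mulr0.
rewrite !(affine_point (affine_rcoord i)) ?hq //.
set d := map _ _ in hz1 hz2; have hd : size u = size d.
  by rewrite size_map size_zip hq minnn.
have : 0 < \sum_(t <- zip u d) t.1 * zr t.2 by exact: sum_zip_gt0.
suff -> : \sum_(t <- zip u d) t.1 * zr t.2 = zr z *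
    (\sum_(wt <- zip u q) wt.1 * rcoord i (zr3 wt.2) - \sum_(wt <- zip u vs) wt.1 * rcoord i (zr3 wt.2)).
  by move=> /gt_eqF/eqP.
rewrite /d; elim: u vs q hu hq {h1 u0 e d hz1 hz2 hd} => [|a u IH] [|v vs] [|r q] //=.
  by rewrite !big_nil subrr mulr0.
move=> [hu] [hq]; rewrite !big_cons /= IH // zrM zrB /zcoord !zr_sel /rcoord; ring.
Qed.
End Faces.

Section Core.
Variable R : realFieldType.
Local Open Scope ring_scope.
Local Notation V := (R * R * R)%type.
Local Notation zr3 := (zr3 R).
Local Notation zr := (zr R).
Local Notation simpz := (simpz R).
Implicit Types (x y p c : V) (g h s k : code) (u w : seq R) (H : subgroup).

Definition positive w : bitseq := [seq 0 < a | a <- w].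

Lemma mask_positive w a : a \in mask (positive w) w -> 0 < a.
Proof.
elim: w => //= b w IH; case: ifP => b0; last exact: IH.
by rewrite inE => /orP[/eqP->|].
Qed.

Lemma sum_positive w : (forall a, a \in w -> 0 <= a) ->
  \sum_(a <- mask (positive w) w) a = \sum_(a <- w) a.
Proof.
elim: w => //= b w IH w0; rewrite big_cons -IH; last by move=> a ha; rewrite w0 // inE ha orbT.
case: ifP => [_|/negbT]; first by rewrite big_cons.
have : 0 <= b by rewrite w0 // inE eqxx.
by rewrite -leNgt => h1 h2; have -> : b = 0; [apply/eqP; rewrite eq_le h1 h2|rewrite add0r].
Qed.

Lemma point_positive w (t : seq zvec) : size w = size t -> (forall a, a \in w -> 0 <= a) ->
  point (mask (positive w) w) (mask (positive w) t) = point w t.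
Proof.
rewrite /point; elim: w t => [|b w IH] [|v t] //= [hs] w0.
rewrite /bary /= -!/(bary _ _) -IH //; last by move=> a ha; rewrite w0 // inE ha orbT.
case: ifP => [_|/negbT] //; have : 0 <= b by rewrite w0 // inE eqxx.
rewrite -leNgt => h1 h2; have -> : b = 0; first by apply/eqP; rewrite eq_le h1 h2.
by case: (bary _ _) (zr3 v) => [[? ?] ?] [[? ?] ?]; rewrite /= !mul0r !add0r.
Qed.

Definition pattern w : seq nat := mask (positive w) (iota 0 (size w)).

Lemma vertices_pattern n w : size w = size (piece n) ->
  vertices n (pattern w) = mask (positive w) (piece n).
Proof.
move=> hs; rewrite /vertices /pattern map_mask; congr (mask _ _).
by rewrite hs map_nth_iota0 // take_size.
Qed.

Lemma size_mask_positive w (t : seq zvec) : size w = size t ->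
  size (mask (positive w) w) = size (mask (positive w) t).
Proof. by move=> hs; rewrite !size_mask ?size_map. Qed.

Definition barycenter (n : nat) : seq R := if n == 3%N then [:: 3^-1; 3^-1; 3^-1]
  else [:: 4^-1; 4^-1; 4^-1; 4^-1].

Lemma weights3 (a b c : R) (t : seq zvec) : size t = 3 -> a + b + c = 1 ->
  0 < a -> 0 < b -> 0 < c -> weights [:: a; b; c] t.
Proof.
move=> hs h1 ha hb hc; split; rewrite ?hs //.
- by rewrite !big_cons big_nil addr0 -h1 !addrA.
- case=> [|[|[|i]]] /=; rewrite ?(ltW ha) ?(ltW hb) ?(ltW hc) //.
  by rewrite nth_nil.
- by case=> [|[|[|i]]].
Qed.

Definition leaf_weights n w := [/\ size w = size (piece n), \sum_(a <- w) a = 1 &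
  forall a, a \in w -> 0 <= a].

(** Any positive share of the barycentre makes all weights positive, so the segment from the given
    point enters the relative interior of the piece at once. *)
Lemma towards_weights n w t : n \in [:: 1; 2; 3]%N -> leaf_weights n w -> 0 < t -> t <= 1 ->
  exists2 w', weights w' (piece n) &
    point w' (piece n) = towards (point (barycenter n) (piece n)) (point w (piece n)) t.
Proof.
move=> hn [hs h1 w0] t0 t1.
have pos a : a \in w -> forall b, 0 < b -> 0 < (1 - t) * a + t * b.
  by move=> ha b hb; rewrite ltr_wpDl ?mulr_gt0 // mulr_ge0 ?subr_ge0 // w0.
have f3 : 0 < 3^-1 :> R by rewrite invr_gt0. have f4 : 0 < 4^-1 :> R by rewrite invr_gt0.
have e3 : 3 * 3^-1 = 1 :> R by lra. have e4 : 4 * 4^-1 = 1 :> R by lra.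
have [a [b [c [d [ew|ew]]]]] : exists a b c d : R, w = [:: a; b; c; d] \/ w = [:: a; b; c].
- move: hn hs; rewrite !inE => /or3P[] /eqP-> /=.
  + by move/seq4 => [a [b [c [d ->]]]]; exists a, b, c, d; left.
  + by move/seq4 => [a [b [c [d ->]]]]; exists a, b, c, d; left.
  + by move/seq3 => [a [b [c ->]]]; exists a, b, c, 0; right.
- have hn' : n = 1%N \/ n = 2.
    by move: hn hs; rewrite ew !inE => /or3P[] /eqP->; auto.
  have ha := pos a; have hb := pos b; have hc := pos c; have hd := pos d.
  move: h1 ha hb hc hd; rewrite ew !inE !eqxx !orbT !big_cons big_nil => h1 ha hb hc hd.
  exists [:: (1 - t) * a + t * 4^-1; (1 - t) * b + t * 4^-1;
    (1 - t) * c + t * 4^-1; (1 - t) * d + t * 4^-1].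
    apply: weights4; rewrite ?ha ?hb ?hc ?ltW ?hd //.
      by case: hn' => ->.
    have -> : d = 1 - a - b - c by lra.
    by ring: e4.
  by case: hn' => ->; rewrite /point /bary /towards /barycenter /= !simpz; congr (_, _, _); ring.
have hn' : n = 3 by move: hn hs; rewrite ew !inE => /or3P[] /eqP->.
have ha := pos a; have hb := pos b; have hc := pos c.
move: h1 ha hb hc; rewrite ew !inE !eqxx !orbT !big_cons big_nil => h1 ha hb hc.
exists [:: (1 - t) * a + t * 3^-1; (1 - t) * b + t * 3^-1; (1 - t) * c + t * 3^-1].
  apply: weights3; rewrite ?ha ?hb ?hc ?hn' //.
  have -> : c = 1 - a - b by lra.
  by ring: e3.
by rewrite hn' /point /bary /towards /barycenter /= !simpz; congr (_, _, _); ring.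
Qed.

Definition tetra p : Prop := let: (x, y, z) := p in [/\ y <= x, z <= y, 0 <= z & x + z <= 2].

Lemma leaf_weights4 n (a b c d : R) : n \in [:: 1; 2]%N -> a + b + c + d = 1 ->
  0 <= a -> 0 <= b -> 0 <= c -> 0 <= d -> leaf_weights n [:: a; b; c; d].
Proof.
rewrite !inE => hn h1 ha hb hc hd; split; first by case/orP: hn => /eqP->.
  by rewrite !big_cons big_nil addr0 -h1 !addrA.
by move=> e; rewrite !inE => /or4P[] /eqP->.
Qed.

(** The exceptions are the vertex [v0] and the open edges [v0 v1] and [v0 v3], which [faces] does
    not list for piece 1. *)
Lemma leaf1_face (a b c d : R) : a + b + c + d = 1 -> 0 <= a -> 0 <= b -> 0 <= c -> 0 <= d ->
  List.In (1%N, pattern [:: a; b; c; d]) faces \/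
  0 < a /\ ((c = 0 /\ d = 0) \/ [/\ 0 < c, b = 0 & d = 0]).
Proof.
rewrite /pattern /positive /= => h1 ha hb hc hd.
have [a0|a0] := ltrP 0 a; have [b0|b0] := ltrP 0 b; have [c0|c0] := ltrP 0 c;
  have [d0|d0] := ltrP 0 d; rewrite /=; try (by left; rewrite /faces /=; tauto);
  try by (exfalso; lra).
- by right; split=> //; left; split; lra.
- by right; split=> //; right; split=> //; lra.
- by right; split=> //; left; split; lra.
Qed.

Lemma leaf2_face (a b c d : R) : a + b + c + d = 1 -> 0 <= a -> 0 <= b -> 0 <= c -> 0 <= d ->
  0 < b \/ 0 < c \/ 0 < d -> List.In (2, pattern [:: a; b; c; d]) faces.
Proof.
rewrite /pattern /positive /= => h1 ha hb hc hd.
have [a0|a0] := ltrP 0 a; have [b0|b0] := ltrP 0 b; have [c0|c0] := ltrP 0 c;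
  have [d0|d0] := ltrP 0 d; rewrite /=; try (by move=> _; rewrite /faces /=; tauto).
all: by case=> [?|[?|?]]; exfalso; lra.
Qed.

Lemma leaf3_face (a b : R) : 0 < a -> 0 <= b -> List.In (3, pattern [:: a; b; 0]) faces.
Proof.
rewrite /pattern /positive /= ltxx => -> hb.
by case: ltrP => _; rewrite /faces /=; tauto.
Qed.

(** The sign of [(x - y) - (y - z)] tells on which side of the plane through [v0], [v3] and [vm] the
    point lies. Of the three exceptional faces of piece 1, the vertex [v0] and the open edge [v0 v1]
    go to piece 3, the open edge [v0 v3] to piece 2. *)
Lemma tetra_cover p : tetra p -> exists n w,
  [/\ n \in [:: 1; 2; 3]%N, leaf_weights n w, point w (piece n) = p & List.In (n, pattern w) faces].
Proof.
case: p => [[x y] z] [yx zy z0 xz].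
have [le|lt] := leP (y - z) (x - y); last first.
  have h1 : (2 - x - z) / 2 + (x - y) + z + ((y - z) / 2 - (x - y) / 2) = 1 by lra.
  exists 2, [:: (2 - x - z) / 2; x - y; z; (y - z) / 2 - (x - y) / 2]; split=> //.
  - by apply: leaf_weights4 => //; lra.
  - by rewrite /point /bary /= !simpz; congr (_, _, _); lra.
  - by apply: leaf2_face; lra || (right; right; lra).
have h1 : (2 - x - z) / 2 + ((x - y) / 2 - (y - z) / 2) + z + (y - z) = 1 by lra.
have [|||||[a0 [[c0 d0]|[c0 b0 d0]]]] := leaf1_face h1; try lra.
- move=> hf; exists 1%N, [:: (2 - x - z) / 2; (x - y) / 2 - (y - z) / 2; z; y - z]; split=> //.
    by apply: leaf_weights4 => //; lra.
  by rewrite /point /bary /= !simpz; congr (_, _, _); lra.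
- exists 3, [:: (2 - x) / 2; x / 2; 0]; split=> //.
  + split=> //; first by rewrite !big_cons big_nil; lra.
    by move=> e; rewrite !inE => /or3P[] /eqP->; lra.
  + by rewrite /point /bary /= !simpz; congr (_, _, _); lra.
  + by apply: leaf3_face; lra.
- exists 2, [:: (2 - x - z) / 2; 0; z; 0]; split=> //.
  + by apply: leaf_weights4 => //; lra.
  + by rewrite /point /bary /= !simpz; congr (_, _, _); lra.
  + by apply: leaf2_face; lra || (right; left; lra).
Qed.

(** For a centre at the origin, [|x - y - z|^2 - |x|^2] is the sum of the corresponding differences
    for [y] and [z] plus twice the dot product of [y] and [z]. The argument is not circular, since
    both summands are short and short images are never discarded. *)
Lemma reduced_sound (vs : seq zvec) (Q : seq (seq zvec)) u x :
  size u = size vs -> \sum_(a <- u) a = 1 -> (forall q, List.In q Q -> size q = size vs) ->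
  (forall q, List.In q (reduced vs Q) -> dist2 x (point u vs) <= dist2 x (point u q)) ->
  forall q, List.In q Q -> dist2 x (point u vs) <= dist2 x (point u q).
Proof.
move=> hu h1 hQ; rewrite /reduced; case: eqzsP => // e hR q hq.
case hr : (Z.leb (znorm (head v0 q)) 16 || ~~ has (fun r => has (fun t =>
    Z.leb 0 (zdot (head v0 r) (head v0 t)) && zeqv (head v0 q) (zadd (head v0 r) (head v0 t)))
  [seq q <- Q | Z.leb (znorm (head v0 q)) 16]) [seq q <- Q | Z.leb (znorm (head v0 q)) 16]).
  by apply: hR; rewrite in_filter.
move/negbT: hr; rewrite negb_or negbK => /andP[_].
move=> /has_in[r /in_filter[hr sr] /has_in[t /in_filter[ht st] /andP[dot /zeqvP eq]]].
have hRr := hR r; have hRt := hR t; rewrite !in_filter sr st /= in hRr hRt.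
have {hRr} := hRr (conj hr isT); have {hRt} := hRt (conj ht isT).
have one (o : seq zvec) : List.In o Q -> point u o = zr3 (head v0 o).
  move/hQ; rewrite e; case: o => [|[[r1 r2] r3] []] // _.
  move: hu h1; rewrite e; case: (u) => [|a []] // _; rewrite big_cons big_nil addr0 => ->.
  by rewrite /point /bary /= !mul1r !addr0.
rewrite (one _ hr) (one _ ht) (one _ hq) eq; have -> : point u vs = (0, 0, 0).
  move: hu h1; rewrite e; case: (u) => [|a []] // _; rewrite big_cons big_nil addr0 => ->.
  by rewrite /point /bary /= zr0 mul1r addr0.
move: dot; case: (head v0 r) (head v0 t) (x) => [[y1 y2] y3] [[z1 z2] z3] [[x1 x2] x3].
move=> /zr_ge0-/(_ R); rewrite /zdot !zrD !zrM /= !zrD.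
move: (zr y1) (zr y2) (zr y3) (zr z1) (zr z2) (zr z3) => *; lra.
Qed.

Lemma codes_wf : all wf codes.
Proof. by vm_compute. Qed.

Lemma Kset_member H n k : List.In k (Kset decoded known_cosets H n) -> member H k.
Proof.
rewrite /Kset in_map => -[[c l] /in_filter[hd /andP[/= hc _]] ->]; rewrite /member hc andbT.
apply: (all_in codes_wf); rewrite /codes in_map; move: hd; rewrite /decoded in_map.
by case=> f hf [-> _]; exists f.
Qed.

Lemma leaf_index n : n \in [:: 1; 2; 3]%N -> (n < 4)%N /\ List.In n [:: 1%N; 2%N; 3%N].
Proof. by rewrite !inE => /or3P[] /eqP-> /=; auto. Qed.

Lemma subgroup_ok_face df kc H n phi : subgroup_ok df kc H -> List.In n [:: 1%N; 2%N; 3%N] ->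
  List.In (n, phi) faces -> let: K := Kset df kc H n in let: vs := vertices n phi in
  let: Q := images (stabilizer H vs) K vs in
  [/\ all (fun g => has (eqcode g) K) (required H), all (moves vs) Q & (size (reduced vs Q) <= 25)%N].
Proof.
rewrite /subgroup_ok => hl hn hf; have := all_in hl hn; rewrite /leaf_ok => /andP[hreq h].
by have := all_in h hf; rewrite eqxx orFb => /andP[].
Qed.

(** The list [K] is hidden behind an existential, so that the geometric argument uses only these
    properties and never the computed table. *)
Lemma leaf_data H n phi : H \in subgroups -> n \in [:: 1; 2; 3]%N -> List.In (n, phi) faces ->
  closed_ok H /\ exists K, let: vs := vertices n phi in let: Q := images (stabilizer H vs) K vs in
  [/\ forall k, List.In k K -> member H k,
      forall w y, weights w (piece n) -> (forall k, List.In k K -> 0 <= B k y (point w (piece n))) ->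
        forall g, member H g -> 0 <= B g y (point w (piece n)),
      all (moves vs) Q & (size (reduced vs Q) <= 25)%N].
Proof.
move=> hH hn hf; split; first exact: (allP closed_okT _ hH).
have [n4 n3] := leaf_index hn; have hl := subgroups_okT; cbv zeta in hl.
have [hreq hmv hsz] := subgroup_ok_face (allP hl _ hH) n3 hf; exists (Kset decoded known_cosets H n).
refine (And4 _ _ hmv hsz); first exact: Kset_member.
by move=> w y hw hK g /andP[g1 g2]; exact: (leaf_ge0 n4 hw hreq hK g1 g2).
Qed.

(** The weights of [p] that vanish are removed, so that [p] has positive weights [u] on the vertices
    [vs] of its face; then [limit_le] is applied along the segment from [p] to the barycentre of the
    piece. Every point of [Q] differs from [p], hence defines a genuine bisector. *)
Theorem core H p : H \in subgroups -> tetra p -> exists Q : seq V,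
  [/\ (size Q <= 25)%N,
      forall q, List.In q Q -> q <> p /\ exists2 g, member H g & q = app g p &
      forall x, (forall q, List.In q Q -> dist2 x p <= dist2 x q) ->
        forall g, member H g -> dist2 x p <= dist2 x (app g p)].
Proof.
move=> hH /tetra_cover[n [w [hn hw ew hface]]].
have [hcl [K [hK hleaf hmv hsz]]] := leaf_data hH hn hface; clear hH.
have [hs h1 w0] := hw.
set u := mask (positive w) w; set vs := vertices n (pattern w).
have evs : vs = mask (positive w) (piece n) by exact: vertices_pattern.
have hu : size u = size vs by rewrite evs; exact: size_mask_positive.
have u1 : \sum_(a <- u) a = 1 by rewrite sum_positive.
have u0 a : a \in u -> 0 < a by exact: mask_positive.
have ep : point u vs = p by rewrite evs point_positive.
have nvs : vs <> [::].
  by move=> e; move: hu u1; rewrite e => /size0nil->; rewrite big_nil => /eqP; rewrite eq_sym oner_eq0.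
pose S := stabilizer H vs; pose Q := images S K vs.
have hS s : List.In s S -> member H s /\ [seq zapp s v | v <- vs] = vs by move/(stabilizerP _ _ nvs).
have hQ q : List.In q Q -> size q = size vs /\
    exists s k, [/\ List.In s S, List.In k K & point u q = app (ccomp s k) p].
  move/in_images => [s [k [h2 h3 h4 _]]]; split; first by rewrite h4 !size_map.
  exists s, k; split=> //; rewrite h4 -ep !app_point // -map_comp; congr (point _ _).
  by apply: eq_map => v /=; rewrite zapp_comp.
have hsk s k : List.In s S -> List.In k K -> member H (ccomp s k).
  by move=> /hS[h2 _] /hK h3; exact: member_comp.
exists [seq point u q | q <- reduced vs Q]; split.
- by rewrite size_map.
- move=> q /in_map[r hr ->].
  have hr' : List.In r Q by move: hr; rewrite /reduced; case: ifP => // _ /in_filter[].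
  have [sr [s [k [h2 h3 er]]]] := hQ r hr'; split; last by exists (ccomp s k) => //; exact: hsk.
  by have := moves_neq hu sr u1 u0 (all_in hmv hr'); rewrite ep.
move=> x hx.
have hx' q : List.In q Q -> dist2 x p <= dist2 x (point u q).
  rewrite -ep; apply: reduced_sound => // [r /hQ[]//|r hr].
  by rewrite ep; apply: hx; rewrite in_map; exists r.
apply: (@limit_le R H n (barycenter n) S p K hcl hleaf _ _ _ hK).
- by move=> t t0 t1; rewrite -ew; exact: towards_weights.
- by move=> s /hS[h2 h3]; split; rewrite // -ep app_point // h3.
- apply/(stabilizerP _ _ nvs); rewrite member_id //; split=> //.
  by apply: map_id_of_in => -[[v1' v2'] v3'] _; rewrite /zapp /=; congr (_, _, _); lia.
move=> s k hs' hk; have [e|ne] := eqzsP [seq zapp s v | v <- [seq zapp k v | v <- vs]] vs.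
  left; apply/(stabilizerP _ _ nvs); rewrite hsk //; split=> //.
  by rewrite -[RHS]e -map_comp; apply: eq_map => v; rewrite zapp_comp.
right; set q := map _ _ in ne.
have hq : List.In q Q by apply/in_images; exists s, k.
have eq : app (ccomp s k) p = point u q.
  rewrite /q -ep app_point // -map_comp; congr (point _ _).
  by apply: eq_map => v /=; rewrite zapp_comp.
rewrite eq; split; last exact: hx'.
by move=> e; apply: (moves_neq hu (hQ _ hq).1 u1 u0 (all_in hmv hq)); rewrite ep.
Qed.
End Core.

(** * Enumeration of the subgroups of the quotient *)

Section CosetCases.
Local Open Scope Z_scope.
Lemma coset_cases e d : forall k, (0 <=? k) && (k <? 4) -> List.In (e, d, k) all_cosets.
Proof.
move=> k /andP[/Z.leb_le h1 /Z.ltb_lt h2].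
suff : (List.In k [:: 0; 1; 2; 3]); last by rewrite /=; lia.
by move=> /=[<-|[<-|[<-|[<-|[]]]]]; case: e; case: d; rewrite /all_cosets /=; tauto.
Qed.

End CosetCases.

Section SubgroupEnumeration.
Implicit Types (a b c : coset) (H : subgroup).
Local Notation coset1 := (false, false, Z0).

Lemma in_mulc a b : List.In (mulc a b) all_cosets.
Proof.
case: a b => [[e d] k] [[e' d'] k']; apply: coset_cases.
by case: ifP => _; lia.
Qed.

Lemma cindex_lt a : List.In a all_cosets -> (cindex a < 16)%N.
Proof. by apply: (@all_in _ (fun a => cindex a < 16)%N); vm_compute. Qed.

Lemma cosetK a : List.In a all_cosets -> nth coset1 all_cosets (cindex a) = a.
Proof.
have h : [seq nth coset1 all_cosets (cindex b) | b <- all_cosets] = all_cosets by vm_compute.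
exact: (map_eq_id h).
Qed.

Lemma cindexK i : (i < 16)%N -> cindex (nth coset1 all_cosets i) = i.
Proof. by do 16?[case: i => [//|i]]. Qed.

Lemma mem_cls_map (f : coset -> bool) a : List.In a all_cosets ->
  mem_cls [seq f b | b <- all_cosets] a = f a.
Proof. by move=> ha; rewrite /mem_cls (nth_map coset1) ?cindex_lt // cosetK. Qed.

Lemma subgroup_ext H H' : size H = 16 -> size H' = 16 ->
  (forall a, List.In a all_cosets -> mem_cls H a = mem_cls H' a) -> H = H'.
Proof.
move=> hs hs' e; apply: (@eq_from_nth _ false); rewrite hs // => i hi.
by have := e _ (@in_nth _ coset1 all_cosets i hi); rewrite /mem_cls cindexK.
Qed.

Definition adjoin_step c H : subgroup :=
  let el := [seq a <- all_cosets | mem_cls H a] in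
  let pr := [seq mulc a b | a <- c :: el, b <- c :: el] in
  [seq mem_cls H a || has (fun b => cindex a == cindex b) pr | a <- all_cosets].

Lemma mulc1 a : List.In a all_cosets -> mulc a coset1 = a.
Proof.
have h : [seq mulc b coset1 | b <- all_cosets] = all_cosets by vm_compute.
exact: (map_eq_id h).
Qed.

Lemma has_of_in (T : Type) (P : pred T) s (x : T) : List.In x s -> P x -> has P s.
Proof. by elim: s => //= y s IH [->|/IH h] px; rewrite ?px ?h ?orbT. Qed.

Lemma mul1c a : List.In a all_cosets -> mulc coset1 a = a.
Proof.
have h : [seq mulc coset1 b | b <- all_cosets] = all_cosets by vm_compute.
exact: (map_eq_id h).
Qed.

Lemma in_allpairs (T W U : Type) (f : T -> W -> U) s t y :
  List.In y [seq f u v | u <- s, v <- t] <->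
  exists u v, [/\ List.In u s, List.In v t & y = f u v].
Proof.
elim: s => /= [|x s [IH1 IH2]]; first by split=> // -[? [? []]].
rewrite List.in_app_iff in_map; split.
  by case=> [[v hv ->]|/IH1[u [v [h1 h2 h3]]]]; [exists x, v | exists u, v]; split; auto.
case=> u [v [[<-|h1] h2 h3]]; [by left; exists v | by right; apply: IH2; exists u, v].
Qed.

Lemma adjoin_step_le c H a : List.In a all_cosets -> mem_cls H a -> mem_cls (adjoin_step c H) a.
Proof. by move=> ha h; rewrite mem_cls_map // h. Qed.

Lemma mem_adjoin_step c H : List.In c all_cosets -> mem_cls H coset1 ->
  mem_cls (adjoin_step c H) c.
Proof.
move=> hc h1; rewrite mem_cls_map //; apply/orP; right.
set el := [seq a <- _ | mem_cls H a].
have h : List.In (mulc c coset1) [seq mulc a b | a <- c :: el, b <- c :: el].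
  apply/in_allpairs; exists c, coset1; split=> //; first by left.
  by right; rewrite in_filter; split=> //; left.
by apply: has_of_in h _; rewrite mulc1.
Qed.

Definition mul_closed H := forall a b, List.In a all_cosets -> List.In b all_cosets ->
  mem_cls H a -> mem_cls H b -> mem_cls H (mulc a b).

Lemma adjoin_step_sub c H H' : mul_closed H' -> List.In c all_cosets ->
  (forall a, List.In a all_cosets -> mem_cls H a -> mem_cls H' a) -> mem_cls H' c ->
  forall a, List.In a all_cosets -> mem_cls (adjoin_step c H) a -> mem_cls H' a.
Proof.
move=> hcl hca sub hc a ha; rewrite mem_cls_map // => /orP[|/has_in[b]]; first exact: sub.
move=> /in_allpairs[x [y [hx hy ->]]] /eqP e; rewrite /mem_cls e.
have hel z : List.In z (c :: [seq a <- all_cosets | mem_cls H a]) ->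
    List.In z all_cosets /\ mem_cls H' z.
  by case=> [<-|/in_filter[h1 h2]] //; split=> //; exact: sub.
by have [x1 x2] := hel x hx; have [y1 y2] := hel y hy; exact: hcl.
Qed.

Lemma adjoinE H c : adjoin H c = adjoin_step c (adjoin_step c (adjoin_step c H)).
Proof. by []. Qed.

Lemma subgroups_from_cons c cs H : subgroups_from (c :: cs) H =
  if mem_cls H c then subgroups_from cs H
  else subgroups_from cs H ++ subgroups_from cs (adjoin H c).
Proof. by []. Qed.

(** Follow the branch that adjoins [c] exactly when [c] belongs to [H]. Along it the current set
    stays inside [H], and what it lacks of [H] is among the classes still to be treated. *)
Lemma subgroups_from_complete H : size H = 16 ->
  mul_closed H ->
  forall cs H0, (forall a, List.In a cs -> List.In a all_cosets) -> size H0 = 16 ->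
  mem_cls H0 coset1 -> (forall a, List.In a all_cosets -> mem_cls H0 a -> mem_cls H a) ->
  (forall a, List.In a all_cosets -> mem_cls H a -> List.In a cs \/ mem_cls H0 a) ->
  List.In H (subgroups_from cs H0).
Proof.
move=> hs hcl; elim=> [|c cs IH] H0 hcs hs0 h1 sub sup.
  left; apply: subgroup_ext => // a ha; apply/idP/idP; first exact: sub.
  by case/(sup a ha).
have hc : List.In c all_cosets by apply: hcs; left.
have hcs' a : List.In a cs -> List.In a all_cosets by move=> ha; apply: hcs; right.
rewrite subgroups_from_cons; case: ifP => c0.
  apply: IH => // a ha /(sup a ha)[[<-|]|]; auto.
rewrite List.in_app_iff; case cH : (mem_cls H c); [right | left]; last first.
  apply: IH => // a ha hm; have [[e|]|] := sup a ha hm; auto.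
  by rewrite -e cH in hm.
apply: IH => //.
- by rewrite adjoinE !adjoin_step_le //; left.
- by rewrite adjoinE; exact: adjoin_step_sub hcl hc (adjoin_step_sub hcl hc (adjoin_step_sub hcl hc sub cH) cH) cH.
move=> a ha hm; rewrite adjoinE.
have [[<-|]|h] := sup a ha hm; [right|by left|right]; last by rewrite !adjoin_step_le.
by do 2!apply: adjoin_step_le => //; exact: mem_adjoin_step.
Qed.

Lemma in_of_mem (T : eqType) (x : T) s : x \in s -> List.In x s.
Proof. by elim: s => //= y s IH; rewrite inE => /orP[/eqP->|/IH]; auto. Qed.

Lemma mem_of_in (T : eqType) (x : T) s : List.In x s -> x \in s.
Proof. by elim: s => //= y s IH [->|/IH h]; rewrite inE ?eqxx ?h ?orbT. Qed.

Lemma subgroups_complete H : size H = 16 -> mem_cls H coset1 ->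
  mul_closed H -> H \in subgroups.
Proof.
move=> hs h1 hcl; rewrite /subgroups.
suff h : List.In H (subgroups_from all_cosets trivial_subgroup).
  by rewrite mem_undup; exact: mem_of_in.
apply (subgroups_from_complete (H := H)); [exact: hs | exact: hcl | by [] | by [] | by [] | | by move=> a ha _; left].
move=> a ha h; suff -> : a = coset1 by [].
rewrite -(cosetK ha); move: h; rewrite /mem_cls.
by case: (cindex a) (cindex_lt ha) => // i hi; do 15?[case: i hi => [//|i] hi].
Qed.
End SubgroupEnumeration.

(** * Reduction of the centre to the fundamental tetrahedron *)

Section Reduction.
Variable R : archiRealFieldType.
Local Open Scope ring_scope.
Local Notation V := (R * R * R)%type.
Local Notation zr := (zr R).
Implicit Types (x y p : V) (g h : code).

Definition equivalent x y := exists2 g, wf g & y = app g x.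

Lemma equivalent_trans x y z : equivalent x y -> equivalent y z -> equivalent x z.
Proof.
by move=> [g hg ->] [h hh ->]; exists (ccomp h g); rewrite ?app_comp //; exact: wf_comp.
Qed.

Lemma center_coord (a : R) : exists z : Z, -2 <= a + zr (Z.mul 4 z) <= 2.
Proof.
exists (Z.opp (Z_of_int (Num.floor ((a + 2) / 4)))).
have /andP[h1 h2] := floor_itv ((a + 2) / 4).
rewrite zrM zrN zr4; have -> : zr (Z_of_int (Num.floor ((a + 2) / 4))) = (Num.floor ((a + 2) / 4))%:~R.
  by rewrite /zr Z_of_intK.
 move: h1 h2; rewrite rmorphD /=.
by move: (_%:~R) => m h1 h2; apply/andP; split; lra.
Qed.

Lemma equivalent_nonneg (a b c : R) : exists s1 s2 s3,
  app (lin1 s1 s2 s3, v0) (a, b, c) = (`|a|, `|b|, `|c|).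
Proof.
have sgn (d : R) : exists s : bool, (if s then - d else d) = `|d|.
  by have [d0|d0] := ltrP d 0; [exists true; rewrite ltr0_norm | exists false; rewrite ger0_norm].
have [s1 h1] := sgn a; have [s2 h2] := sgn b; have [s3 h3] := sgn c.
exists s1, s2, s3; rewrite /app /lapp /sel /= !zr0 !addr0.
by rewrite h1 h2 h3.
Qed.

Definition sorted3 x : Prop := let: (a, b, c) := x in [/\ b <= a, c <= b, 0 <= c & a <= 2].

Lemma equivalent_sorted (a b c : R) : 0 <= a <= 2 -> 0 <= b <= 2 -> 0 <= c <= 2 ->
  exists2 x, equivalent (a, b, c) x & sorted3 x.
Proof.
move=> /andP[a0 a2] /andP[b0 b2] /andP[c0 c2].
have perm l : perm_axes l -> equivalent (a, b, c) (lapp -%R l (a, b, c)).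
  move=> hl; exists (l, v0); first by rewrite /wf hl.
  by rewrite /app; case: (lapp -%R l _) => [[x1 x2] x3] /=; rewrite !zr0 !addr0.
have go r1 r2 r3 : perm_axes ((r1, false), (r2, false), (r3, false)) ->
    sorted3 (lapp -%R ((r1, false), (r2, false), (r3, false)) (a, b, c)) ->
    exists2 x, equivalent (a, b, c) x & sorted3 x.
  by move=> h1 h2; exists (lapp -%R ((r1, false), (r2, false), (r3, false)) (a, b, c)) => //; exact: perm.
have [ab|/ltW ba] := leP a b; have [bc|/ltW cb] := leP b c; have [ac|/ltW ca] := leP a c.
- by apply: (go X3 X2 X1).
- by apply: (go X3 X2 X1) => //; split=> //=; lra.
- by apply: (go X2 X3 X1).
- by apply: (go X2 X1 X3).
- by apply: (go X3 X1 X2).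
- by apply: (go X1 X3 X2).
- by apply: (go X1 X2 X3) => //; split=> //=; lra.
- by apply: (go X1 X2 X3).
Qed.

Lemma equivalent_tetra x : exists2 g, wf g & tetra (app g x).
Proof.
suff [y [g hg ->]] : exists2 y, equivalent x y & tetra y by exists g.
case: x => [[a b] c].
have [z1 /andP[a1 a2]] := center_coord a; have [z2 /andP[b1 b2]] := center_coord b.
have [z3 /andP[c1 c2]] := center_coord c.
have e1 : equivalent (a, b, c) (a + zr (Z.mul 4 z1), b + zr (Z.mul 4 z2), c + zr (Z.mul 4 z3)).
  exists (lin_id, (Z.mul 4 z1, Z.mul 4 z2, Z.mul 4 z3)); last by [].
  by rewrite /wf andTb; apply/and3P; split; apply/Z.eqb_eq; lia.
move: (a + _) (b + _) (c + _) a1 a2 b1 b2 c1 c2 e1 => a' b' c' a1 a2 b1 b2 c1 c2 e1.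
have [s1 [s2 [s3 e2]]] := equivalent_nonneg a' b' c'.
have {e1 e2} e2 : equivalent (a, b, c) (`|a'|, `|b'|, `|c'|).
  by apply: equivalent_trans e1 _; exists (lin1 s1 s2 s3, v0).
have [||| x e3 hx] := @equivalent_sorted `|a'| `|b'| `|c'|; rewrite ?normr_ge0 ?ler_norml //=.
1-3: by apply/andP.
have {e2 e3} e3 := equivalent_trans e2 e3; case: x e3 hx => [[x y] z] e3 [yx zy z0 x2].
have [xz|xz] := leP (x + z) 2; first by exists (x, y, z).
exists (2 - z, 2 - y, 2 - x); last by split; lra.
(* This is the half-turn about the line through [v3] and [vm], which folds the side [x + z > 2]
   back. *)
apply: equivalent_trans e3 _; exists (((X3, true), (X2, true), (X1, true)), zadd v3 v3) => //.
by rewrite /app /lapp /sel /= !zr2; congr (_, _, _); ring.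
Qed.
End Reduction.

(** * Facets of a polyhedron given by finitely many bisectors *)

Section Kernel.
Variable F : fieldType.
Local Open Scope ring_scope.

(** The left kernel of a matrix with three rows and rank at least 2 has dimension at most one, so it
    is spanned by [u]. *)
Lemma kernel_line m n (A : 'M[F]_(3, n)) (u : 'rV[F]_3) (N : 'M[F]_(m, 3)) :
  (2 <= \rank A)%N -> u != 0 -> u *m A = 0 -> N *m A = 0 -> exists D : 'cV[F]_m, N = D *m u.
Proof.
move=> rA u0 uA NA.
have uK : (u <= kermx A)%MS by apply/sub_kermxP.
have NK : (N <= kermx A)%MS by apply/sub_kermxP.
have ru : \rank u = 1%N by rewrite rank_rV u0.
have rK : (\rank (kermx A) <= 1)%N by rewrite mxrank_ker; lia.
have eK : (u == kermx A)%MS.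
  by rewrite -(mxrank_leqif_eq uK) ru eqn_leq rK -{1}ru mxrankS.
have /submxP[D ->] : (N <= u)%MS by rewrite (eqmxP eK).
by exists D.
Qed.
End Kernel.

Section Space.
Variable R : realType.
Local Open Scope classical_set_scope.
Local Open Scope card_scope.
Local Open Scope ring_scope.
Local Notation E := 'rV[R]_3.
Local Notation edist := (@Defs.edist R).
Implicit Types (p q x y z u v c : E).

Lemma dotC u v : dot u v = dot v u.
Proof. by apply: eq_bigr => i _; rewrite mulrC. Qed.
Lemma dotDl u v w : dot (u + v) w = dot u w + dot v w.
Proof. by rewrite -big_split; apply: eq_bigr => i _; rewrite mxE mulrDl. Qed.
Lemma dotZl a u v : dot (a *: u) v = a * dot u v.
Proof. by rewrite mulr_sumr; apply: eq_bigr => i _; rewrite mxE mulrA. Qed.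
Lemma dotDr u v w : dot u (v + w) = dot u v + dot u w.
Proof. by rewrite dotC dotDl !(dotC u). Qed.
Lemma dotZr a u v : dot u (a *: v) = a * dot u v.
Proof. by rewrite dotC dotZl dotC. Qed.
Lemma dotNl u v : dot (- u) v = - dot u v.
Proof. by rewrite -scaleN1r dotZl mulN1r. Qed.
Lemma dotNr u v : dot u (- v) = - dot u v.
Proof. by rewrite dotC dotNl dotC. Qed.
Lemma dot0l v : dot 0 v = 0.
Proof. by rewrite /dot big1 // => i _; rewrite mxE mul0r. Qed.
Definition dotE := (dotDl, dotDr, dotZl, dotZr, dotNl, dotNr).

Lemma dot_mul u v : u *m v^T = (dot u v)%:M.
Proof. by rewrite [LHS]mx11_scalar !mxE; congr _%:M; apply: eq_bigr => i _; rewrite mxE. Qed.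

Lemma dot_ge0 u : 0 <= dot u u.
Proof. by apply: sumr_ge0 => i _; rewrite -expr2 sqr_ge0. Qed.

Lemma dot_eq0 u : (dot u u == 0) = (u == 0).
Proof.
apply/eqP/eqP => [h|->]; last by rewrite /dot big1 // => i _; rewrite mxE mul0r.
apply/rowP => i; rewrite mxE; apply/eqP.
have : dot u u == 0 by rewrite h.
rewrite psumr_eq0; last by move=> j _; rewrite -expr2 sqr_ge0.
by move/allP/(_ i (mem_index_enum i)); rewrite /= -expr2 sqrf_eq0.
Qed.

Lemma dot_gt0 u : u != 0 -> 0 < dot u u.
Proof. by rewrite lt_def dot_ge0 andbT dot_eq0. Qed.

Lemma edist_le x y x' y' : (edist x y <= edist x' y') =
  (dot (x - y) (x - y) <= dot (x' - y') (x' - y')).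
Proof. by rewrite /Defs.edist ler_sqrt // dot_ge0. Qed.

Lemma edist_le_dot x p q : (edist x p <= edist x q) =
  (2 * dot (q - p) x <= dot q q - dot p p).
Proof.
rewrite edist_le !dotE (dotC q x) (dotC p x); apply/idP/idP => h; lra.
Qed.

Lemma for_small_gt0_line (r s : R) : 0 < r -> for_small (fun t => 0 < r + t * s).
Proof.
move=> r0; exists (r / (2 * (r + `|s|))).
  by rewrite divr_gt0 // mulr_gt0 // ltr_wpDr.
have d0 : 0 < 2 * (r + `|s|) by rewrite mulr_gt0 // ltr_wpDr.
move=> t t0; rewrite ler_pdivlMr // => h.
have h1 : - (t * `|s|) <= t * s by rewrite -mulrN ler_pM2l // lerNl -normrN ler_norm.
have h2 : 0 < t * r by rewrite mulr_gt0.
have h3 : 0 <= t * `|s| by rewrite mulr_ge0 // ltW.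
move: h; rewrite mulrCA mulrDr => h; lra.
Qed.

Section Facets.
Variables (p : E) (Q : seq E).
Hypothesis Qp : forall q, List.In q Q -> q != p.
Local Notation P := [set x | forall q, List.In q Q -> edist x p <= edist x q].

Lemma ball_in_P v : for_small (fun t => P (p + t *: v)).
Proof.
apply: for_small_all => q hq.
have [|e e0 he] := @for_small_gt0_line (dot (q - p) (q - p)) (- (2 * dot (q - p) v)).
  by rewrite dot_gt0 // subr_eq0 Qp.
exists e => // t t0 te; rewrite edist_le_dot; have := he t t0 te.
by rewrite !dotE (dotC p q) => h; lra.
Qed.

(** If no bisector passed through [m], then [m] could be moved a little in the direction [c] inside
    the polyhedron, increasing [dot c] beyond [b]. *)
Lemma tight_at_boundary m c b : (P `<=` [set x | dot c x <= b]) -> c != 0 -> P m -> dot c m = b ->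
  exists2 q, List.In q Q & 2 * dot (q - p) m = dot q q - dot p p.
Proof.
move=> sub c0 Pm cm; apply: contrapT => no.
have : for_small (fun t => P (m + t *: c)).
  apply: for_small_all => q hq.
  have [|e e0 he] := @for_small_gt0_line (dot q q - dot p p - 2 * dot (q - p) m) (- (2 * dot (q - p) c)).
    rewrite subr_gt0 lt_neqAle; have := Pm q hq; rewrite edist_le_dot => ->; rewrite andbT.
    by apply/eqP => e; apply: no; exists q.
  exists e => // t t0 te; rewrite edist_le_dot; have := he t t0 te.
  by rewrite !dotE => h; lra.
move=> [e e0 /(_ e e0 (lexx e))/sub] /=; rewrite !dotE cm gerDl pmulr_rle0 //.
by rewrite leNgt dot_gt0.
Qed.

(** Take a bisector through the centroid of three affinely independent points of [F]. Inequalities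
    whose mean is an equality are equalities, so it contains all three points; [c] and [q - p] are
    then orthogonal to the same two independent vectors, hence proportional. *)
Lemma facet_bisector F : facet P F -> exists2 q, List.In q Q &
  F = P `&` [set x | 2 * dot (q - p) x = dot q q - dot p p].
Proof.
move=> [[c [b [sub FE]]] [[x xF indep] no4]].
have xP i : P (x i) by have := xF i; rewrite FE => -[].
have xb i : dot c (x i) = b by have := xF i; rewrite FE => -[].
have c0 : c != 0.
  (* With [c = 0] the face would be the whole polyhedron, which contains [p] and three small
     displacements of it along the axes, against the dimension 2. *)
  apply/eqP => c0; have b0 : b = 0 by rewrite -(xb ord0) c0 dot0l.
  have : for_small (fun t => forall i, List.In i (enum 'I_3) -> P (p + t *: delta_mx 0 i)).
    by apply: for_small_all => i _; exact: ball_in_P.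
  move=> [e e0 /(_ e e0 (lexx e)) he].
  pose y (i : 'I_4) : E := if unlift ord0 i is Some j then p + e *: delta_mx 0 j else p.
  apply: (no4 y) => [i|].
    rewrite FE; split; last by rewrite /= c0 b0 dot0l.
    rewrite /y; case: unliftP => [j _|_]; first by apply: he; apply: in_of_mem; rewrite mem_enum.
    by move=> q hq; rewrite edist_le subrr dot0l dot_ge0.
  rewrite /affinely_independent; set D := \matrix_i _.
  have -> : D = e%:M.
    apply/matrixP => i j; rewrite [LHS]mxE /y unlift_none liftK addrC addKr !mxE eqxx /=.
    by rewrite eq_sym mulr_natr.
  by rewrite row_free_unit unitmxE det_scalar unitrX // unitfE gt_eqF.
pose i1 : 'I_3 := lift ord0 ord0; pose i2 : 'I_3 := ord_max.
have sum3 (V : zmodType) (G : 'I_3 -> V) : \sum_(i < 3) G i = G ord0 + G i1 + G i2.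
  by rewrite !big_ord_recl big_ord0 addr0 addrA; congr (_ + _ + G _); exact: val_inj.
pose m := 3^-1 *: (x ord0 + x i1 + x i2).
have dm v : dot v m = 3^-1 * (dot v (x ord0) + dot v (x i1) + dot v (x i2)).
  by rewrite /m !dotE.
have Pm : P m.
  move=> q hq; have := (xP ord0 q hq, xP i1 q hq, xP i2 q hq).
  by rewrite !edist_le_dot dm => -[[h1 h2] h3]; lra.
have cm : dot c m = b by rewrite dm !xb; lra.
have [q hq qm] := tight_at_boundary sub c0 Pm cm; exists q => //.
have qx i : 2 * dot (q - p) (x i) = dot q q - dot p p.
  have := (xP ord0 q hq, xP i1 q hq, xP i2 q hq); rewrite !edist_le_dot => -[[h1 h2] h3].
  move: qm; rewrite dm => qm.
  have [->|[->|->]] : i = ord0 \/ i = i1 \/ i = i2.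
    by case: i => [[|[|[|//]]] hi]; [left|right; left|right; right]; exact: val_inj.
  - lra.
  - lra.
  - lra.
set D := \matrix_(i < 2) (x (lift ord0 i) - x ord0).
have kD v : (forall i, dot v (x i) = dot v (x ord0)) -> v *m D^T = 0.
  move=> hv; apply/rowP => j; rewrite !mxE.
  rewrite (_ : \sum_k _ = dot v (x (lift ord0 j) - x ord0)).
    by rewrite !dotE hv subrr.
  by apply: eq_bigr => k _; rewrite !mxE.
have rD : \rank D^T = 2 by rewrite mxrank_tr; apply/eqP; exact: indep.
have [||||k ek] := @kernel_line _ 1 2 D^T c (q - p).
- by rewrite rD.
- exact: c0.
- by apply: kD => i; rewrite !xb.
- by apply: kD => i; have := qx i; have := qx ord0; lra.
have {}ek : q - p = k 0 0 *: c by rewrite ek [k]mx11_scalar mul_scalar_mx mxE eqxx mulr1n.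
have k0 : k 0 0 != 0.
  by apply: contraNneq (Qp hq) => k0; rewrite -subr_eq0 ek k0 scale0r.
have eb : dot q q - dot p p = 2 * k 0 0 * b by rewrite -(qx ord0) ek dotZl xb mulrA.
rewrite FE; congr (P `&` _); apply/seteqP; split=> y /=; rewrite eb ek dotZl mulrA.
  by move=> ->.
by apply: mulfI; rewrite mulf_neq0.
Qed.

Theorem facets_le n : (size Q <= n)%N -> [set F | facet P F] #<= `I_n.
Proof.
move=> hn; pose f i := P `&` [set x | 2 * dot (nth p Q i - p) x = dot (nth p Q i) (nth p Q i) - dot p p].
apply: (@card_le_trans _ _ _ (f @` `I_n)); last exact: card_image_le.
apply: subset_card_le => F /facet_bisector[q hq ->].
have [i hi e] := in_ex_nth p hq.
by exists i; [exact: leq_trans hi hn | rewrite /f e].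
Qed.
End Facets.
End Space.

(** * Codes as isometries of Euclidean space *)

Section Coordinates.
Variable R : realType.
Local Open Scope classical_set_scope.
Local Open Scope ring_scope.
Local Notation E := 'rV[R]_3.
Local Notation V := (R * R * R)%type.
Local Notation edist := (@Defs.edist R).
Local Notation zr := (zr R).
Local Notation zr3 := (zr3 R).
Implicit Types (x y z u v : E) (p q : V) (g h : code).

Definition i0 : 'I_3 := @Ordinal 3 0 isT.
Definition i1 : 'I_3 := @Ordinal 3 1 isT.
Definition i2 : 'I_3 := @Ordinal 3 2 isT.

Lemma ord3_cases (i : 'I_3) : i = i0 \/ i = i1 \/ i = i2.
Proof.
by case: i => [[|[|[|//]]] hi]; [left|right; left|right; right]; exact: val_inj.
Qed.

Lemma sum3 (W : nmodType) (F : 'I_3 -> W) : \sum_(i < 3) F i = F i0 + F i1 + F i2.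
Proof.
rewrite !big_ord_recl big_ord0 addr0 addrA.
by congr (F _ + F _ + F _); exact: val_inj.
Qed.

Definition tri x : V := (x 0 i0, x 0 i1, x 0 i2).
Definition row3 p : E := \row_j nth 0 [:: p.1.1; p.1.2; p.2] j.

Lemma triK : cancel tri row3.
Proof. by move=> x; apply/rowP => j; rewrite mxE; have [->|[->|->]] := ord3_cases j. Qed.

Lemma row3K : cancel row3 tri.
Proof. by move=> [[a b] c]; rewrite /tri !mxE. Qed.

Lemma tri_inj : injective tri. Proof. exact: can_inj triK. Qed.

Lemma dot_tri x y : dot (x - y) (x - y) = dist2 (tri x) (tri y).
Proof. by rewrite /dot sum3 !mxE -!expr2. Qed.

Lemma edist_tri x y : edist x y = Num.sqrt (dist2 (tri x) (tri y)).
Proof. by rewrite /Defs.edist dot_tri. Qed.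

Definition scaled x : V := vscale 4 (tri x).
Definition unscaled p : E := row3 (vscale 4^-1 p).

Lemma scaledK : cancel scaled unscaled.
Proof.
move=> x; rewrite /unscaled /scaled -[RHS]triK; congr row3; case: (tri x) => [[a b] c] /=.
by rewrite !mulrA !mulVf ?mul1r // pnatr_eq0.
Qed.

Lemma unscaledK : cancel unscaled scaled.
Proof.
move=> [[a b] c]; rewrite /unscaled /scaled row3K /=.
by rewrite !mulrA !divff ?mul1r // pnatr_eq0.
Qed.

Lemma edist_unscaled p q : edist (unscaled p) (unscaled q) = 4^-1 * Num.sqrt (dist2 p q).
Proof.
rewrite edist_tri /unscaled !row3K; case: p q => [[a b] c] [[d e] f] /=.
have -> : (4^-1 * a - 4^-1 * d) ^+ 2 + (4^-1 * b - 4^-1 * e) ^+ 2 + (4^-1 * c - 4^-1 * f) ^+ 2 =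
  4^-1 ^+ 2 * ((a - d) ^+ 2 + (b - e) ^+ 2 + (c - f) ^+ 2) by ring.
by rewrite sqrtrM ?sqr_ge0 // sqrtr_sqr ger0_norm // invr_ge0.
Qed.

Definition act g x : E := unscaled (app g (scaled x)).

Lemma act_comp g h x : act (ccomp g h) x = act g (act h x).
Proof. by rewrite /act unscaledK app_comp. Qed.

Lemma act_id : act code_id = idfun.
Proof. by apply: funext => x; rewrite /act app_id scaledK. Qed.

Lemma act_cinv g x : perm_axes g.1 -> act g (act (cinv g) x) = x.
Proof. by move=> /cinvK[e _]; rewrite -act_comp e act_id. Qed.

Lemma act_cinv' g x : perm_axes g.1 -> act (cinv g) (act g x) = x.
Proof. by move=> /cinvK[_ e]; rewrite -act_comp e act_id. Qed.

Lemma act_isometry g : perm_axes g.1 -> is_isometry (act g).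
Proof.
by move=> hg x y; rewrite /act edist_unscaled dist2_app // -edist_unscaled !scaledK.
Qed.

(* A distance-preserving map preserves dot products of displacements from the
   image of the origin, so the images of the basis vectors are orthonormal. *)
Lemma isometry_affine (f : E -> E) : is_isometry f -> exists (O : 'M[R]_3) v,
  [/\ O *m O^T = 1%:M, O^T *m O = 1%:M & forall x, f x = x *m O + v].
Proof.
move=> hf; have [L LE] : exists L : E -> E, forall x, L x = f x - f 0 by exists (fun x => f x - f 0).
have hd x y : dot (f x - f y) (f x - f y) = dot (x - y) (x - y).
  have := hf x y; rewrite /Defs.edist => /eqP.
  by rewrite eqr_sqrt ?dot_ge0 // => /eqP.
have Ldot x y : dot (L x) (L y) = dot x y.
  have h1 := hd x y; have h2 := hd x 0; have h3 := hd y 0.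
  have e : f x - f y = L x - L y by rewrite !LE opprB addrA subrK.
  move: h1 h2 h3; rewrite e -!LE !subr0 !dotE (dotC (L y)) (dotC y).
  by move=> h1 h2 h3; lra.
pose O : 'M[R]_3 := \matrix_i L (delta_mx 0 i).
have LO x : L x *m O^T = x.
  apply/rowP => j; rewrite mxE.
  rewrite (_ : \sum_k _ = dot (L x) (L (delta_mx 0 j))); last first.
    by apply: eq_bigr => k _; rewrite !mxE.
  rewrite Ldot /dot (bigD1 j) //= big1 ?addr0; last first.
    by move=> k kj; rewrite !mxE eqxx (negbTE kj) mulr0.
  by rewrite !mxE !eqxx mulr1.
have OO : O *m O^T = 1%:M.
  by apply/row_matrixP => i; rewrite row_mul rowK LO row1.
exists O, (f 0); split=> //; first exact: mulmx1C.
by move=> x; rewrite -{2}(LO x) -mulmxA (mulmx1C OO) mulmx1 LE subrK.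
Qed.

(** [M] shows that the elements are invertible isometries. The inverse lies in every group of the
    intersection because a two-sided inverse is unique as a map. *)
Lemma generated_group (S M : set (E -> E)) : isometry_group M -> S `<=` M ->
  isometry_group (generated S).
Proof.
move=> hM SM; split.
- move=> f /(_ M (conj hM SM)); by case: hM => h _ _ _; exact: h.
- by move=> N [[_ h _ _] _].
- by move=> f g hf hg N hN; have [[_ _ h _] _] := hN; apply: h; [exact: hf | exact: hg].
move=> f hf; have [_ _ _ hi] := hM; have [g Mg [fg gf]] := hi f (hf M (conj hM SM)).
exists g => // N hN; have [[_ _ _ hi'] _] := hN; have [g' Ng' [fg' gf']] := hi' f (hf N hN).
suff -> : g = g' by [].
by apply: funext => x; rewrite -{1}(gf' x) fg.
Qed.

Lemma generated_sub (S M : set (E -> E)) : isometry_group M -> S `<=` M -> generated S `<=` M.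
Proof. by move=> hM SM f /(_ M (conj hM SM)). Qed.

Lemma sub_generated (S : set (E -> E)) : S `<=` generated S.
Proof. by move=> f Sf M [_ SM]; exact: SM. Qed.
End Coordinates.

(** * Rotations of order three *)

Section Rotations.
Variable R : realType.
Local Open Scope classical_set_scope.
Local Open Scope ring_scope.
Local Notation E := 'rV[R]_3.
Local Notation V := (R * R * R)%type.
Local Notation diagonal := (@Defs.diagonal R).
Implicit Types (x y z u v : E) (A M : 'M[R]_3).

Lemma rank_le1 M : (\rank M <= 1)%N -> exists t : R, M *m M = t *: M.
Proof.
move: (mulmx_base M); move: (col_base M) (row_base M); case: (\rank M) => [|[|//]] C W <- _.
  by exists 0; rewrite (flatmx0 W) mulmx0 mul0mx scaler0.
exists ((W *m C) 0 0); rewrite -mulmxA (mulmxA W) [W *m C]mx11_scalar mul_scalar_mx.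
by rewrite -scalemxAr [in RHS]mxE eqxx mulr1n.
Qed.

(** If [M = A - 1] had rank at most one, then [M^2 = t M], and [A^3 = 1] would give
    [(t^2 + 3 t + 3) M = 0]; the quadratic has no real root. *)
Lemma fixed_rank A : A *m A *m A = 1%:M -> A != 1%:M -> (2 <= \rank (A - 1%:M)%R)%N.
Proof.
move=> A3 A1; rewrite ltnNge; apply/negP => /rank_le1[t].
move: (A - 1%:M) (esym (subrK 1%:M A)) => M AE MM.
have MMM : M *m M *m M = (t * t) *: M by rewrite MM -scalemxAl MM scalerA.
have : (t * t + 3 * t + 3) *: M = 0.
  have : M *m M *m M + M *m M *+ 3 + M *+ 3 = 0.
    have e : A *m A *m A = M *m M *m M + M *m M *+ 3 + M *+ 3 + 1%:M.
      rewrite AE !(mulmxDl, mulmxDr, mulmx1, mul1mx).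
      move: (M *m M *m M) (M *m M) => M3 M2.
      by apply/matrixP => i j; rewrite !mxE; ring.
    by move: e; rewrite A3 => /(canLR (addrK _)); rewrite subrr => ->.
  have m3 (B : 'M[R]_3) : B *+ 3 = 3 *: B by rewrite scaler_nat.
  by rewrite MMM MM !m3 scalerA -!scalerDl => <-; congr (_ *: _); ring.
move/eqP; rewrite scaler_eq0 => /orP[/eqP h|/eqP h]; last by rewrite AE h add0r eqxx in A1.
have : 0 <= (2 * t + 3) ^+ 2 by rewrite sqr_ge0.
lra.
Qed.

(* The rows of [1 + A + A^2] are fixed by [A], hence multiples of [u]. *)
Lemma order3_sum u A : u != 0 -> dot u u = 3 -> orthogonal_mx A -> u *m A = u ->
  A *m A *m A = 1%:M -> A != 1%:M -> 1%:M + A + A^T = u^T *m u.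
Proof.
move=> u0 uu AA uA A3 A1; have AT : A^T = A *m A.
  by rewrite -[RHS]mulmx1 -AA !mulmxA A3 mul1mx.
set N := _ + A^T; have NM : N *m (A - 1%:M) = 0.
  rewrite /N AT mulmxBr mulmx1 !mulmxDl mul1mx A3.
  by rewrite [_ + 1%:M]addrC addrA subrr.
have uT : u *m A^T = u by rewrite -{1}uA -mulmxA AA mulmx1.
have uN : u *m N = 3 *: u.
  by rewrite /N !mulmxDr mulmx1 uA uT scaler_nat !mulrS mulr0n addr0 addrA.
have NT : N^T = N by rewrite /N !linearD /= trmxK trmx1 -addrA [A^T + A]addrC addrA.
have [|D ND] := kernel_line (fixed_rank A3 A1) u0 _ NM.
  by rewrite mulmxBr uA mulmx1 subrr.
rewrite ND; congr (_ *m _); apply: (@scalerI _ _ (3 : R)); first by rewrite pnatr_eq0.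
by rewrite -[RHS]linearZ /= -uN trmx_mul NT ND -mulmxA dot_mul uu mul_mx_scalar.
Qed.

(* The rotations of order three about the line of direction [u] are [rmx u 1]
   and [rmx u 2]. *)
Definition rmx u (k : 'I_3) : 'M[R]_3 := \matrix_(i, j) (u 0 i * u 0 j *+ (j == i + k)).

Lemma diagonal_sqr u i : diagonal u -> u 0 i * u 0 i = 1.
Proof. by move/(_ i) => [->|->]; rewrite ?mulrNN mulr1. Qed.

Lemma dot_diagonal u : diagonal u -> dot u u = 3.
Proof. by move=> hu; rewrite /dot sum3 !diagonal_sqr //; ring. Qed.

Lemma diagonal_neq0 u : diagonal u -> u != 0.
Proof. by move=> hu; rewrite -dot_eq0 dot_diagonal // pnatr_eq0. Qed.

Lemma rmxM u k m : diagonal u -> rmx u k *m rmx u m = rmx u (k + m).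
Proof.
move=> hu; apply/matrixP => i j; rewrite !mxE (bigD1 (i + k)) //= big1 ?addr0.
  rewrite !mxE eqxx mulr1n mulrnAr -addrA; congr (_ *+ _).
  by rewrite mulrA -(mulrA (u 0 i)) diagonal_sqr // mulr1.
by move=> l /negbTE hl; rewrite !mxE hl mulr0n mul0r.
Qed.

Lemma rmx0 u : diagonal u -> rmx u 0 = 1%:M.
Proof.
move=> hu; apply/matrixP => i j; rewrite !mxE addr0 eq_sym.
by case: eqP => // <-; rewrite diagonal_sqr.
Qed.

Lemma rmxT u k : (rmx u k)^T = rmx u (- k).
Proof.
by apply/matrixP => i j; rewrite !mxE mulrC eq_sym -subr_eq opprK eq_sym; congr (_ *+ _);
  rewrite eq_sym.
Qed.

Lemma mul_rmx u k : diagonal u -> u *m rmx u k = u.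
Proof.
move=> hu; apply/rowP => j; rewrite mxE (bigD1 (j - k)) //= big1 ?addr0.
  by rewrite mxE subrK eqxx mulr1n mulrA diagonal_sqr // mul1r.
move=> l hl; have -> : rmx u k l j = 0; last by rewrite mulr0.
by rewrite mxE; case: (j =P l + k) hl => // ->; rewrite addrK eqxx.
Qed.

(** Squaring [a01 * u1 + a02 * u2 = u0] and comparing with the unit length of the row gives
    [a01 * a02 = 0]; in each of the two cases the other equations are linear. *)
Lemma rmx_entries (u0 u1 u2 a01 a02 a10 a12 a20 a21 : R) :
  u0 = 1 \/ u0 = -1 -> u1 = 1 \/ u1 = -1 -> u2 = 1 \/ u2 = -1 ->
  a01 + a10 = u0 * u1 -> a02 + a20 = u0 * u2 -> a12 + a21 = u1 * u2 ->
  a01 * u1 + a02 * u2 = u0 -> a10 * u0 + a12 * u2 = u1 -> a20 * u0 + a21 * u1 = u2 ->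
  a01 * a01 + a02 * a02 = 1 ->
  [/\ a01 = u0 * u1, a02 = 0 & a10 = 0] /\ [/\ a12 = u1 * u2, a20 = u0 * u2 & a21 = 0] \/
  [/\ a01 = 0, a02 = u0 * u2 & a10 = u0 * u1] /\ [/\ a12 = 0, a20 = 0 & a21 = u1 * u2].
Proof.
move=> h0 h1 h2 e1 e2 e3 e4 e5 e6 e7.
have sq (w : R) : w = 1 \/ w = -1 -> w * w = 1 by case=> ->; ring.
have /eqP : a01 * a02 = 0.
  have E : (a01 * u1 + a02 * u2) * (a01 * u1 + a02 * u2) = 1 by rewrite e4 (sq _ h0).
  have F : u1 * u2 * (a01 * a02) = 0.
    suff : 2 * (u1 * u2 * (a01 * a02)) = 0 by lra.
    transitivity ((a01 * u1 + a02 * u2) * (a01 * u1 + a02 * u2) -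
      (a01 * a01 * (u1 * u1) + a02 * a02 * (u2 * u2))); first by ring.
    by rewrite E (sq _ h1) (sq _ h2) !mulr1 e7 subrr.
  transitivity (u1 * u1 * (u2 * u2) * (a01 * a02)).
    by rewrite (sq _ h1) (sq _ h2) !mul1r.
  by transitivity (u1 * u2 * (u1 * u2 * (a01 * a02))); [ring | rewrite F mulr0].
rewrite mulf_eq0 => /orP[] /eqP z; [right | left]; rewrite z in e1 e2 e3 e4 e5 e6 e7 *;
  case: h0 h1 h2 e1 e2 e3 e4 e5 e6 e7 => -> [] -> [] -> *; (split; split; lra).
Qed.

(** By [order3_sum] the diagonal of [A] vanishes and [A i j + A j i = u_i u_j] off it; [rmx_entries]
    settles the remaining six entries. *)
Theorem rotation3_rmx u A : diagonal u -> orthogonal_mx A -> u *m A = u ->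
  A *m A *m A = 1%:M -> A != 1%:M -> A = rmx u i1 \/ A = rmx u i2.
Proof.
move=> hu AA uA A3 A1.
have S := order3_sum (diagonal_neq0 hu) (dot_diagonal hu) AA uA A3 A1.
have AS i j : A i j + A j i = u 0 i * u 0 j - (i == j)%:R.
  by have := congr1 (fun M : 'M[R]_3 => M i j) S; rewrite !mxE big_ord1 !mxE => <-; ring.
have Ad i : A i i = 0 by have := AS i i; rewrite eqxx diagonal_sqr // subrr => h; lra.
have uAT : u *m A^T = u by rewrite -{1}uA -mulmxA AA mulmx1.
have Ar i : \sum_j A i j * u 0 j = u 0 i.
  rewrite -[in RHS]uAT mxE; by apply: eq_bigr => j _; rewrite [in RHS]mxE mulrC.
have An : \sum_j A i0 j * A i0 j = 1.
  transitivity ((A *m A^T) i0 i0); last by rewrite AA mxE eqxx.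
  by rewrite mxE; apply: eq_bigr => j _; rewrite [in RHS]mxE.
have r0 := Ar i0; have r1 := Ar i1; have r2 := Ar i2; move: r0 r1 r2 An.
have s01 := AS i0 i1; have s02 := AS i0 i2; have s12 := AS i1 i2.
rewrite /= !subr0 in s01 s02 s12.
rewrite !sum3 !Ad !mul0r !add0r !addr0 => r0 r1 r2 An.
have := rmx_entries (hu i0) (hu i1) (hu i2) s01 s02 s12 r0 r1 r2 An.
case=> -[[h1 h2 h3] [h4 h5 h6]]; [left | right]; apply/matrixP => i j; rewrite mxE;
  have [->|[->|->]] := ord3_cases i; have [->|[->|->]] := ord3_cases j;
  rewrite ?Ad ?h1 ?h2 ?h3 ?h4 ?h5 ?h6 /= ?mulr1n ?mulr0n //; exact: mulrC.
Qed.
End Rotations.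

(** * Identification of R1 with the codes of trivial class *)

Local Arguments Z.mul : simpl never.
Definition class0 : coset := (false, false, Z0).
Definition zscale (c : Z) (x : zvec) : zvec :=
  let: (x1, x2, x3) := x in (Z.mul c x1, Z.mul c x2, Z.mul c x3).

(** A cyclic permutation whose entries carry the signs [u_i u_j] of a diagonal vector [u], hence the
    exclusive disjunctions; [k] chooses between the two rotations about its line. *)
Definition lrot (k s1 s2 s3 : bool) : lin :=
  if k then ((X2, s1 (+) s2), (X3, s2 (+) s3), (X1, s3 (+) s1))
  else ((X3, s3 (+) s1), (X1, s1 (+) s2), (X2, s2 (+) s3)).

Definition rot_code k s1 s2 s3 (z : zvec) : code :=
  let l := lrot k s1 s2 s3 in (l, zadd (zscale 4 z) (zopp (lapp Z.opp l (zscale 4 z)))).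

Definition special g := wf g /\ cls g = class0.

Lemma special_rot k s1 s2 s3 z : special (rot_code k s1 s2 s3 z).
Proof.
case: z => [[z1 z2] z3]; split.
  apply/andP; split; first by case: k.
  by apply/and3P; case: k; case: s1; case: s2; case: s3; rewrite /rot_code /lapp /sel /=; split;
    apply/Z.eqb_eq; lia.
rewrite /cls /class0; congr (_, _, _); try by case: k; case: s1; case: s2; case: s3.
by case: k; case: s1; case: s2; case: s3; rewrite /rot_code /shift_class /lapp /sel /=; lia.
Qed.

Lemma special_id : special code_id.
Proof. by []. Qed.

Lemma special_comp g h : special g -> special h -> special (ccomp g h).
Proof. by move=> [g1 g2] [h1 h2]; split; [exact: wf_comp | rewrite cls_comp // g2 h2]. Qed.

Lemma special_cinv g : special g -> special (cinv g).
Proof.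
move=> [g1 g2]; have w := wf_cinv g1; split=> //.
rewrite -(mulc1 (cls_all_cosets (cinv g))) -/class0 -g2 -cls_comp //.
by have [_ ->] := cinvK (proj1 (andP g1)).
Qed.

Section OddGroup.
Variable R : realType.
Local Open Scope classical_set_scope.
Local Open Scope ring_scope.
Local Notation E := 'rV[R]_3.
Local Notation V := (R * R * R)%type.
Local Notation diagonal := (@Defs.diagonal R).
Local Notation zr := (zr R).
Local Notation zr3 := (zr3 R).
Implicit Types (x y u v : E) (p q : V) (g h : code) (f : E -> E).

Definition usign (s1 s2 s3 : bool) : E :=
  row3 (if s1 then -1 else 1, if s2 then -1 else 1, if s3 then -1 else 1).

Lemma usign_diagonal s1 s2 s3 : diagonal (usign s1 s2 s3).
Proof.
by move=> i; have [->|[->|->]] := ord3_cases i; rewrite mxE /=;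
  [case: s1 | case: s2 | case: s3]; auto.
Qed.

Lemma diagonal_usign u : diagonal u -> exists s1 s2 s3, u = usign s1 s2 s3.
Proof.
move=> hu; have h i : exists s : bool, u 0 i = if s then -1 else 1.
  by case: (hu i) => ->; [exists false | exists true].
have [s1 e1] := h i0; have [s2 e2] := h i1; have [s3 e3] := h i2.
by exists s1, s2, s3; rewrite -[LHS]triK /tri e1 e2 e3.
Qed.

Definition turn (k : bool) : 'I_3 := if k then i2 else i1.

Lemma tri_rot k s1 s2 s3 x :
  tri (x *m rmx (usign s1 s2 s3) (turn k)) = lapp -%R (lrot k s1 s2 s3) (tri x).
Proof.
rewrite /tri !mxE !sum3 !mxE /=.
by case: k; case: s1; case: s2; case: s3;
  rewrite /= ?mulr1n ?mulr0n /lapp /sel /=; congr (_, _, _); ring.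
Qed.

Lemma tri_add x y : tri (x + y) = vadd (tri x) (tri y).
Proof. by rewrite /tri /= !mxE. Qed.

Lemma tri_opp x : tri (- x) = vscale (-1) (tri x).
Proof. by rewrite /tri /= !mxE !mulN1r. Qed.

Lemma lapp_vscale l a p : lapp -%R l (vscale a p) = vscale a (lapp -%R l p).
Proof.
case: l p => [[[a1 s1] [a2 s2]] [a3 s3]] [[x1 x2] x3]; rewrite /lapp /sel /=.
by case: a1 s1 a2 s2 a3 s3 => [] [] [] [] [] []; rewrite ?mulrN.
Qed.

Lemma tri_act g x : tri (act g x) = vadd (lapp -%R g.1 (tri x)) (vscale 4^-1 (zr3 g.2)).
Proof.
rewrite /act /unscaled row3K /app /scaled lapp_vscale.
case: (lapp _ _ _) (zr3 _) => [[a b] c] [[d e] f] /=.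
by rewrite !mulrDr !mulrA !mulVf ?mul1r // pnatr_eq0.
Qed.

Definition zcoords (z : 'rV[int]_3) : zvec := (Z_of_int (z 0 i0), Z_of_int (z 0 i1), Z_of_int (z 0 i2)).

Lemma zr_of_int (m : int) : zr (Z_of_int m) = m%:~R.
Proof. by rewrite /zr Z_of_intK. Qed.

Lemma tri_int_point z : tri (int_point R z) = zr3 (zcoords z).
Proof. by rewrite /tri !mxE /= !zr_of_int. Qed.

Lemma zcoords_surj (z : zvec) : exists z', zcoords z' = z.
Proof.
case: z => [[a b] c]; exists (\row_j nth 0 [:: int_of_Z a; int_of_Z b; int_of_Z c] j).
by rewrite /zcoords !mxE /= !int_of_ZK.
Qed.

Lemma act_rot k s1 s2 s3 z x : act (rot_code k s1 s2 s3 (zcoords z)) x =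
  int_point R z + (x - int_point R z) *m rmx (usign s1 s2 s3) (turn k).
Proof.
apply: tri_inj; rewrite tri_act tri_add tri_rot tri_add tri_opp lapp_vadd lapp_vscale tri_int_point.
rewrite /rot_code [(_, _).1]/= [(_, _).2]/=; set l := lrot _ _ _ _.
have -> : vscale 4^-1 (zr3 (zadd (zscale 4 (zcoords z)) (zopp (lapp Z.opp l (zscale 4 (zcoords z)))))) =
    vadd (zr3 (zcoords z)) (vscale (-1) (lapp -%R l (zr3 (zcoords z)))).
  have e4 w : zr3 (zscale 4 w) = vscale 4 (zr3 w) by case: w => [[a b] c] /=; rewrite !zrM.
  have eN w : zr3 (zopp w) = vscale (-1) (zr3 w) by case: w => [[a b] c] /=; rewrite !zrN !mulN1r.
  rewrite zr3_add eN lapp_zr3 e4 lapp_vscale.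
  case: (zr3 _) (lapp _ _ _) => [[a b] c] [[d e] f] /=; congr (_, _, _); lra.
have e (p q r : V) : vadd p (vadd q (vscale (-1) r)) = vadd q (vadd p (vscale (-1) r)).
  by case: p q r => [[a b] c] [[d e] f] [[a' b'] c'] /=; congr (_, _, _); ring.
exact: e.
Qed.

Lemma rmx_order3 u k : diagonal u -> rmx u k *m rmx u k *m rmx u k = 1%:M.
Proof.
move=> hu; rewrite !rmxM // (_ : k + k + k = 0) ?rmx0 //.
by have [->|[->|->]] := ord3_cases k; exact: val_inj.
Qed.

Lemma act_rot_rotation k s1 s2 s3 z : rotation3_about (int_point R z) (usign s1 s2 s3)
  (act (rot_code k s1 s2 s3 (zcoords z))).
Proof.
set u := usign _ _ _; have hu : diagonal u by exact: usign_diagonal.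
have A3 := rmx_order3 (turn k) hu; set A := rmx u (turn k) in A3.
have fE : act (rot_code k s1 s2 s3 (zcoords z)) =
    fun x => int_point R z + (x - int_point R z) *m A.
  by apply: funext => x; exact: act_rot.
split; last split.
- split; first exact: diagonal_neq0.
  exists A; split; last by move=> x; rewrite fE.
  + by rewrite /orthogonal_mx rmxT rmxM // subrr rmx0.
  + have : \det A ^+ 3 = 1 by rewrite !exprS expr0 mulr1 mulrA -!det_mulmx A3 det1.
    move/eqP; rewrite -subr_eq0 (_ : _ - 1 = (\det A - 1) * (\det A ^+ 2 + \det A + 1)); last by ring.
    rewrite mulf_eq0 subr_eq0 => /orP[/eqP //|/eqP h].
    by have : 0 <= (2 * \det A + 1) ^+ 2; [rewrite sqr_ge0 | lra].
  + exact: mul_rmx.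
- move=> fid; have A1 : A = 1%:M.
    apply/row_matrixP => i; rewrite !rowE mulmx1.
    have := congr1 (fun f => f (int_point R z + delta_mx 0 i)) fid.
    by rewrite fE /= => /addrI; rewrite [_ + delta_mx 0 i]addrC addrK.
  have := congr1 (fun M : 'M[R]_3 => M i0 i0) A1.
  by rewrite !mxE; case: (k) => /= /eqP; rewrite eq_sym oner_eq0.
- by apply: funext => x /=; rewrite !fE !(addrC (int_point R z)) !addrK -!mulmxA [A *m (A *m A)]mulmxA A3 mulmx1 subrK.
Qed.

Lemma rotation_act z u f : diagonal u -> rotation3_about (int_point R z) u f ->
  exists k s1 s2 s3, f = act (rot_code k s1 s2 s3 (zcoords z)).
Proof.
move=> hu [[u0 [A [AA _ uA fE]]] [f1 f3]].
have A3 : A *m A *m A = 1%:M.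
  apply/row_matrixP => i; rewrite !rowE mulmx1 !mulmxA.
  have := congr1 (fun f => f (int_point R z + delta_mx 0 i)) f3.
  by rewrite /= !fE => /addrI; rewrite !(addrC (int_point R z)) !addrK.
have A1 : A != 1%:M.
  by apply/eqP => A1; apply: f1; apply: funext => x; rewrite fE A1 mulmx1 addrC subrK.
have [s1 [s2 [s3 us]]] := diagonal_usign hu.
have [k Ak] : exists k, A = rmx u (turn k).
  by have [->|->] := rotation3_rmx hu AA uA A3 A1; [exists false | exists true].
by exists k, s1, s2, s3; apply: funext => x; rewrite act_rot fE Ak us.
Qed.

Definition special_acts : set (E -> E) := [set f | exists2 g, special g & f = act g].

Lemma special_acts_group : isometry_group special_acts.
Proof.
split.
- by move=> f [g [/andP[hg _] _] ->]; exact: act_isometry.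
- by exists code_id; [exact: special_id | rewrite act_id].
- move=> f f' [g hg ->] [h hh ->]; exists (ccomp g h); first exact: special_comp.
  by apply: funext => x; rewrite act_comp.
move=> f [g hg ->]; have [/andP[hp _] _] := hg.
exists (act (cinv g)); first by exists (cinv g) => //; exact: special_cinv.
by split=> x; rewrite ?act_cinv ?act_cinv'.
Qed.

Lemma R1_generators : [set f | exists z u, diagonal u /\ rotation3_about (int_point R z) u f]
  `<=` special_acts.
Proof.
move=> f [z [u [hu /(rotation_act hu)[k [s1 [s2 [s3 ->]]]]]]].
by exists (rot_code k s1 s2 s3 (zcoords z)) => //; exact: special_rot.
Qed.

Lemma R1_group : isometry_group (@R1 R).
Proof. exact: generated_group special_acts_group R1_generators. Qed.

Lemma R1_special : @R1 R `<=` special_acts.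
Proof. exact: generated_sub special_acts_group R1_generators. Qed.
End OddGroup.

Definition bools := [:: false; true].
(** Opposite directions give the same line, so the third sign can be fixed; these are the eight
    elements of order three of the tetrahedral rotation group. *)
Definition turns : seq lin :=
  [seq lrot ks.1 ks.2 s false | ks <- [seq (k, s) | k <- bools, s <- bools], s <- bools].

Lemma turns_generate : all (fun l => odd_axes l || flips l ||
  has (fun m => has (fun m' => eqlin l (lcomp m m')) turns) turns) all_lins.
Proof. by vm_compute. Qed.

Lemma in_turns m : List.In m turns -> exists k s1 s2, m = lrot k s1 s2 false.
Proof.
by move=> /in_allpairs[[k s1] [s2 [_ _ ->]]]; exists k, s1, s2.
Qed.

Section SpecialTranslations.
Local Open Scope Z_scope.
Definition ey : zvec := (0, 1, 0).
Definition ez : zvec := (0, 0, 1).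

Lemma zscale_rot l z :
  zadd (zscale 4 z) (zopp (lapp Z.opp l (zscale 4 z))) = zscale 4 (zadd z (zopp (lapp Z.opp l z))).
Proof.
have e c x : lapp Z.opp l (zscale c x) = zscale c (lapp Z.opp l x).
  case: l x => [[[a1 s1] [a2 s2]] [a3 s3]] [[x1 x2] x3]; rewrite /lapp /sel /=.
  by case: a1 s1 a2 s2 a3 s3 => [] [] [] [] [] []; rewrite ?Z.mul_opp_r.
rewrite e; case: z (lapp _ _ z) => [[z1 z2] z3] [[y1 y2] y3] /=; congr (_, _, _); lia.
Qed.

Lemma special_translation l b : special (l, b) ->
  exists d1 d2 d3, b = (4 * d1, 4 * d2, 4 * d3) /\ (d1 + d2 + d3) mod 2 = 0.
Proof.
case: b => [[b1 b2] b3] [/andP[_ /and3P[/Z.eqb_eq p1 /Z.eqb_eq p2 /Z.eqb_eq p3]] [_ _ p4]].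
exists (b1 / 4), (b2 / 4), (b3 / 4); split; last by lia.
by congr (_, _, _); lia.
Qed.
End SpecialTranslations.

Section OddGroupGenerated.
Variable R : realType.
Local Open Scope classical_set_scope.
Local Open Scope ring_scope.
Local Notation E := 'rV[R]_3.
Local Notation V := (R * R * R)%type.

Definition in_R1 g := @R1 R (act g).

Lemma in_R1_comp g h : in_R1 g -> in_R1 h -> in_R1 (ccomp g h).
Proof.
move=> hg hh; have [_ _ hc _] := R1_group R; have := hc _ _ hg hh.
by congr (R1 _); apply: funext => x; rewrite act_comp.
Qed.

Lemma in_R1_cinv g : perm_axes g.1 -> in_R1 g -> in_R1 (cinv g).
Proof.
move=> hp hg; have [_ _ _ hi] := R1_group R; have [f hf [h1 h2]] := hi _ hg.
rewrite /in_R1; suff -> : act (cinv g) = f by [].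
by apply: funext => x; rewrite -[in LHS](h2 x) act_cinv'.
Qed.

Lemma in_R1_id : in_R1 code_id.
Proof. by rewrite /in_R1 act_id; have [_ h _ _] := R1_group R. Qed.

Lemma in_R1_rot k s1 s2 s3 (z : zvec) : in_R1 (rot_code k s1 s2 s3 z).
Proof.
have [z' <-] := zcoords_surj z; apply: sub_generated.
exists z', (usign R s1 s2 s3); split; [exact: usign_diagonal | exact: act_rot_rotation].
Qed.

Definition shift (d : zvec) : code := (lin_id, zscale 4 d).

Lemma shift_add d e : in_R1 (shift d) -> in_R1 (shift e) -> in_R1 (shift (zadd d e)).
Proof.
move=> hd he; have := in_R1_comp hd he; congr (in_R1 (_, _)).
by case: d e {hd he} => [[d1 d2] d3] [[e1 e2] e3]; rewrite /= /zapp /lapp /sel /=; congr (_, _, _); lia.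
Qed.

Lemma shift_opp d : in_R1 (shift d) -> in_R1 (shift (zopp d)).
Proof.
move=> /(in_R1_cinv (g := shift d) isT); congr (in_R1 _); congr (_, _).
by case: d => [[d1 d2] d3]; rewrite /cinv /=; congr (_, _, _); lia.
Qed.

Lemma shift_scale m d : in_R1 (shift d) -> in_R1 (shift (zscale m d)).
Proof.
move=> hd; have nat_case n : in_R1 (shift (zscale (Z.of_nat n) d)).
  elim: n => [|n IH].
    by have := in_R1_id; congr (in_R1 (_, _)); case: (d) => [[d1 d2] d3] /=; congr (_, _, _); lia.
  have := shift_add IH hd; congr (in_R1 (shift _)).
  by case: (d) => [[d1 d2] d3] /=; congr (_, _, _); lia.
have [n [->|->]] : exists n, m = Z.of_nat n \/ m = Z.opp (Z.of_nat n).
  by exists (Z.to_nat (Z.abs m)); lia.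
- exact: nat_case.
have := shift_opp (nat_case n); congr (in_R1 (shift _)).
by case: (d) => [[d1 d2] d3] /=; congr (_, _, _); lia.
Qed.

Lemma in_R1_ext g h : (forall p : V, app g p = app h p) -> in_R1 g -> in_R1 h.
Proof. by move=> e; congr (R1 _); apply: funext => x; rewrite /act e. Qed.

Lemma app_shift d (p : V) : app (shift d) p = vadd p (zr3 R (zscale 4 d)).
Proof. by case: p => [[a b] c]. Qed.

Lemma app_v0 l (p : V) : app (l, v0) p = lapp -%R l p.
Proof.
rewrite /app [(l, v0).1]/= [(l, v0).2]/=; case: (lapp -%R l p) => [[a b] c] /=.
by rewrite !zr0 !addr0.
Qed.

Lemma in_R1_turn k s1 s2 s3 : in_R1 (lrot k s1 s2 s3, v0).
Proof.
have -> : (lrot k s1 s2 s3, v0) = rot_code k s1 s2 s3 v0.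
  by case: k; case: s1; case: s2; case: s3.
exact: in_R1_rot.
Qed.

(* The product of two opposite rotations of order three about parallel lines is
   a translation. *)
Lemma shift_rot k s1 s2 s3 (z : zvec) :
  in_R1 (shift (zadd z (zopp (lapp Z.opp (lrot k s1 s2 s3) z)))).
Proof.
set l := lrot k s1 s2 s3; have hl : perm_axes l by rewrite /l; case: (k).
have e0 := in_R1_turn k s1 s2 s3.
apply: in_R1_ext (in_R1_comp (in_R1_rot k s1 s2 s3 z) (in_R1_cinv (g := (l, v0)) hl e0)) => p.
rewrite app_comp app_shift -[in RHS](@app_cinv R (l, v0) p hl).
move: (app (cinv (l, v0)) p) => q; rewrite app_v0 /app.
by congr (vadd _ (zr3 R _)); exact: zscale_rot.
Qed.

Lemma in_R1_shift (d1 d2 d3 : Z) : Z.modulo (Z.add (Z.add d1 d2) d3) 2 = Z0 ->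
  in_R1 (shift (d1, d2, d3)).
Proof.
(* The three translations are by [(1, 1, 0)], [(-1, 1, 0)] and [(0, 1, 1)], a basis of the points of
   even coordinate sum; the coefficients below are exact halves by parity. *)
move=> hd; have h1 := shift_rot true false true false ey.
have h2 := shift_rot true false false false ey; have h3 := shift_rot true false true false ez.
have := shift_add (shift_scale d3 h3) (shift_add (shift_scale (Z.div (Z.sub (Z.add d1 d2) d3) 2) h1)
  (shift_scale (Z.div (Z.sub (Z.sub d2 d3) d1) 2) h2)).
by congr (in_R1 (shift _)); rewrite /= /lapp /sel /=; congr (_, _, _); lia.
Qed.

Lemma in_R1_special g : special g -> in_R1 g.
Proof.
case: g => l b hg; have [d1 [d2 [d3 [eb hd]]]] := special_translation hg.
have [/andP[hl _] [ho hf _]] := hg.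
have := all_in turns_generate (all_linsP hl); rewrite ho hf => /has_in[m hm /has_in[m' hm' /eqlinP el]].
have [k [s1 [s2 em]]] := in_turns hm; have [k' [s1' [s2' em']]] := in_turns hm'.
have hlv : in_R1 (l, v0).
  apply: in_R1_ext (in_R1_comp (in_R1_turn k s1 s2 false) (in_R1_turn k' s1' s2' false)) => p.
  by rewrite app_comp !app_v0 -em -em' -(lapp_comp _ _ _ (@opprK R)) -el.
apply: in_R1_ext (in_R1_comp (in_R1_shift hd) hlv) => p.
by rewrite app_comp app_shift app_v0 eb.
Qed.

Theorem R1E : @R1 R = @special_acts R.
Proof.
apply/seteqP; split; first exact: R1_special.
by move=> f [g hg ->]; exact: in_R1_special.
Qed.
End OddGroupGenerated.

Section IntegerLemmas.
Local Open Scope Z_scope.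

Lemma special_shift d1 d2 d3 : (d1 + d2 + d3) mod 2 = 0 -> special (shift (d1, d2, d3)).
Proof.
move=> hd; split.
  by rewrite /wf andTb; apply/and3P; split; apply/Z.eqb_eq; lia.
by rewrite /cls /class0 /shift /shift_class /=; congr (_, _, _); lia.
Qed.

Lemma sum_squares4 a b c : a * a + b * b + c * c = 4 ->
  (a = 2 \/ a = -2) /\ b = 0 /\ c = 0 \/ (b = 2 \/ b = -2) /\ a = 0 /\ c = 0 \/
  (c = 2 \/ c = -2) /\ a = 0 /\ b = 0.
Proof.
move=> h; have bound x y : 0 <= y -> x * x + y = 4 -> x = -2 \/ x = -1 \/ x = 0 \/ x = 1 \/ x = 2.
  by move=> y0 e; nia.
have sq x : 0 <= x * x by nia.
have ha := bound a (b * b + c * c) ltac:(nia) ltac:(nia).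
have hb := bound b (a * a + c * c) ltac:(nia) ltac:(nia).
have hc := bound c (a * a + b * b) ltac:(nia) ltac:(nia).
by case: ha hb hc h => [->|[->|[->|[->|->]]]] [->|[->|[->|[->|->]]]] [->|[->|[->|[->|->]]]] h; lia.
Qed.
End IntegerLemmas.

(** * The normalizer of R1 *)

Section Normalizer.
Variable R : realType.
Local Open Scope classical_set_scope.
Local Open Scope ring_scope.
Local Notation E := 'rV[R]_3.
Local Notation V := (R * R * R)%type.
Local Notation zr := (zr R).
Local Notation zr3 := (zr3 R).
Implicit Types (x y u v : E) (h k : E -> E).

Definition normalizes h k := forall r, special r ->
  exists2 r', special r' & forall x, h (act r (k x)) = act r' x.

(* The translations by the even points are those of R1. *)
Definition even_point x := exists d1 d2 d3,
  tri x = zr3 (d1, d2, d3) /\ Z.modulo (Z.add (Z.add d1 d2) d3) 2 = Z0.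

Lemma tri0 : tri (0 : E) = (0, 0, 0). Proof. by rewrite /tri !mxE. Qed.

Lemma act_shift d x : tri (act (shift d) x) = vadd (tri x) (zr3 d).
Proof.
rewrite tri_act; case: (tri x) d => [[a b] c] [[d1 d2] d3].
by rewrite /= !zrM zr4 !mulrA !mulVf ?mul1r // pnatr_eq0.
Qed.

Lemma even_special r : special r -> even_point (act r 0).
Proof.
case: r => l b hr; have [d1 [d2 [d3 [-> hd]]]] := special_translation hr.
exists d1, d2, d3; split=> //; rewrite tri_act tri0 [(_, _).2]/=.
have -> : lapp -%R (l, zscale 4 (d1, d2, d3)).1 (0, 0, 0) = (0, 0, 0) :> V.
  case: (l) => [[[a1 s1] [a2 s2]] [a3 s3]]; rewrite /lapp /sel /=.
  by case: a1 s1 a2 s2 a3 s3 => [] [] [] [] [] []; rewrite ?oppr0.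
by rewrite /= !zrM zr4 !add0r !mulrA !mulVf ?mul1r // pnatr_eq0.
Qed.

(** Conjugating the translation by [x] with [h] gives the translation by [x *m O], which is again in
    R1. *)
Lemma even_mul h k (O : 'M[R]_3) v x : normalizes h k -> cancel k h ->
  (forall x, h x = x *m O + v) -> even_point x -> even_point (x *m O).
Proof.
move=> hn kh hE [d1 [d2 [d3 [ex hd]]]]; have [r' hr' e] := hn _ (special_shift hd).
suff -> : x *m O = act r' 0 by exact: even_special.
rewrite -e; have -> : act (shift (d1, d2, d3)) (k 0) = k 0 + x.
  by apply: tri_inj; rewrite act_shift tri_add ex.
by rewrite hE mulmxDl addrAC -hE kh add0r.
Qed.

Lemma even_delta (i : 'I_3) : exists2 j, even_point (delta_mx 0 i + delta_mx 0 j : E) &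
  even_point (delta_mx 0 i - delta_mx 0 j : E).
Proof.
have [->|[->|->]] := ord3_cases i; [exists i1 | exists i0 | exists i0];
  [exists (Zpos xH), (Zpos xH), Z0 | exists (Zpos xH), (Zneg xH), Z0
  |exists (Zpos xH), (Zpos xH), Z0 | exists (Zneg xH), (Zpos xH), Z0
  |exists (Zpos xH), Z0, (Zpos xH) | exists (Zneg xH), Z0, (Zpos xH)];
  by split=> //; rewrite /tri !mxE /= ?subr0 ?sub0r ?addr0 ?add0r.
Qed.

Lemma zr_square_sum a b c (x y z : R) : 2 * x = zr a -> 2 * y = zr b -> 2 * z = zr c ->
  x * x + y * y + z * z = 1 -> exists (i : axis) (s : bool),
  (x, y, z) = (let e := if s then -1 else 1 in
    match i with X1 => (e, 0, 0) | X2 => (0, e, 0) | X3 => (0, 0, e) end).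
Proof.
move=> ex ey ez h; have /sum_squares4 : Z.add (Z.add (Z.mul a a) (Z.mul b b)) (Z.mul c c) = Zpos 4.
  by apply: (@zr_inj R); rewrite !zrD !zrM -ex -ey -ez zr4; lra.
have zm2 : zr (Zneg 2) = -2 by [].
case=> [[[e|e] [e' e'']]|[[[e|e] [e' e'']]|[[e|e] [e' e'']]]];
  rewrite e e' e'' ?zr2 ?zm2 ?zr0 in ex ey ez;
  [exists X1, false | exists X1, true | exists X2, false | exists X2, true
  |exists X3, false | exists X3, true]; rewrite /=; congr (_, _, _); lra.
Qed.

(* Twice a column of [O] is an integral vector of squared norm 4. *)
Lemma column_axis h k (O : 'M[R]_3) v : normalizes k h -> cancel h k -> O^T *m O = 1%:M ->
  (forall x, k x = x *m O^T + v) -> forall j, exists r, forall x, (x *m O) 0 j = sel -%R r (tri x).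
Proof.
move=> kn hk OO kE j.
have even_k := even_mul kn hk kE.
have [m e1 e2] := even_delta j.
have [a1 [a2 [a3 [ea _]]]] := even_k _ e1; have [b1 [b2 [b3 [eb _]]]] := even_k _ e2.
have OE i : ((delta_mx 0 j : E) *m O^T) 0 i = O i j by rewrite -rowE !mxE.
have ex : tri (delta_mx 0 j *m O^T) = (O i0 j, O i1 j, O i2 j) by rewrite /tri !OE.
have e3 : vadd (tri (delta_mx 0 j *m O^T)) (tri (delta_mx 0 j *m O^T)) =
    vadd (zr3 (a1, a2, a3)) (zr3 (b1, b2, b3)).
  by rewrite -ea -eb -!tri_add -!mulmxDl addrACA subrr addr0.
move: e3; rewrite ex /= => -[f1 f2 f3].
have norm : O i0 j * O i0 j + O i1 j * O i1 j + O i2 j * O i2 j = 1.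
  transitivity ((O^T *m O) j j); last by rewrite OO mxE eqxx.
  by rewrite mxE sum3 !mxE.
have [|||i [s e]] := @zr_square_sum (Z.add a1 b1) (Z.add a2 b2) (Z.add a3 b3) _ _ _ _ _ _ norm.
- by rewrite zrD -f1; ring.
- by rewrite zrD -f2; ring.
- by rewrite zrD -f3; ring.
exists (i, s) => x; rewrite mxE sum3; move: e; rewrite /sel /tri /=.
by case: i => -[-> -> ->]; case: s; ring.
Qed.

(** A repeated axis would give every value two coordinates of equal absolute value, which
    [(1, 2, 4)] does not have. *)
Lemma axes_perm (l : lin) : (forall p : V, exists q, lapp -%R l q = p) -> perm_axes l.
Proof.
move=> /(_ (1, 2, 4))[[[x1 x2] x3]]; case: l => [[[a1 s1] [a2 s2]] [a3 s3]].
rewrite /lapp /sel /= => -[e1 e2 e3].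
have n (s : bool) (a b : R) : (if s then - a else a) = b -> `|a| = `|b|.
  by case: s => <-; rewrite ?normrN.
move: (n _ _ _ e1) (n _ _ _ e2) (n _ _ _ e3) => {e1 e2 e3 n}; rewrite normr1 !normr_nat.
by case: a1; case: a2; case: a3 => //= *; exfalso; lra.
Qed.

(** The conjugate [k r h] lies in R1 and moves the origin to [(r v - v) *m O^T], an even point;
    multiplication by [O] keeps it even. *)
Lemma even_displacement h k (O : 'M[R]_3) v r : normalizes h k -> normalizes k h -> cancel k h ->
  O^T *m O = 1%:M -> (forall x, h x = x *m O + v) -> (forall x, k x = (x - v) *m O^T) ->
  special r -> even_point (act r v - v).
Proof.
move=> hn kn kh OO hE kE hr; have [r' hr' e] := kn r hr.
have h0 : h 0 = v by rewrite hE mul0mx add0r.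
have := even_mul hn kh hE (even_special hr'); rewrite -e h0 kE -mulmxA OO mulmx1.
exact.
Qed.

Lemma special_flips1 : special (lin1 false true true, v0). Proof. by []. Qed.
Lemma special_flips3 : special (lin1 true true false, v0). Proof. by []. Qed.

(** The linear part is a signed permutation by its columns. Two half-turns about coordinate axes
    have displacements [(0, -2 v2, -2 v3)] and [(-2 v1, -2 v2, 0)], and their being even says that
    the [2 v_i] are integers of equal parity, that is, that [4 v] is in the body-centred lattice. *)
Theorem normalizer_code h k : is_isometry h -> cancel h k -> cancel k h ->
  normalizes h k -> normalizes k h -> exists2 g, wf g & h = act g.
Proof.
move=> hi hk kh hn kn; have [A [v [AA AA' hE]]] := isometry_affine hi.
have kE x : k x = (x - v) *m A^T.
  by rewrite -{2}(kh x) hE addrK -mulmxA AA mulmx1.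
have kE' x : k x = x *m A^T + - (v *m A^T) by rewrite kE mulmxBl.
have [r1 e1] := column_axis kn hk AA' kE' i0; have [r2 e2] := column_axis kn hk AA' kE' i1.
have [r3 e3] := column_axis kn hk AA' kE' i2; pose l : lin := (r1, r2, r3).
have lE x : tri (x *m A) = lapp -%R l (tri x) by rewrite /tri e1 e2 e3.
have hl : perm_axes l.
  apply: axes_perm => p; exists (tri (row3 p *m A^T)).
  by rewrite -lE -mulmxA AA' mulmx1 row3K.
have flip r := @even_displacement h k A v r hn kn kh AA' hE kE.
have [d1 [d2 [d3 [ed hd]]]] := flip _ special_flips1.
have [f1 [f2 [f3 [ef hf]]]] := flip _ special_flips3.
move: ed ef; rewrite !tri_add !tri_opp !tri_act /lapp /= !zr0 !mulr0 !addr0 !mulN1r.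
rewrite /sel /= !subrr => -[/esym-/(@zr_inj R _ Z0) d10 ed2 ed3] [ef1 ef2 /esym-/(@zr_inj R _ Z0) f30].
have f2d : f2 = d2 by apply: (@zr_inj R); rewrite -ef2 -ed2.
pose b : zvec := (Z.mul (-2) f1, Z.mul (-2) d2, Z.mul (-2) d3).
exists (l, b).
  by rewrite /wf hl andTb; apply/and3P; split; apply/Z.eqb_eq; lia.
apply: funext => x; apply: tri_inj; rewrite hE tri_add lE tri_act; congr vadd.
have zm2 : zr (-2) = -2 by [].
by rewrite /b /= !zrM zm2 -ef1 -ed2 -ed3 /tri; congr (_, _, _); lra.
Qed.
End Normalizer.

(** * Full cubic groups *)

Lemma wf_perm g : wf g -> perm_axes g.1.
Proof. by case/andP. Qed.

Lemma member_wf H g : member H g -> wf g.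
Proof. by case/andP. Qed.

Section FullCubic.
Variable R : realType.
Local Open Scope classical_set_scope.
Local Open Scope ring_scope.
Local Open Scope card_scope.
Local Notation E := 'rV[R]_3.
Local Notation V := (R * R * R)%type.
Local Notation edist := (@Defs.edist R).
Implicit Types (x y u v : E) (f g w : E -> E) (G : set (E -> E)).

Lemma rotation3_conj f g w : is_isometry f -> cancel f g -> cancel g f -> rotation3 w ->
  rotation3 (f \o w \o g).
Proof.
move=> fi fg gf [p [u [[u0 [A [AA dA uA wE]]] [w1 w3]]]].
have [B [v [BB BB' fE]]] := isometry_affine fi.
have gE x y : g x - g y = (x - y) *m B^T.
  have e z : g z *m B = z - v by rewrite -[X in _ = X - v]gf fE addrK.
  by rewrite -[LHS]mulmx1 -BB mulmxA mulmxBl !e opprB addrA subrK.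
exists (f p), (u *m B); split; last split.
- split.
    by apply: contra_neq u0 => uB; rewrite -[u]mulmx1 -BB mulmxA uB mul0mx.
  exists (B^T *m A *m B); split.
  + rewrite /orthogonal_mx !trmx_mul trmxK !mulmxA -(mulmxA (B^T *m A)) BB mulmx1.
    by rewrite -(mulmxA B^T) AA mulmx1 BB'.
  + by rewrite !det_mulmx dA mulr1 -det_mulmx BB' det1.
  + by rewrite !mulmxA -(mulmxA u) BB mulmx1 uA.
  + move=> x; rewrite /= wE !fE mulmxDl addrAC; congr (_ + _).
    by rewrite -{1}(fg p) gE -!mulmxA fE.
- move=> e; apply: w1; apply: funext => x.
  by have := congr1 (fun h => g (h (f x))) e; rewrite /= !fg.
- apply: funext => x; rewrite /= !fg -[RHS]gf; congr f.
  exact: (congr1 (fun h => h (g x)) w3).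
Qed.

(** The maps whose conjugates are odd form a group that contains all rotations of order three of
    [G], hence the whole odd subgroup. *)
Lemma odd_conj G f g w : isometry_group G -> G f -> G g -> cancel f g -> cancel g f ->
  odd_subgroup G w -> odd_subgroup G (f \o w \o g).
Proof.
move=> hG Gf Gg fg gf; have [iG idG cG vG] := hG.
have oddG : isometry_group (odd_subgroup G) by apply: generated_group hG _ => ? [].
have [io ido co vo] := oddG.
pose W := [set w : E -> E | odd_subgroup G (f \o w \o g)].
suff : odd_subgroup G `<=` W by apply.
apply: generated_sub.
- split.
  + move=> h Wh x y; have := io _ Wh (f x) (f y).
    by rewrite /= !fg !(iG f Gf).
  + by rewrite /W /= (_ : f \o idfun \o g = idfun) //; apply: funext => x /=; rewrite gf.
  + move=> h h' Wh Wh'; have := co _ _ Wh Wh'; rewrite /W /=; congr odd_subgroup.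
    by apply: funext => x /=; rewrite fg.
  + move=> h Wh; have [k ok [hk kh]] := vo _ Wh; exists (g \o k \o f).
      rewrite /W /=; move: ok; congr odd_subgroup.
      by apply: funext => x /=; rewrite !gf.
    split=> x /=; first by have := hk (f x); rewrite /= fg => ->; rewrite fg.
    by have := kh (f x); rewrite /= => /(congr1 g); rewrite !fg.
- move=> h [Gh rh]; apply: sub_generated; split; last exact: rotation3_conj (iG f Gf) fg gf rh.
  exact: cG (cG _ _ Gf Gh) Gg.
Qed.

Section Group.
Variables (G : set (E -> E)) (s t : E -> E).
Hypotheses (hG : isometry_group G) (sim : similarity s) (st : cancel s t) (ts : cancel t s).
Hypothesis oddE : odd_subgroup G = [set s \o f \o t | f in @R1 R].

Lemma conj_isometry f : G f -> is_isometry (t \o f \o s).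
Proof.
move=> Gf x y; have [c c0 sE] := sim; apply: (mulfI (lt0r_neq0 c0)).
by rewrite -!sE /= !ts; have [iG _ _ _] := hG; rewrite iG.
Qed.

Lemma conj_normalizes f g : G f -> G g -> cancel f g -> cancel g f ->
  normalizes (t \o f \o s) (t \o g \o s).
Proof.
move=> Gf Gg fg gf r hr.
have : odd_subgroup G (s \o act r \o t) by rewrite oddE; exists (act r) => //; exact: in_R1_special.
move/(odd_conj hG Gf Gg fg gf); rewrite oddE R1E => -[r' [r'' hr'' ->] e].
by exists r'' => // x; have := congr1 (fun h => t (h (s x))) e; rewrite /= !st => ->.
Qed.

Lemma group_code f : G f -> exists2 g, wf g & forall x, f (s x) = s (act g x).
Proof.
move=> Gf; have [_ _ _ vG] := hG; have [k Gk [fk kf]] := vG f Gf.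
have [||||g hg e] := @normalizer_code R (t \o f \o s) (t \o k \o s) (conj_isometry Gf).
- by move=> x /=; rewrite ts fk st.
- by move=> x /=; rewrite ts kf st.
- exact: conj_normalizes.
- exact: conj_normalizes.
by exists g => // x; rewrite -e /= ts.
Qed.

Lemma special_group r : special r -> exists2 f, G f & forall x, f (s x) = s (act r x).
Proof.
move=> hr; exists (s \o act r \o t); last by move=> x /=; rewrite st.
have oddG : odd_subgroup G `<=` G by apply: generated_sub hG _ => f [].
by apply: oddG; rewrite oddE; exists (act r) => //; exact: in_R1_special.
Qed.

Variables (p : E) (g1 : code).
Hypothesis (wf1 : wf g1).
Let perm1 : perm_axes g1.1 := wf_perm wf1.
(** Coordinates adapted to the centre: [g1] normalizes R1, so elements of [G] are still given by
    codes, and [tau p] can be put in the fundamental tetrahedron. *)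
Let sigma (y : V) : E := s (unscaled (app (cinv g1) y)).
Let tau x : V := app g1 (scaled (t x)).

Lemma sigmaK : cancel sigma tau.
Proof. by move=> y; rewrite /tau /sigma st unscaledK app_cinv. Qed.

Lemma tauK : cancel tau sigma.
Proof. by move=> x; rewrite /sigma /tau app_cinv' // scaledK ts. Qed.

Lemma edist_sigma (a b c d : V) : (edist (sigma a) (sigma b) <= edist (sigma c) (sigma d)) =
  (dist2 a b <= dist2 c d).
Proof.
have [e e0 sE] := sim; have w1 := wf_perm (wf_cinv wf1).
have dE (a' b' : V) := dist2_app a' b' w1.
have i4 : 0 < 4^-1 :> R by rewrite invr_gt0.
by rewrite !sE !edist_unscaled !dE (ler_pM2l e0) (ler_pM2l i4) (ler_sqrt _ (dist2_ge0 c d)).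
Qed.

Definition in_group (g : code) := exists2 f, G f & forall y : V, f (sigma y) = sigma (app g y).

Lemma in_group_comp (g h : code) : in_group g -> in_group h -> in_group (ccomp g h).
Proof.
move=> [f Gf fE] [k Gk kE]; have [_ _ cG _] := hG; exists (f \o k); first exact: cG.
by move=> y; rewrite /= kE fE app_comp.
Qed.

Lemma in_group_special r : special r -> in_group r.
Proof.
move=> [r1 r2]; have hr : special (ccomp (cinv g1) (ccomp r g1)).
  have w1 := wf_cinv wf1; split; first exact: wf_comp w1 (wf_comp r1 wf1).
  rewrite (cls_comp w1 (wf_comp r1 wf1)) (cls_comp r1 wf1) r2 (mul1c (cls_all_cosets g1)).
  by rewrite -(cls_comp w1 wf1); have [_ ->] := cinvK perm1.
have [f Gf fE] := special_group hr; exists f => // y; rewrite /sigma fE /act unscaledK.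
by rewrite !app_comp app_cinv.
Qed.

Lemma code_in_group f : G f -> exists2 g, wf g & forall y : V, f (sigma y) = sigma (app g y).
Proof.
move=> Gf; have [g2 w2 e2] := group_code Gf; have w1 := wf_cinv wf1.
exists (ccomp g1 (ccomp g2 (cinv g1))); first exact: wf_comp wf1 (wf_comp w2 w1).
by move=> y; rewrite /sigma e2 /act unscaledK !app_comp app_cinv'.
Qed.

(** The codes differ by a special one, which belongs to the group; so a set of cosets describes the
    group completely. *)
Lemma in_group_cls (g g' : code) : wf g -> wf g' -> cls g = cls g' -> in_group g -> in_group g'.
Proof.
move=> w w' e hg; have wi := wf_cinv w.
have hs : special (ccomp g' (cinv g)).
  split; first exact: wf_comp w' wi.
  by rewrite (cls_comp w' wi) -e -(cls_comp w wi); have [-> _] := cinvK (wf_perm w).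
have [f Gf fE] := in_group_comp (in_group_special hs) hg; exists f => // y.
by rewrite fE !app_comp app_cinv' // (wf_perm w).
Qed.

Definition group_cosets : subgroup :=
  [seq `[< exists2 g, wf g /\ in_group g & cls g = a >] | a <- all_cosets].

Lemma member_group (g : code) : wf g -> member group_cosets g <-> in_group g.
Proof.
move=> w; rewrite /member w mem_cls_map; last exact: cls_all_cosets.
split=> [/asboolP[h [wh hh] e]|hg]; first exact: in_group_cls wh w e hh.
by apply/asboolP; exists g.
Qed.

Lemma group_cosets_ok : group_cosets \in subgroups.
Proof.
apply: subgroups_complete; first by rewrite size_map.
  have h := cls_all_cosets code_id; rewrite mem_cls_map //.
  by apply/asboolP; exists code_id => //; split=> //; exact: in_group_special.
move=> a b ha hb; rewrite !mem_cls_map //; last exact: in_mulc.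
move=> /asboolP[g [wg hg] <-] /asboolP[h [wh hh] <-]; apply/asboolP.
exists (ccomp g h); last exact: cls_comp.
by split; [exact: wf_comp | exact: in_group_comp].
Qed.

Hypothesis tp : tetra (tau p).

(** The similarity behind [sigma] preserves comparisons of distances, so [core] carries over and
    presents the cell by at most 25 bisectors, to which [facets_le] applies. *)
Lemma Voronoi_facets : [set F | facet (Voronoi_cell (point_orbit G p) p) F] #<= `I_25.
Proof.
have [Q [sQ Qg Qv]] := core group_cosets_ok tp.
have Q'p q : List.In q [seq sigma a | a <- Q] -> q != p.
  move=> /in_map[y /Qg[yp _] ->]; apply/eqP => e; apply: yp.
  by rewrite -[LHS]sigmaK e.
suff -> : Voronoi_cell (point_orbit G p) p =
    [set x | forall q, List.In q [seq sigma a | a <- Q] -> edist x p <= edist x q].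
  by apply: facets_le Q'p _ _; rewrite size_map.
apply/seteqP; split=> x hx.
  move=> q /in_map[y hy ->]; have [_ [g hg ey]] := Qg y hy.
  have wg := member_wf hg; have [f Gf fE] := (member_group wg).1 hg.
  apply: hx; exists f => //; by rewrite -{1}(tauK p) fE ey.
move=> q [f Gf <-]; have [g wg fE] := code_in_group Gf.
rewrite -(tauK x) -{1 2}(tauK p) fE edist_sigma; apply: Qv.
  move=> y hy; rewrite -edist_sigma !tauK; apply: hx; rewrite in_map; by exists y.
by apply/(member_group wg); exists f.
Qed.
End Group.
End FullCubic.

Local Open Scope classical_set_scope.
Local Open Scope ring_scope.
Local Open Scope card_scope.

Theorem theorem1p3 (R : realType) (G : set ('rV[R]_3 -> 'rV[R]_3)) :
  full_cubic G ->
  forall p : 'rV[R]_3,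
    [set F | facet (Voronoi_cell (point_orbit G p) p) F] #<= `I_25.
Proof.
move=> [[[hG _ _] _] [s [t [sim st ts oddE]]]] p.
have [g1 w1 tp] := equivalent_tetra (scaled (t p)).
exact (@Voronoi_facets R G s t hG sim st ts oddE p g1 w1 tp).
Qed.
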